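(* Let $(\mathcal F,U)$ be an $n$-dimensional system of fields and local relations and let $X_1,X_2$ be $n$-manifolds. The blob complex of a disjoint union is naturally isomorphic to the tensor product of the blob complexes: $$\mathcal B_*(X_1\sqcup X_2)\cong\mathcal B_*(X_1)\otimes\mathcal B_*(X_2).$$
   Context: Conventions. All manifolds are compact, unoriented and piecewise linear (PL); ''homeomorphism'' means PL homeomorphism; a $k$-ball is any manifold homeomorphic to the standard $k$-ball; $I=[0,1]$; $X\setminus Y$ denotes the closure of the complement when $Y$ is a closed codimension-0 submanifold. The tensor product of complexes has differential $d(a\otimes b)=da\otimes b+(-1)^{\deg a}a\otimes db$. System of fields. An $n$-dimensional system of fields $\mathcal F$ (enriched in vector spaces) consists of functors $\mathcal F$ from $k$-manifolds and homeomorphisms to sets, $0\le k\le n$, with: (1) natural restriction maps $\mathcal F(X)\to\mathcal F(\partial X)$; $\mathcal F(X;c)$ denotes the preimage of a boundary condition $c\in\mathcal F(\partial X)$. (2) If $\dim X=n$, each $\mathcal F(X;c)$ is a vector space, and all structure maps between fields on $n$-manifolds are linear. (3) $\mathcal F(X\sqcup W)\cong\mathcal F(X)\times\mathcal F(W)$ if $k<n$, and $\mathcal F(X\sqcup W;c\sqcup d)\cong\mathcal F(X;c)\otimes\mathcal F(W;d)$ if $k=n$, compatibly with homeomorphisms and boundary restriction. (4) Gluing: let $\partial X=(Y\sqcup Y)\cup W$ with $\partial(Y\sqcup Y)=\partial W$ (possibly empty), let $X_{gl}$ (resp. $W_{gl}$) be $X$ glued along the two copies of $Y$ (resp. $W$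 glued along the two copies of $\partial Y$), let $c_{gl}\in\mathcal F(W_{gl})$ be splittable along $\partial Y$ and let $c\in\mathcal F(W)$ be its cut-open version. There is an injective gluing map from the equalizer of the two restriction maps $\{x\in\mathcal F(X): x|_W=c\}\rightrightarrows\mathcal F(Y)$ to $\mathcal F(X_{gl};c_{gl})$, compatible with homeomorphisms, boundary restriction and disjoint union, and surjective up to homeomorphisms of $X_{gl}$ isotopic to the identity and collar maps (below). Fields in its image are called splittable along $Y$. Gluing of $x_1$ and $x_2$ is denoted $x_1\bullet x_2$. (5) For $c\in\mathcal F(X)$ and a properly embedded codimension-1 submanifold $Y\subset X$, $c$ splits along most (e.g. an open dense set of) small perturbations of $Y$. (6) Product fields: natural maps $\mathcal F(Y)\to\mathcal F(Y\times I)$, $c\mapsto c\times I$, commuting with all the structure above, with $f(c\times I)=\bar f(c)\times I$ for every fiber-preserving homeomorphism $f$ of $Y\times I$ covering $\bar f:Y\to Y$. For $Y\subset\partial M$ of codimension 0, a collaring homeomorphism is a homeomorphism $f:M\cup(Y\times I)\to M$ ($Y\times I$ glued to $M$ along $Y$) which is the identity outside a bicollar of $Y$ and preserves the fibers of the bicollar; the associated collar map is $x\mapsto f(x\bullet(x|_Y\times I))$, for $x\in\mathcal F(M)$ with $\partial x$ splittable along $\partial Y$. Extended isotopy is the equivalence relation generated by collar maps and homeomorphisms isotopic to the identity. Local relations. $U$ assigns to each $n$-ball $B$ and $c\in\mathcal F(\partial B)$ a subspace $U(B;c)\subset\mathcal F(B;c)$ such that: $f(U(B;c))=U(B';f(c))$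 for homeomorphisms $f:B\to B'$; $x-y\in U(B;c)$ if $x,y\in\mathcal F(B;c)$ are extended isotopic; and if $B=B'\cup B''$, $x\in U(B')$, $r\in\mathcal F(B'')$, then $x\bullet r\in U(B)$. Blob complex. A gluing decomposition of an $n$-manifold $X$ is a sequence $M_0\to M_1\to\cdots\to M_m=X$ of manifolds in which $M_i$ is obtained from $M_{i-1}$ by gluing together a disjoint pair of homeomorphic $(n-1)$-manifolds in $\partial M_{i-1}$. A field on $X$ is splittable along it if it is the image under gluing and disjoint union of fields on the components of $M_0$. A configuration of $k$ blobs in $X$ is an ordered collection of $k$ subsets $B_1,\dots,B_k$ of $X$ for which there is a gluing decomposition (called compatible with the configuration) such that each $B_i$ is the image in $X$ of a connected component of some $M_l$ which is a ball. $B_i$ is a twig blob if no other $B_j$ is a strict subset of it. A $k$-blob diagram is a configuration $\{B_1,\dots,B_k\}$ together with a field $r\in\mathcal F(X)$ splittable along some gluing decomposition compatible with the configuration, such that the restriction of $r$ to (the ball whose image is) each twig blob $B_i$ lies in $U(B_i)$. $\mathcal B_k(X)=\mathcal B_k(X;\mathcal F)$ is the direct sum over all configurations of $k$ blobs of the vector space of $k$-blob diagrams with that configuration (for instance, for one blob $B$ this space is $\bigoplus_{c\in\mathcal F(\partial B)}U(B;c)\otimes\mathcal F(X\setminus B;c)$), modulo identifying the spaces for configurations which differ by a permutation of the blobs via the sign of the permutation. In particular $\mathcal B_0(X)=\mathcal F(X)$. The differential is $\partial(\{B_1,\dots,B_k\},r)=\sum_{i=1}^k(-1)^{i+1}(\{B_1,\dots,\widehat{B_i},\dots,B_k\},r)$.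 If $\partial X\ne\emptyset$, a boundary condition $c\in\mathcal F(\partial X)$ is fixed, $\mathcal B_0(X;c)=\mathcal F(X;c)$ etc., and $c$ is usually omitted from the notation. ''Natural'' means natural with respect to homeomorphisms. *)

(* Defs.v *)
(* Mathematical Components, with the classical and reals layers of
   MathComp-Analysis *)
From HB Require Import structures.
From mathcomp Require Import all_boot all_order all_algebra all_fingroup.
From mathcomp Require Import lra zify.
From mathcomp Require Import all_classical all_reals.

Set Implicit Arguments.
Unset Strict Implicit.
Unset Printing Implicit Defensive.
Import Order.TTheory GRing.Theory Num.Theory.
Local Open Scope classical_set_scope.
Local Open Scope ring_scope.

(** * Modules presented by generators and relations *)

Section Presented.
Context {K : fieldType} {G : Type}.

Inductive expr : Type :=
| Egen of G
| Ezero
| Eadd of expr & expr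
| Escale of K & expr.

Context (rel : expr -> expr -> Prop).

(* the least module congruence containing rel *)
Inductive cong : expr -> expr -> Prop :=
| cong_rel x y : rel x y -> cong x y
| cong_refl x : cong x x
| cong_sym x y : cong x y -> cong y x
| cong_trans x y z : cong x y -> cong y z -> cong x z
| cong_add x x' y y' : cong x x' -> cong y y' -> cong (Eadd x y) (Eadd x' y')
| cong_scale a x x' : cong x x' -> cong (Escale a x) (Escale a x')
| cong_addA x y z : cong (Eadd x (Eadd y z)) (Eadd (Eadd x y) z)
| cong_addC x y : cong (Eadd x y) (Eadd y x)
| cong_add0 x : cong (Eadd Ezero x) x
| cong_addN x : cong (Eadd (Escale (-1) x) x) Ezero
| cong_scaleA a b x : cong (Escale a (Escale b x)) (Escale (a * b) x)
| cong_scale1 x : cong (Escale 1 x) x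
| cong_scaleDr a x y : cong (Escale a (Eadd x y)) (Eadd (Escale a x) (Escale a y))
| cong_scaleDl a b x : cong (Escale (a + b) x) (Eadd (Escale a x) (Escale b x)).

Definition pres : Type := {C : set expr | exists e, C = cong e}.

Lemma pres_eq (C D : pres) : sval C = sval D -> C = D.
Proof. by case: C D => C p [D q] /= e; subst D; rewrite (Prop_irrelevance p q). Qed.

Definition pres_cls (e : expr) : pres := exist _ (cong e) (ex_intro _ e erefl).
Definition pres_repr (C : pres) : expr := sval (cid (svalP C)).

Lemma reprK C : pres_cls (pres_repr C) = C.
Proof.
have e : sval C = cong (pres_repr C) by exact: (svalP (cid (svalP C))).
by apply: pres_eq; rewrite /= -e.
Qed.

Lemma eq_cls e e' : cong e e' -> pres_cls e = pres_cls e'.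
Proof.
move=> h; apply: pres_eq; apply/seteqP; split=> x /= hx.
  exact: cong_trans (cong_sym h) hx.
exact: cong_trans h hx.
Qed.

Lemma cls_inj e e' : pres_cls e = pres_cls e' -> cong e e'.
Proof.
move=> /(congr1 sval) /= h.
by rewrite h; exact: cong_refl.
Qed.

Lemma repr_cls e : cong (pres_repr (pres_cls e)) e.
Proof. by apply: cls_inj; rewrite reprK. Qed.

HB.instance Definition _ := gen_eqMixin pres.
HB.instance Definition _ := gen_choiceMixin pres.

Definition pres_add C D := pres_cls (Eadd (pres_repr C) (pres_repr D)).
Definition pres_scale a C := pres_cls (Escale a (pres_repr C)).

Lemma clsD x y : pres_add (pres_cls x) (pres_cls y) = pres_cls (Eadd x y).
Proof. by apply: eq_cls; apply: cong_add; exact: repr_cls. Qed.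

Lemma clsZ a x : pres_scale a (pres_cls x) = pres_cls (Escale a x).
Proof. by apply: eq_cls; apply: cong_scale; exact: repr_cls. Qed.

Lemma pres_ind (P : pres -> Prop) : (forall e, P (pres_cls e)) -> forall C, P C.
Proof. by move=> h C; rewrite -(reprK C). Qed.

Fact pres_addA : associative pres_add.
Proof.
elim/pres_ind=> x; elim/pres_ind=> y; elim/pres_ind=> z.
by rewrite !clsD; apply: eq_cls; exact: cong_addA.
Qed.
Fact pres_addC : commutative pres_add.
Proof.
elim/pres_ind=> x; elim/pres_ind=> y.
by rewrite !clsD; apply: eq_cls; exact: cong_addC.
Qed.
Fact pres_add0 : left_id (pres_cls Ezero) pres_add.
Proof. by elim/pres_ind=> x; rewrite clsD; apply: eq_cls; exact: cong_add0. Qed.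
Fact pres_addN : left_inverse (pres_cls Ezero) (pres_scale (-1)) pres_add.
Proof.
by elim/pres_ind=> x; rewrite clsZ clsD; apply: eq_cls; exact: cong_addN.
Qed.

HB.instance Definition _ :=
  GRing.isZmodule.Build pres pres_addA pres_addC pres_add0 pres_addN.

Fact pres_scaleA a b v : pres_scale a (pres_scale b v) = pres_scale (a * b) v.
Proof.
by elim/pres_ind: v => x; rewrite !clsZ; apply: eq_cls; exact: cong_scaleA.
Qed.
Fact pres_scale1 : left_id 1 pres_scale.
Proof. by elim/pres_ind=> x; rewrite clsZ; apply: eq_cls; exact: cong_scale1. Qed.
Fact pres_scaleDr : right_distributive pres_scale +%R.
Proof.
move=> a; elim/pres_ind=> x; elim/pres_ind=> y.
by rewrite /GRing.add /= !(clsD, clsZ); apply: eq_cls; exact: cong_scaleDr.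
Qed.
Fact pres_scaleDl v : {morph pres_scale^~ v : a b / a + b}.
Proof.
elim/pres_ind: v => x a b.
by rewrite {2}/GRing.add /= !(clsD, clsZ); apply: eq_cls; exact: cong_scaleDl.
Qed.

HB.instance Definition _ := GRing.Zmodule_isLmodule.Build K pres
  pres_scaleA pres_scale1 pres_scaleDr pres_scaleDl.

Definition pres_gen (g : G) : pres := pres_cls (Egen g).

Lemma clsDE x y : pres_cls (Eadd x y) = pres_cls x + pres_cls y.
Proof. by rewrite -clsD. Qed.
Lemma clsZE a x : pres_cls (Escale a x) = a *: pres_cls x.
Proof. by rewrite -clsZ. Qed.
Lemma cls0E : pres_cls Ezero = 0.
Proof. by []. Qed.

Section Lift.
Context {M : lmodType K} (f : G -> M).

Fixpoint eval (e : expr) : M :=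
  match e with
  | Egen g => f g
  | Ezero => 0
  | Eadd x y => eval x + eval y
  | Escale a x => a *: eval x
  end.

Definition respects := forall x y, rel x y -> eval x = eval y.

Context (fR : respects).

Lemma eval_cong x y : cong x y -> eval x = eval y.
Proof.
elim=> //= {x y}.
- by move=> x y z _ -> _ ->.
- by move=> x x' y y' _ -> _ ->.
- by move=> a x x' _ ->.
- by move=> x y z; rewrite addrA.
- by move=> x y; rewrite addrC.
- by move=> x; rewrite add0r.
- by move=> x; rewrite scaleN1r addNr.
- by move=> a b x; rewrite scalerA.
- by move=> x; rewrite scale1r.
- by move=> a x y; rewrite scalerDr.
- by move=> a b x; rewrite scalerDl.
Qed.

Definition plift_fun (C : pres) : M := eval (pres_repr C).

Lemma plift_cls e : plift_fun (pres_cls e) = eval e.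
Proof. by apply: eval_cong; exact: repr_cls. Qed.

Fact plift_is_linear : linear plift_fun.
Proof.
move=> a; elim/pres_ind=> x; elim/pres_ind=> y.
by rewrite -clsZE -clsDE !plift_cls.
Qed.

Definition plift : {linear pres -> M} :=
  HB.pack plift_fun (GRing.isLinear.Build K pres M *:%R plift_fun plift_is_linear).

Lemma plift_gen g : plift (pres_gen g) = f g.
Proof. exact: plift_cls. Qed.

End Lift.

Lemma linear_gen_eq (M : lmodType K) (f g : {linear pres -> M}) :
  (forall x, f (pres_gen x) = g (pres_gen x)) -> f =1 g.
Proof.
move=> h; elim/pres_ind; elim=> [x||x hx y hy|a x hx].
- exact: h.
- by rewrite cls0E !linear0.
- by rewrite clsDE !linearD hx hy.
- by rewrite clsZE !linearZ hx.
Qed.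

End Presented.

Arguments expr K G : clear implicits.
Arguments pres {K G} rel.
Arguments plift {K G rel M} f fR.
Arguments linear_gen_eq {K G rel M} f g.
Arguments plift : simpl never.

(** * Tensor products and chain complexes *)

Section Tensor.
Context {K : fieldType} (V W : lmodType K).

Inductive tens_rel : expr K (V * W) -> expr K (V * W) -> Prop :=
| tens_l a v v' w :
    tens_rel (Egen (a *: v + v', w)) (Eadd (Escale a (Egen (v, w))) (Egen (v', w)))
| tens_r a v w w' :
    tens_rel (Egen (v, a *: w + w')) (Eadd (Escale a (Egen (v, w))) (Egen (v, w'))).

Definition tens : lmodType K := pres tens_rel.
Definition pure_tens (v : V) (w : W) : tens := pres_gen tens_rel (v, w).

End Tensor.

Record complex (K : fieldType) := Complex {
  ch :> nat -> lmodType K;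
  dif : forall k, {linear ch k.+1 -> ch k};
  diff2 : forall k (x : ch k.+2), dif k (dif k.+1 x) = 0 }.

Record chain_map (K : fieldType) (C D : complex K) := ChainMap {
  cm :> forall k, {linear ch C k -> ch D k};
  cmP : forall k (x : ch C k.+1), cm k (dif C k x) = dif D k (cm k.+1 x) }.

Definition chain_iso (K : fieldType) (C D : complex K) (f : chain_map C D) :=
  forall k, bijective (f k).

Section TensorComplex.
Context {K : fieldType} (C D : complex K).

Definition tgen := ({p : nat & ch C p} * {q : nat & ch D q})%type.
Definition tg p q (a : ch C p) (b : ch D q) : tgen :=
  (existT (ch C) p a, existT (ch D) q b).

(* The degree k part is generated by all symbols a (x) b with a, b homogeneous;
   those of degree other than k are set to zero. *)
Inductive tc_rel (k : nat) : expr K tgen -> expr K tgen -> Prop :=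
| tc_deg p q (a : ch C p) (b : ch D q) : (p + q)%N <> k ->
    tc_rel k (Egen (tg a b)) (Ezero : expr K tgen)
| tc_l p q c (a a' : ch C p) (b : ch D q) :
    tc_rel k (Egen (tg (c *: a + a') b))
             (Eadd (Escale c (Egen (tg a b))) (Egen (tg a' b)))
| tc_r p q c (a : ch C p) (b b' : ch D q) :
    tc_rel k (Egen (tg a (c *: b + b')))
             (Eadd (Escale c (Egen (tg a b))) (Egen (tg a b'))).

Definition tc_ch (k : nat) : lmodType K := pres (tc_rel k).

Definition tsym k p q (a : ch C p) (b : ch D q) : tc_ch k :=
  pres_gen (tc_rel k) (tg a b).

(* the differential out of degree p, zero for p = 0 *)
Definition diff_pred (E : complex K) (p : nat) : {linear ch E p -> ch E p.-1} :=
  match p return {linear ch E p -> ch E p.-1} with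
  | 0 => (\0 : {linear ch E 0 -> ch E 0})
  | p'.+1 => dif E p'
  end.

Definition tc_diff_gen k (g : tgen) : tc_ch k :=
  let: (existT p a, existT q b) := g in
  tsym k (diff_pred C p a) b + (-1) ^+ p *: tsym k a (diff_pred D q b).

Lemma tsym_lin_l k p q c (a a' : ch C p) (b : ch D q) :
  tsym k (c *: a + a') b = c *: tsym k a b + tsym k a' b.
Proof. by rewrite /tsym /pres_gen -clsZE -clsDE; apply/eq_cls/cong_rel/tc_l. Qed.

Lemma tsym_lin_r k p q c (a : ch C p) (b b' : ch D q) :
  tsym k a (c *: b + b') = c *: tsym k a b + tsym k a b'.
Proof. by rewrite /tsym /pres_gen -clsZE -clsDE; apply/eq_cls/cong_rel/tc_r. Qed.

Lemma tsym_deg k p q (a : ch C p) (b : ch D q) : (p + q)%N <> k -> tsym k a b = 0.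
Proof. by move=> h; rewrite -cls0E; apply/eq_cls/cong_rel/tc_deg. Qed.

Lemma tsym0l k p q (b : ch D q) : tsym k (0 : ch C p) b = 0.
Proof.
have := tsym_lin_l k (-1) (0 : ch C p) 0 b.
by rewrite scaler0 add0r scaleN1r addNr.
Qed.

Lemma tsym0r k p q (a : ch C p) : tsym k a (0 : ch D q) = 0.
Proof.
have := tsym_lin_r k (-1) a (0 : ch D q) 0.
by rewrite scaler0 add0r scaleN1r addNr.
Qed.

Fact tc_diff_respects k : respects (tc_rel k.+1) (@tc_diff_gen k).
Proof.
move=> _ _ [p q a b h|p q c a a' b|p q c a b b'] /=.
- have -> : tsym k (diff_pred C p a) b = 0.
    case: p a h => [|p] a h /=; first exact: tsym0l.
    by apply: tsym_deg => e; apply: h; rewrite addSn e.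
  have -> : tsym k a (diff_pred D q b) = 0.
    case: q b h => [|q] b h /=; first exact: tsym0r.
    by apply: tsym_deg => e; apply: h; rewrite addnS e.
  by rewrite scaler0 addr0.
- rewrite !linearP !tsym_lin_l !scalerDr !scalerA (mulrC _ c).
  by rewrite addrACA.
- rewrite !linearP !tsym_lin_r !scalerDr !scalerA (mulrC _ c).
  by rewrite addrACA.
Qed.

Definition tc_diff k : {linear tc_ch k.+1 -> tc_ch k} :=
  plift (@tc_diff_gen k) (@tc_diff_respects k).

Arguments tc_diff : simpl never.

Lemma tc_diff_sym k p q (a : ch C p) (b : ch D q) :
  tc_diff k (tsym k.+1 a b) =
  tsym k (diff_pred C p a) b + (-1) ^+ p *: tsym k a (diff_pred D q b).
Proof. exact: plift_gen. Qed.

Lemma diff_pred2 (E : complex K) p (x : ch E p) :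
  diff_pred E p.-1 (diff_pred E p x) = 0.
Proof.
case: p x => [|[|p]] x //=; exact: diff2.
Qed.

Fact tc_diff2 k (x : tc_ch k.+2) : tc_diff k (tc_diff k.+1 x) = 0.
Proof.
have := @linear_gen_eq _ _ _ _
  ((tc_diff k \o tc_diff k.+1) : {linear tc_ch k.+2 -> tc_ch k})
  (\0 : {linear tc_ch k.+2 -> tc_ch k}).
apply=> {x} -[[p a] [q b]].
change (tc_diff k (tc_diff k.+1 (tsym k.+2 a b)) = 0).
rewrite tc_diff_sym linearD linearZ !tc_diff_sym.
rewrite !diff_pred2 tsym0l tsym0r scaler0 addr0 add0r -scalerDl.
case: p a => [|p] a /=; first by rewrite tsym0l scaler0.
by rewrite exprS mulN1r subrr scale0r.
Qed.

Definition tensor_complex : complex K := Complex tc_diff2.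

End TensorComplex.

Arguments tsym {K C D} k {p q} a b.
Arguments tc_diff {K} C D k : simpl never.

Section TensorMap.
Context {K : fieldType} {C C' D D' : complex K}.
Context (f : chain_map C C') (g : chain_map D D').

Definition tm_gen k (x : tgen C D) : tc_ch C' D' k :=
  let: (existT p a, existT q b) := x in tsym k (f p a) (g q b).

Fact tm_respects k : respects (tc_rel k) (@tm_gen k).
Proof.
move=> _ _ [p q a b h|p q c a a' b|p q c a b b'] /=.
- exact: tsym_deg.
- by rewrite linearP tsym_lin_l.
- by rewrite linearP tsym_lin_r.
Qed.

Definition tm k : {linear tc_ch C D k -> tc_ch C' D' k} :=
  plift (@tm_gen k) (@tm_respects k).

Arguments tm : simpl never.

Lemma tm_sym k p q (a : ch C p) (b : ch D q) :
  tm k (tsym k a b) = tsym k (f p a) (g q b).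
Proof. exact: plift_gen. Qed.

Lemma cm_diff_pred (A B : complex K) (h : chain_map A B) p (x : ch A p) :
  h _ (diff_pred A p x) = diff_pred B p (h p x).
Proof. by case: p x => [|p] x /=; [rewrite linear0 | rewrite cmP]. Qed.

Fact tmP k (x : tc_ch C D k.+1) :
  tm k (tc_diff C D k x) = tc_diff C' D' k (tm k.+1 x).
Proof.
have := @linear_gen_eq _ _ _ _
  ((tm k \o tc_diff C D k) : {linear tc_ch C D k.+1 -> tc_ch C' D' k})
  ((tc_diff C' D' k \o tm k.+1) : {linear tc_ch C D k.+1 -> tc_ch C' D' k}).
apply=> {x} -[[p a] [q b]].
change (tm k (tc_diff C D k (tsym k.+1 a b)) =
        tc_diff C' D' k (tm k.+1 (tsym k.+1 a b))).
by rewrite tc_diff_sym tm_sym tc_diff_sym linearD linearZ !tm_sym !cm_diff_pred.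
Qed.

Definition tensor_map :
    chain_map (tensor_complex C D) (tensor_complex C' D') :=
  @ChainMap K (tensor_complex C D) (tensor_complex C' D') tm tmP.

End TensorMap.

(** * Compact PL manifolds *)

(* All spaces are compact polyhedra in the space of real sequences; each of
   them lies in some R^N, and every compact PL manifold has such a copy.  A map
   from X is a function on the ambient space, of which only the values on X
   matter. *)

Section PL.
Context {R : realType}.

Definition pt : Type := nat -> R.
Definition space : Type := set pt.

Definition aff (N : nat) (a : R) (l : pt) (v : pt) : R :=
  a + \sum_(i < N) l i * v i.

(* compact convex polytopes *)
Definition cell (A : space) : Prop :=
  exists (N : nat) (M : R) (J : finType) (a : J -> R) (l : J -> pt),
    A = [set v | [/\ forall i, (N <= i)%N -> v i = 0,
                     forall i, `|v i| <= M
                   & forall j, 0 <= aff N (a j) (l j) v]].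

Definition affine_on (A : space) (f : pt -> pt) : Prop :=
  exists (N : nat) (b : nat -> R) (l : nat -> pt),
    forall v, A v -> forall j, f v j = aff N (b j) (l j) v.

Definition pl (X : space) (f : pt -> pt) : Prop :=
  exists (J : finType) (A : J -> space),
    X = [set v | exists j, A j v] /\ forall j, cell (A j) /\ affine_on (A j) f.

Definition polyhedron (X : space) : Prop :=
  exists (J : finType) (A : J -> space),
    X = [set v | exists j, A j v] /\ forall j, cell (A j).

Definition homeo (X Y : space) (f : pt -> pt) : Prop :=
  [/\ pl X f, f @` X = Y &
      exists g, [/\ pl Y g, g @` Y = X, (forall x, X x -> g (f x) = x)
                  & (forall y, Y y -> f (g y) = y)]].

Definition cube (d : nat) : space :=
  [set v | forall i, if (i < d)%N then 0 <= v i <= 1 else v i == 0].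
Definition open_cube (d : nat) : space :=
  [set v | forall i, if (i < d)%N then 0 < v i < 1 else v i == 0].

Definition pl_ball (d : nat) (B : space) : Prop := exists f, homeo (cube d) B f.

(* f maps the standard d-ball homeomorphically onto a neighbourhood of x in X *)
Definition chart (d : nat) (X : space) (x : pt) (f : pt -> pt) : Prop :=
  homeo (cube d) (f @` cube d) f /\
  exists A, [/\ polyhedron A, X = f @` cube d `|` A & ~ A x].

Definition pl_interior (d : nat) (X : space) : space :=
  [set x | exists f, chart d X x f /\ (f @` open_cube d) x].

(* Levels are dimensions plus one: [mfd k.+1 X] says that X is a k-manifold, and
   level 0 consists of the empty manifold of dimension -1, the boundary of a
   0-manifold.  That the boundary is a closed manifold is a theorem of PL
   topology, so requiring it does not restrict the class of manifolds. *)
Definition bnd (k : nat) (X : space) : space :=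
  match k with 0 => set0 | d.+1 => X `\` pl_interior d X end.

Fixpoint mfd (k : nat) (X : space) : Prop :=
  match k with
  | 0 => X = set0
  | d.+1 => [/\ polyhedron X, (forall x, X x -> exists f, chart d X x f),
                mfd d (bnd d.+1 X) & bnd d (bnd d.+1 X) = set0]
  end.

Definition pl_connected (X : space) : Prop :=
  forall A B, polyhedron A -> polyhedron B -> X = A `|` B -> A `&` B = set0 ->
    A = set0 \/ B = set0.

Definition pl_component (X C : space) : Prop :=
  [/\ C `<=` X, C !=set0, polyhedron C, polyhedron (X `\` C) & pl_connected C].

(** ** Disjoint unions, cylinders, isotopies *)

Definition pcons (t : R) (v : pt) : pt := fun i => if i is j.+1 then v j else t.
Definition ptl (v : pt) : pt := fun i => v i.+1.
Definition inj1 : pt -> pt := pcons 0.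
Definition inj2 : pt -> pt := pcons 1.

Definition dsum (X W : space) : space := inj1 @` X `|` inj2 @` W.
Definition cyl (X : space) : space := [set v | 0 <= v 0%N <= 1 /\ X (ptl v)].

Definition is_dsum (k : nat) (A B Z : space) : Prop :=
  [/\ mfd k A, mfd k B, mfd k Z, Z = A `|` B & A `&` B = set0].

Definition isotopic_id (X : space) (f : pt -> pt) : Prop :=
  homeo X X f /\
  exists H, homeo (cyl X) (cyl X) H /\ (forall v, cyl X v -> H v 0%N = v 0%N) /\
    forall x, X x -> H (pcons 0 x) = pcons 0 x /\ H (pcons 1 x) = pcons 1 (f x).

(** ** Gluing *)

(* q : X -> X' exhibits X' as the d-manifold X glued along the disjoint
   (d-1)-manifolds Y1, Y2 in its boundary by h : Y1 -> Y2; W is the closure of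
   the rest of the boundary of X. *)
Record gluing (d : nat) (X Y1 Y2 : space) (h : pt -> pt) (W X' : space)
    (q : pt -> pt) : Prop := Gluing {
  glu_src : mfd d.+1 X;
  glu_tgt : mfd d.+1 X';
  glu_Y1 : mfd d Y1;
  glu_Y2 : mfd d Y2;
  glu_W : mfd d W;
  glu_h : homeo Y1 Y2 h;
  glu_disj : Y1 `&` Y2 = set0;
  glu_bnd : bnd d.+1 X = (Y1 `|` Y2) `|` W;
  glu_bndW : bnd d W = (Y1 `|` Y2) `&` W;
  glu_bndY : bnd d (Y1 `|` Y2) = (Y1 `|` Y2) `&` W;
  glu_pl : pl X q;
  glu_surj : q @` X = X';
  glu_eq : forall x x', X x -> X x' ->
    q x = q x' <-> [\/ x = x', Y1 x /\ x' = h x | Y1 x' /\ x = h x'] }.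

(* [collaring d M Y g]: g : M + (Y x I) -> M is the composite of the gluing map
   M + (Y x I) -> M u (Y x I) and a collaring homeomorphism M u (Y x I) -> M.
   The inner half of the bicollar of Y is given by b : Y x I -> M, and A is the
   part of M outside the bicollar. *)
Definition collaring (d : nat) (M Y : space) (g : pt -> pt) : Prop :=
  (exists W, gluing d (dsum M (cyl Y)) (inj1 @` Y) (inj2 @` (pcons 0 @` Y))
               (inj2 \o pcons 0 \o ptl) W M g) /\
  exists b A,
    [/\ homeo (cyl Y) (b @` cyl Y) b, (forall y, Y y -> b (pcons 0 y) = y),
        polyhedron A /\ M = b @` cyl Y `|` A,
        A `&` (b @` cyl Y) = b @` (pcons 1 @` Y)
      & (forall x, A x -> g (inj1 x) = x) /\
        forall v, cyl Y v -> exists s t, [/\ 0 <= s <= 1, 0 <= t <= 1,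
          g (inj1 (b v)) = b (pcons s (ptl v))
        & g (inj2 v) = b (pcons t (ptl v))] ].

(** ** Homeomorphisms compose *)

Definition cutl (n : nat) (l : pt) : pt := fun i => if (i < n)%N then l i else 0.

Lemma aff_cut N n a l v : (forall i, (N <= i)%N -> v i = 0) ->
  aff n a l v = aff N a (cutl n l) v.
Proof.
move=> v0; rewrite /aff; congr (_ + _).
pose F i := cutl n l i * v i.
have -> : \sum_(i < n) l i * v i = \sum_(i < maxn N n) F i.
  rewrite (big_ord_widen (maxn N n) (fun i => l i * v i) (leq_maxr N n)).
  rewrite big_mkcond; apply: eq_bigr => i _; rewrite /F /cutl.
  by case: ifP => // _; rewrite mul0r.
rewrite (big_ord_widen (maxn N n) F (leq_maxl N n)).
rewrite [RHS]big_mkcond; apply: eq_bigr => i _; rewrite /F.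
by case: ltnP => // le; rewrite v0 // mulr0.
Qed.

Lemma aff_comp n m a l (b : nat -> R) (k : nat -> pt) (v : pt) :
  a + \sum_(i < n) l i * aff m (b i) (k i) v =
  aff m (a + \sum_(i < n) l i * b i) (fun j => \sum_(i < n) l i * k i j) v.
Proof.
rewrite /aff -addrA; congr (_ + _).
under eq_bigr => i _ do rewrite mulrDr.
rewrite big_split /=; congr (_ + _).
under eq_bigr => i _ do rewrite mulr_sumr.
rewrite exchange_big /=; apply: eq_bigr => j _.
by rewrite mulr_suml; apply: eq_bigr => i _; rewrite mulrA.
Qed.

Lemma affN N a l v : - aff N a l v = aff N (- a) (fun i => - l i) v.
Proof.
rewrite /aff opprD; congr (_ + _); rewrite -sumrN.
by apply: eq_bigr => i _; rewrite mulNr.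
Qed.

Lemma affDc N a b l v : aff N a l v + b = aff N (a + b) l v.
Proof. by rewrite /aff addrAC. Qed.

Lemma polyhedron_bound X : polyhedron X ->
  exists N, forall v, X v -> forall i, (N <= i)%N -> v i = 0.
Proof.
move=> [J [A [-> cA]]].
have [N NP] : exists N : J -> nat,
    forall j v, A j v -> forall i, (N j <= i)%N -> v i = 0.
  have [N NP] : {N : J -> nat &
      forall j v, A j v -> forall i, (N j <= i)%N -> v i = 0}.
    apply: (@choice J nat (fun j N =>
      forall v, A j v -> forall i, (N <= i)%N -> v i = 0)) => j.
    have [N [M [J' [a [l ->]]]]] := cA j.
    by exists N => v [].
  by exists N.
exists (\max_j N j)%N => v [j Av] i le; apply: (NP j v Av).
exact: leq_trans (leq_bigmax j) le.
Qed.

(* the part of a cell sent into another cell by an affine map is a cell *)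
Lemma cell_pre (N : nat) (A B : space) (f : pt -> pt) :
  cell A -> affine_on A f -> (forall v, A v -> forall i, (N <= i)%N -> f v i = 0) ->
  cell B -> cell [set v | A v /\ B (f v)].
Proof.
move=> [NA [MA [JA [aA [lA ->]]]]] [n [b [k fE]]] fN [NB [MB [JB [aB [lB ->]]]]].
pose J := (JA + ('I_N * bool) + ('I_N * bool) + (JB + unit))%type.
pose sg (s : bool) (x : R) := if s then x else - x.
pose a (j : J) : R := match j with
  | inl (inl (inl j)) => aA j
  | inl (inl (inr (i, s))) => if (NB <= i)%N then sg s (b i) else 0
  | inl (inr (i, s)) => sg s (b i) + MB
  | inr (inl j) => aB j + \sum_(i < NB) lB j i * b i
  | inr (inr _) => MB
  end.
pose l (j : J) : pt := match j with
  | inl (inl (inl j)) => lA j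
  | inl (inl (inr (i, s))) =>
      if (NB <= i)%N then cutl n (fun x => sg s (k i x)) else (fun=> 0)
  | inl (inr (i, s)) => cutl n (fun x => sg s (k i x))
  | inr (inl j) => cutl n (fun x => \sum_(i < NB) lB j i * k i x)
  | inr (inr _) => fun=> 0
  end.
have sgE s i v : sg s (aff n (b i) (k i) v) =
    aff n (sg s (b i)) (fun x => sg s (k i x)) v.
  by case: s => //=; rewrite affN.
have aff0 c v : aff NA c (fun=> 0) v = c.
  by rewrite /aff big1 ?addr0 // => x _; rewrite mul0r.
exists NA, MA, J, a, l; apply/seteqP; split=> v /=.
  move=> [Av [B1 B2 B3]]; have [A1 A2 A3] := Av.
  split=> //.
  move=> [[[j|[i s]]|[i s]]|[j|[]]] /=.
  - exact: A3.
  - case: leqP => NBi; last by rewrite aff0.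
    rewrite -aff_cut // -sgE -fE // B1 //.
    by case: s; rewrite /sg ?oppr0.
  - rewrite -aff_cut // -affDc -sgE -fE //.
    by have := B2 i; rewrite ler_norml /sg => /andP[h1 h2]; case: s; lra.
  - rewrite -aff_cut // -aff_comp; have := B3 j.
    by rewrite /aff; under eq_bigr => i _ do rewrite fE //.
  - rewrite aff0; exact: le_trans (B2 0%N).
move=> [C1 C2 C3].
have Av : [/\ forall i, (NA <= i)%N -> v i = 0, forall i, `|v i| <= MA
            & forall j, 0 <= aff NA (aA j) (lA j) v].
  by split=> // j; exact: (C3 (inl (inl (inl j)))).
split=> //; split.
- move=> i NBi; case: (ltnP i N) => iN; last exact: fN.
  have h s : 0 <= sg s (f v i).
    have := C3 (inl (inl (inr (Ordinal iN, s)))).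
    by rewrite /= NBi -aff_cut // -sgE -fE.
  by have := h true; have := h false; rewrite /sg; lra.
- move=> i; case: (ltnP i N) => iN; last first.
    by rewrite fN // normr0; have := C3 (inr (inr tt)); rewrite /= aff0.
  have h s : 0 <= sg s (f v i) + MB.
    have := C3 (inl (inr (Ordinal iN, s))).
    by rewrite /= -aff_cut // -affDc -sgE -fE.
  by rewrite ler_norml; have := h true; have := h false; rewrite /sg; lra.
- move=> j; have := C3 (inr (inl j)).
  rewrite /= -aff_cut // -aff_comp /aff.
  by under [X in _ -> 0 <= _ + X]eq_bigr => i _ do rewrite fE //.
Qed.

Lemma affine_comp (A B : space) (f g : pt -> pt) :
  affine_on A f -> affine_on B g ->
  affine_on [set v | A v /\ B (f v)] (g \o f).
Proof.
move=> [m [b [k fE]]] [n [c [l gE]]].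
exists m, (fun j => c j + \sum_(i < n) l j i * b i),
  (fun j x => \sum_(i < n) l j i * k i x) => v /= [Av Bv] j.
rewrite gE // -aff_comp /aff.
by under eq_bigr => i _ do rewrite fE //.
Qed.

Lemma pl_polyhedron X f : pl X f -> polyhedron X.
Proof. by move=> [J [A [e h]]]; exists J, A; split=> // j; case: (h j). Qed.

Lemma pl_comp X Y f g : pl X f -> f @` X = Y -> pl Y g -> pl X (g \o f).
Proof.
move=> [J [A [XE Af]]] fXY Yg.
have [N NP] := polyhedron_bound (pl_polyhedron Yg).
move: Yg => [J' [B [YE Bg]]].
exists (J * J')%type, (fun j => [set v | A j.1 v /\ B j.2 (f v)]); split.
  rewrite XE; apply/seteqP; split=> v /=.
    move=> [j Av].
    have : Y (f v) by rewrite -fXY; exists v => //; rewrite XE; exists j.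
    by rewrite YE => -[j' Bv]; exists (j, j').
  by move=> [[j j'] [Av _]]; exists j.
move=> [j j'] /=; have [cA fA] := Af j; have [cB gB] := Bg j'; split.
  apply: (cell_pre (N := N)) => // v Av; apply: NP.
  by rewrite -fXY; exists v => //; rewrite XE; exists j.
exact: affine_comp.
Qed.

Lemma homeo_comp X Y Z f g : homeo X Y f -> homeo Y Z g -> homeo X Z (g \o f).
Proof.
move=> [fpl fXY [f' [f'pl f'YX f'K fK]]] [gpl gYZ [g' [g'pl g'ZY g'K gK]]].
have fY x : X x -> Y (f x) by move=> Xx; rewrite -fXY; exists x.
have gY z : Z z -> Y (g' z) by move=> Zz; rewrite -g'ZY; exists z.
split; first exact: pl_comp fpl fXY gpl.
  by rewrite -gYZ -fXY image_comp.
exists (f' \o g'); split.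
- exact: pl_comp g'pl g'ZY f'pl.
- by rewrite -f'YX -g'ZY image_comp.
- by move=> x Xx /=; rewrite g'K ?f'K //; exact: fY.
- by move=> z Zz /=; rewrite fK ?gK //; exact: gY.
Qed.

End PL.

(** * Systems of fields *)

Definition lspan (K : fieldType) (V : lmodType K) (A : set V) : set V :=
  [set v | exists (m : nat) (a : 'I_m -> K) (w : 'I_m -> V),
     (forall i, A (w i)) /\ v = \sum_i a i *: w i].

(* [fl k X] is the set of fields on the (k-1)-manifold X; its values, and those
   of all operations, are only meaningful for manifolds, resp. for arguments to
   which the operation applies.  In dimension n, [topf c] is the vector space
   F(X;c), identified by [inc] with the set of fields restricting to c. *)
Record field_data (R : realType) (K : fieldType) (n : nat) := FieldData {
  fl : nat -> @space R -> Type;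
  fpush : forall k X X', (@pt R -> @pt R) -> fl k X -> fl k X';
  res : forall k X, fl k.+1 X -> fl k (bnd k.+1 X);
  topf : forall X, fl n (bnd n.+1 X) -> lmodType K;
  inc : forall X (c : fl n (bnd n.+1 X)), topf c -> fl n.+1 X;
  (* the field a u b on the disjoint union Z of A and B *)
  du : forall k A B Z, fl k A -> fl k B -> fl k Z;
  (* gluing of fields along the quotient map q : X -> X' *)
  gl : forall k X X', (@pt R -> @pt R) -> fl k X -> fl k X';
  (* the product field c x I *)
  times_I : forall k Y, fl k Y -> fl k.+1 (cyl Y) }.

Arguments fl {R K n} F k X : rename.
Arguments fpush {R K n} F {k X X'} f x : rename.
Arguments res {R K n} F {k X} x : rename.
Arguments topf {R K n} F {X} c : rename.
Arguments inc {R K n} F {X c} u : rename.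
Arguments du {R K n} F {k A B Z} a b : rename.
Arguments gl {R K n} F {k X X'} q x : rename.
Arguments times_I {R K n} F {k Y} c : rename.

Section FieldDefs.
Context {R : realType} {K : fieldType} {n : nat} (F : field_data R K n).
Local Notation space := (@space R).
Local Notation pt := (@pt R).

(* the glued field p . w on S = P u W; the gluing map is ptl, which folds the
   disjoint copies of P and W onto S *)
Definition bullet k (P W S : space) (p : fl F k P) (w : fl F k W) : fl F k S :=
  gl F ptl (du F (fpush F inj1 p : fl F k (inj1 @` P))
                 (fpush F inj2 w : fl F k (inj2 @` W)) : fl F k (dsum P W)).

(* p and w restrict to the same field on the common boundary of P and W *)
Definition agree k (P W : space) : fl F k P -> fl F k W -> Prop :=
  match k with
  | 0 => fun _ _ => True
  | e.+1 => fun p w => fpush F id (res F p) = res F w :> fl F e (bnd e.+1 W)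
  end.

(* The boundary field b on the boundary (Y1 u Y2) u W of X is (y u h(y)) . c:
   both restrictions to Y coincide, and c is the restriction to W. *)
Definition compat d (X Y1 Y2 : space) (h : pt -> pt) (W : space)
    (b : fl F d (bnd d.+1 X)) (y : fl F d Y1) (c : fl F d W) : Prop :=
  let p : fl F d (Y1 `|` Y2) := du F y (fpush F h y : fl F d Y2) in
  agree p c /\ b = bullet (bnd d.+1 X) p c.

(* c is obtained by cutting open along the boundary of Y1 a field on the
   boundary of the glued manifold *)
Definition cut_open d (Y1 Y2 : space) (h : pt -> pt) (W : space) :
    fl F d W -> Prop :=
  match d with
  | 0 => fun _ => True
  | e.+1 => fun c => exists y : fl F e (bnd e.+1 Y1),
      res F c = du F y (fpush F h y : fl F e (bnd e.+1 Y2))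
  end.

(* images of the gluing map, with boundary condition c on W *)
Definition glued d (X Y1 Y2 : space) (h : pt -> pt) (W X' : space)
    (q : pt -> pt) (c : fl F d W) : set (fl F d.+1 X') :=
  [set x' | exists (x : fl F d.+1 X) (y : fl F d Y1),
     compat Y2 h (res F x) y c /\ x' = gl F q x].

Definition collar_move d (M : space) (x x' : fl F d.+1 M) : Prop :=
  exists (Y W : space) (g : pt -> pt) (y : fl F d Y) (w : fl F d W),
    [/\ [/\ mfd d Y, mfd d W, bnd d.+1 M = Y `|` W,
            bnd d Y = Y `&` W & bnd d W = Y `&` W],
        collaring d M Y g,
        agree y w /\ res F x = bullet (bnd d.+1 M) y w
      & x' = gl F g (du F (fpush F inj1 x : fl F d.+1 (inj1 @` M))
                  (fpush F inj2 (times_I F y) : fl F d.+1 (inj2 @` cyl Y))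
                : fl F d.+1 (dsum M (cyl Y)))].

Inductive ext_isotopic d (M : space) : fl F d.+1 M -> fl F d.+1 M -> Prop :=
| exti_iso f x : isotopic_id M f -> ext_isotopic x (fpush F f x)
| exti_collar x x' : collar_move x x' -> ext_isotopic x x'
| exti_refl x : ext_isotopic x x
| exti_sym x y : ext_isotopic x y -> ext_isotopic y x
| exti_trans x y z : ext_isotopic x y -> ext_isotopic y z -> ext_isotopic x z.

(* phi restricts to a linear map F(X;c) -> F(X';c') *)
Definition linear_fib (X X' : space) (phi : fl F n.+1 X -> fl F n.+1 X')
    (c : fl F n (bnd n.+1 X)) (c' : fl F n (bnd n.+1 X')) : Prop :=
  exists L : {linear topf F c -> topf F c'}, forall u, phi (inc F u) = inc F (L u).

Definition cyl_map (q : pt -> pt) : pt -> pt :=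
  fun v => pcons (v 0%N) (q (ptl v)).

Record is_fields : Prop := IsFields {
  (* functors on manifolds and homeomorphisms *)
  fpush_ext : forall k X X' (f g : pt -> pt) (x : fl F k X), (k <= n.+1)%N ->
    mfd k X -> mfd k X' -> (forall v, X v -> f v = g v) ->
    fpush F f x = fpush F g x :> fl F k X';
  fpush_id : forall k X (x : fl F k X), (k <= n.+1)%N -> mfd k X ->
    fpush F id x = x;
  fpush_comp : forall k X X' X'' f g (x : fl F k X), (k <= n.+1)%N ->
    mfd k X -> mfd k X' -> mfd k X'' -> homeo X X' f -> homeo X' X'' g ->
    fpush F (g \o f) x = fpush F g (fpush F f x : fl F k X') :> fl F k X'';
  (* boundary restriction *)
  res_fpush : forall d X X' f (x : fl F d.+1 X), (d <= n)%N ->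
    mfd d.+1 X -> mfd d.+1 X' -> homeo X X' f ->
    res F (fpush F f x : fl F d.+1 X') = fpush F f (res F x);
  (* vector spaces in dimension n *)
  inc_inj : forall X (c : fl F n (bnd n.+1 X)), mfd n.+1 X ->
    injective (inc F (c := c));
  res_inc : forall X (c : fl F n (bnd n.+1 X)) (u : topf F c), mfd n.+1 X ->
    res F (inc F u) = c;
  inc_surj : forall X (x : fl F n.+1 X), mfd n.+1 X ->
    exists u : topf F (res F x), inc F u = x;
  fpush_linear : forall X X' f (c : fl F n (bnd n.+1 X)),
    mfd n.+1 X -> mfd n.+1 X' -> homeo X X' f ->
    linear_fib (fpush F f : fl F n.+1 X -> fl F n.+1 X') c (fpush F f c);
  (* disjoint unions *)
  du_fpush : forall k A B Z A' B' Z' f (a : fl F k A) (b : fl F k B),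
    (k <= n.+1)%N -> is_dsum k A B Z -> is_dsum k A' B' Z' ->
    homeo Z Z' f -> homeo A A' f -> homeo B B' f ->
    fpush F f (du F a b : fl F k Z) =
      du F (fpush F f a : fl F k A') (fpush F f b : fl F k B') :> fl F k Z';
  du_comm : forall k A B Z (a : fl F k A) (b : fl F k B), (k <= n.+1)%N ->
    is_dsum k A B Z -> du F a b = du F b a :> fl F k Z;
  du_assoc : forall k A B C AB BC Z
      (a : fl F k A) (b : fl F k B) (c : fl F k C), (k <= n.+1)%N ->
    is_dsum k A B AB -> is_dsum k B C BC -> is_dsum k A BC Z ->
    is_dsum k AB C Z ->
    du F a (du F b c : fl F k BC) = du F (du F a b : fl F k AB) c :> fl F k Z;
  (* the empty manifold carries the trivial field *)
  du_unit : forall k, (k <= n.+1)%N -> exists e : fl F k set0,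
    forall X (x : fl F k X), mfd k X -> du F x e = x;
  du_res : forall d A B Z (a : fl F d.+1 A) (b : fl F d.+1 B), (d <= n)%N ->
    is_dsum d.+1 A B Z ->
    res F (du F a b : fl F d.+1 Z) = du F (res F a) (res F b);
  du_bij : forall k A B Z, (k <= n)%N -> is_dsum k A B Z -> forall z : fl F k Z,
    exists! ab : fl F k A * fl F k B, z = du F ab.1 ab.2;
  du_tens : forall A B Z (a : fl F n (bnd n.+1 A)) (b : fl F n (bnd n.+1 B)),
    is_dsum n.+1 A B Z ->
    exists L : {linear tens (topf F a) (topf F b) ->
                       topf F (du F a b : fl F n (bnd n.+1 Z))},
      bijective L /\
      forall u v, inc F (L (pure_tens u v)) = du F (inc F u) (inc F v);
  (* gluing *)
  gl_ext : forall k X X' (q q' : pt -> pt) (x : fl F k X), (k <= n.+1)%N ->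
    mfd k X -> mfd k X' -> (forall v, X v -> q v = q' v) ->
    gl F q x = gl F q' x :> fl F k X';
  gl_empty : forall d X h W X' q (x : fl F d.+1 X), (d <= n)%N ->
    gluing d X set0 set0 h W X' q -> gl F q x = fpush F q x :> fl F d.+1 X';
  gl_fpush : forall d X Y1 Y2 h W X' q Z T1 T2 k V Z' r (f f' : pt -> pt)
      (x : fl F d.+1 X) (y : fl F d Y1) (c : fl F d W), (d <= n)%N ->
    gluing d X Y1 Y2 h W X' q -> gluing d Z T1 T2 k V Z' r ->
    homeo X Z f -> homeo X' Z' f' -> (forall v, X v -> f' (q v) = r (f v)) ->
    compat Y2 h (res F x) y c ->
    fpush F f' (gl F q x : fl F d.+1 X') =
      gl F r (fpush F f x : fl F d.+1 Z) :> fl F d.+1 Z';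
  gl_res : forall d X Y1 Y2 h W X' q
      (x : fl F d.+1 X) (y : fl F d Y1) (c : fl F d W), (d <= n)%N ->
    gluing d X Y1 Y2 h W X' q -> compat Y2 h (res F x) y c ->
    res F (gl F q x : fl F d.+1 X') = gl F q c;
  gl_du : forall d X Y1 Y2 h W X' Z T1 T2 k V Z' XZ XZ' q
      (x : fl F d.+1 X) (y : fl F d Y1) (c : fl F d W)
      (z : fl F d.+1 Z) (t : fl F d T1) (v : fl F d V), (d <= n)%N ->
    gluing d X Y1 Y2 h W X' q -> gluing d Z T1 T2 k V Z' q ->
    is_dsum d.+1 X Z XZ -> is_dsum d.+1 X' Z' XZ' ->
    compat Y2 h (res F x) y c -> compat T2 k (res F z) t v ->
    gl F q (du F x z : fl F d.+1 XZ) =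
      du F (gl F q x : fl F d.+1 X') (gl F q z : fl F d.+1 Z')
        :> fl F d.+1 XZ';
  gl_inj : forall d X Y1 Y2 h W X' q (x x' : fl F d.+1 X) (y y' : fl F d Y1)
      (c : fl F d W), (d < n)%N -> gluing d X Y1 Y2 h W X' q ->
    compat Y2 h (res F x) y c -> compat Y2 h (res F x') y' c ->
    gl F q x = gl F q x' :> fl F d.+1 X' -> x = x';
  gl_linear : forall X Y1 Y2 h W X' q (b : fl F n (bnd n.+1 X))
      (y : fl F n Y1) (c : fl F n W), gluing n X Y1 Y2 h W X' q ->
    compat Y2 h b y c ->
    linear_fib (gl F q : fl F n.+1 X -> fl F n.+1 X') b (gl F q c);
  (* in dimension n the equalizer is the direct sum, over the fields y on Y,
     of the spaces of fields on X restricting to y on both copies of Y *)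
  gl_inj_top : forall X Y1 Y2 h W X' q (c : fl F n W) (c' : fl F n (bnd n.+1 X'))
      m (y : 'I_m -> fl F n Y1) (b : 'I_m -> fl F n (bnd n.+1 X))
      (u : forall i, topf F (b i)) (w : 'I_m -> topf F c'),
    gluing n X Y1 Y2 h W X' q -> injective y ->
    (forall i, compat Y2 h (b i) (y i) c) ->
    (forall i, inc F (w i) = gl F q (inc F (u i))) ->
    \sum_i w i = 0 -> forall i, u i = 0;
  gl_surj : forall d X Y1 Y2 h W X' q (c : fl F d W) (x' : fl F d.+1 X'),
    (d < n)%N -> gluing d X Y1 Y2 h W X' q -> cut_open Y1 Y2 h c ->
    res F x' = gl F q c ->
    exists2 z, glued X Y1 Y2 h q c z & ext_isotopic z x';
  gl_surj_top : forall X Y1 Y2 h W X' q (c : fl F n W)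
      (c' : fl F n (bnd n.+1 X')) (u' : topf F c'),
    gluing n X Y1 Y2 h W X' q -> cut_open Y1 Y2 h c -> c' = gl F q c ->
    exists2 z : topf F c',
      lspan [set w : topf F c' | glued X Y1 Y2 h q c (inc F w)] z &
      ext_isotopic (inc F z) (inc F u');
  (* splitting along arbitrarily small perturbations of the image of Y *)
  split_near : forall d X Y1 Y2 h W X' q (x' : fl F d.+1 X') (e : R),
    (d < n)%N -> gluing d X Y1 Y2 h W X' q -> 0 < e ->
    exists p, [/\ isotopic_id X' p,
      forall v, X' v -> forall i, `|p v i - v i| < e
      & exists c : fl F d W, glued X Y1 Y2 h (p \o q) c x'];
  split_near_top : forall X Y1 Y2 h W X' q (c' : fl F n (bnd n.+1 X'))
      (u' : topf F c') (e : R), gluing n X Y1 Y2 h W X' q -> 0 < e ->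
    exists p, [/\ isotopic_id X' p,
      forall v, X' v -> forall i, `|p v i - v i| < e
      & exists c : fl F n W,
          lspan [set w : topf F c' | glued X Y1 Y2 h (p \o q) c (inc F w)] u'];
  (* product fields *)
  times_I_fib : forall k Y Y' f g (c : fl F k Y), (k <= n)%N ->
    mfd k Y -> mfd k Y' -> homeo (cyl Y) (cyl Y') f -> homeo Y Y' g ->
    (forall v, cyl Y v -> ptl (f v) = g (ptl v)) ->
    fpush F f (times_I F c) = times_I F (fpush F g c : fl F k Y');
  times_I_res : forall k Y (c : fl F k.+1 Y), (k < n)%N -> mfd k.+1 Y ->
    res F (times_I F c) =
      bullet (bnd k.+2 (cyl Y))
        (du F (fpush F (pcons 0) c : fl F k.+1 (pcons 0 @` Y))
              (fpush F (pcons 1) c : fl F k.+1 (pcons 1 @` Y))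
          : fl F k.+1 (pcons 0 @` Y `|` pcons 1 @` Y))
        (times_I F (res F c));
  times_I_du : forall k A B Z (a : fl F k A) (b : fl F k B), (k <= n)%N ->
    is_dsum k A B Z ->
    times_I F (du F a b : fl F k Z) = du F (times_I F a) (times_I F b);
  times_I_gl : forall d X Y1 Y2 h W X' q
      (x : fl F d.+1 X) (y : fl F d Y1) (c : fl F d W), (d < n)%N ->
    gluing d X Y1 Y2 h W X' q -> compat Y2 h (res F x) y c ->
    times_I F (gl F q x : fl F d.+1 X') = gl F (cyl_map q) (times_I F x)
}.

End FieldDefs.

Record system_of_fields (R : realType) (K : fieldType) (n : nat) :=
  SystemOfFields {
    sof_data :> field_data R K n;
    sof_fields : is_fields sof_data }.

(** * Gluing decompositions and local relations *)

Section Splittings.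
Context {R : realType} {K : fieldType} {n : nat} (F : field_data R K n).
Local Notation space := (@space R).
Local Notation pt := (@pt R).

(* fields that are disjoint unions of fields on the connected components *)
Inductive componentwise : forall Z : space, fl F n.+1 Z -> Prop :=
| cw_connected Z (x : fl F n.+1 Z) : pl_connected Z -> componentwise x
| cw_du A B Z (a : fl F n.+1 A) (b : fl F n.+1 B) : is_dsum n.+1 A B Z ->
    componentwise a -> componentwise b ->
    componentwise (du F a b : fl F n.+1 Z).

(* A gluing decomposition M_0 -> ... -> M_m = X along which x splits, with the
   fields on the M_i; the identification of M_m with X is a homeomorphism. *)
Record splitting (X : space) (x : fl F n.+1 X) := Splitting {
  len : nat;
  stage : nat -> space;
  quo : nat -> pt -> pt;
  sfl : forall i, fl F n.+1 (stage i);
  last_homeo : pt -> pt;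
  stage_mfd : forall i, (i <= len)%N -> mfd n.+1 (stage i);
  stage_glue : forall i, (i < len)%N ->
    exists Y1 Y2 h W (y : fl F n Y1) (c : fl F n W),
    [/\ gluing n (stage i) Y1 Y2 h W (stage i.+1) (quo i),
        compat Y2 h (res F (sfl i)) y c & sfl i.+1 = gl F (quo i) (sfl i)];
  split_start : componentwise (sfl 0);
  last_homeoP : homeo (stage len) X last_homeo;
  last_field : x = fpush F last_homeo (sfl len) }.

Fixpoint quo_iter (q : nat -> pt -> pt) (i k : nat) : pt -> pt :=
  match k with 0 => id | k'.+1 => q (i + k')%N \o quo_iter q i k' end.

(* the map M_l -> X *)
Definition to_end X (x : fl F n.+1 X) (s : splitting x) (l : nat) : pt -> pt :=
  last_homeo s \o quo_iter (quo s) l (len s - l).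

Definition stage_ball X (x : fl F n.+1 X) (s : splitting x) (l : nat) (C : space) :=
  [/\ (l <= len s)%N, pl_component (stage s l) C & pl_ball n C].

(* the restriction to C of the field on M_l lies in U(C) *)
Definition restr_in (U : forall B, set (fl F n.+1 B))
    X (x : fl F n.+1 X) (s : splitting x) (l : nat) (C : space) : Prop :=
  is_dsum n.+1 C (stage s l `\` C) (stage s l) /\
  exists (y : fl F n.+1 C) (z : fl F n.+1 (stage s l `\` C)),
    sfl s l = du F y z /\ U C y.

(* [lr_ideal] is the ideal property for an embedded ball B' in B = B' u B''.
   Blobs may touch themselves or each other along their boundaries, so the same
   property is needed, and stated in [lr_nested], for a ball C' glued from a ball
   C and other pieces in the course of a gluing decomposition: if the image of C
   in X lies strictly inside that of C', and the field on C is in U(C), then the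
   field on C' is in U(C').  This makes the blob differential well defined. *)
Record local_relations := LocalRelations {
  lr_rel :> forall B, set (fl F n.+1 B);
  lr_zero : forall B (c : fl F n (bnd n.+1 B)), pl_ball n B ->
    lr_rel (inc F (0 : topf F c));
  lr_lin : forall B (c : fl F n (bnd n.+1 B)) a (u v : topf F c), pl_ball n B ->
    lr_rel (inc F u) -> lr_rel (inc F v) -> lr_rel (inc F (a *: u + v));
  lr_homeo : forall B B' f, pl_ball n B -> homeo B B' f ->
    @lr_rel B' = fpush F f @` @lr_rel B;
  lr_iso : forall B (c : fl F n (bnd n.+1 B)) (u v : topf F c), pl_ball n B ->
    ext_isotopic (inc F u) (inc F v) -> lr_rel (inc F (u - v));
  lr_ideal : forall B B' B'' W (x : fl F n.+1 B') (r : fl F n.+1 B'')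
      (y : fl F n (inj1 @` (B' `&` B'')))
      (c : fl F n W), pl_ball n B -> pl_ball n B' ->
    gluing n (dsum B' B'') (inj1 @` (B' `&` B'')) (inj2 @` (B' `&` B''))
      (inj2 \o ptl) W B ptl ->
    compat (inj2 @` (B' `&` B'')) (inj2 \o ptl)
      (res F (du F (fpush F inj1 x : fl F n.+1 (inj1 @` B'))
                   (fpush F inj2 r : fl F n.+1 (inj2 @` B''))
                : fl F n.+1 (dsum B' B''))) y c ->
    lr_rel x -> lr_rel (bullet B x r);
  lr_nested : forall X (x : fl F n.+1 X) (s : splitting x) l C l' C',
    stage_ball s l C -> stage_ball s l' C' ->
    to_end s l @` C `<` to_end s l' @` C' ->
    restr_in (@lr_rel) s l C -> restr_in (@lr_rel) s l' C' }.

End Splittings.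

(** * The blob complex *)

Section Blob.
Context {R : realType} {K : fieldType} {n : nat} {F : system_of_fields R K n}.
Context (U : local_relations F).
Local Notation space := (@space R).
Local Notation pt := (@pt R).

Definition twig k (T : 'I_k -> space) (i : 'I_k) : Prop :=
  forall j, ~ T j `<` T i.

(* x is a k-blob diagram for the configuration T; in particular T is one *)
Definition blob_diagram k X (T : 'I_k -> space) (x : fl F n.+1 X) : Prop :=
  exists (s : splitting x) (l : 'I_k -> nat) (C : 'I_k -> space),
    forall i, [/\ stage_ball s (l i) (C i), T i = to_end s (l i) @` C i
                & twig T i -> restr_in U s (l i) (C i)].

Context {X : space} (c : fl F n (bnd n.+1 X)).

(* the space of k-blob diagrams with configuration T, as a subspace of F(X;c) *)
Definition diagrams k (T : 'I_k -> space) : set (topf F c) :=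
  lspan [set u | blob_diagram T (inc F u)].

Record blob_gen k := BlobGen {
  bg_conf : 'I_k -> space;
  bg_field : topf F c;
  bg_mem : diagrams bg_conf bg_field }.

Inductive blob_rel k : expr K (blob_gen k) -> expr K (blob_gen k) -> Prop :=
| br_lin a g1 g2 g : bg_conf g1 = bg_conf g -> bg_conf g2 = bg_conf g ->
    bg_field g = a *: bg_field g1 + bg_field g2 ->
    blob_rel (Egen g) (Eadd (Escale a (Egen g1)) (Egen g2))
| br_perm (s : 'S_k) g g' : bg_conf g' = bg_conf g \o s ->
    bg_field g' = bg_field g ->
    blob_rel (Egen g') (Escale ((-1) ^+ s) (Egen g)).

Definition blob_ch k : lmodType K := pres (@blob_rel k).

(* the class of the diagram (T, u), and zero if u is not one *)
Definition bsym k (T : 'I_k -> space) (u : topf F c) : blob_ch k :=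
  match pselect (diagrams T u) with
  | left p => pres_gen (@blob_rel k) (BlobGen p)
  | right _ => 0
  end.

Definition blob_diff_gen k (g : blob_gen k.+1) : blob_ch k :=
  \sum_(i < k.+1) (-1) ^+ i *: bsym (bg_conf g \o lift i) (bg_field g).

Lemma lspan_lin (V : lmodType K) (A : set V) a u v :
  lspan A u -> lspan A v -> lspan A (a *: u + v).
Proof.
move=> [m [b [w [wA ->]]]] [m' [b' [w' [w'A ->]]]].
exists (m + m')%N, (fun i => match fintype.split i with inl i => a * b i | inr i => b' i end),
  (fun i => match fintype.split i with inl i => w i | inr i => w' i end); split.
  by move=> i; case: fintype.split.
rewrite big_split_ord /= scaler_sumr; congr (_ + _); apply: eq_bigr => i _.
  by rewrite (unsplitK (inl i)) scalerA.
by rewrite (unsplitK (inr i)).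
Qed.

Lemma bsymE k (g : blob_gen k) :
  bsym (bg_conf g) (bg_field g) = pres_gen (@blob_rel k) g.
Proof.
case: g => T u p; rewrite /bsym /=; case: pselect => // q.
by rewrite (Prop_irrelevance q p).
Qed.

Lemma bsym_lin k (T : 'I_k -> space) a u v : diagrams T u -> diagrams T v ->
  bsym T (a *: u + v) = a *: bsym T u + bsym T v.
Proof.
move=> Tu Tv; have Tuv := lspan_lin a Tu Tv.
rewrite (bsymE (BlobGen Tu)) (bsymE (BlobGen Tv)) (bsymE (BlobGen Tuv)).
by rewrite /pres_gen -clsZE -clsDE; apply/eq_cls/cong_rel/br_lin.
Qed.

Lemma diagrams_perm k (T : 'I_k -> space) (s : 'S_k) u :
  diagrams T u -> diagrams (T \o s) u.
Proof.
move=> [m [b [w [wA ->]]]]; exists m, b, w; split=> // i.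
have [t [l [C h]]] := wA i; exists t, (l \o s), (C \o s) => j /=.
have [h1 h2 h3] := h (s j); split=> // tw; apply: h3 => j' Tj'.
by apply: (tw (s^-1%g j')); rewrite /= permKV.
Qed.

Lemma bsym_perm k (T : 'I_k -> space) (s : 'S_k) u :
  bsym (T \o s) u = (-1) ^+ s *: bsym T u.
Proof.
have [Tu|Tu] := pselect (diagrams T u).
  have Tsu := diagrams_perm s Tu.
  rewrite (bsymE (BlobGen Tu)) (bsymE (BlobGen Tsu)) /pres_gen -clsZE.
  exact/eq_cls/cong_rel/br_perm.
rewrite /bsym; case: pselect => [Tsu|_]; case: (pselect (diagrams T u)) => // _.
  case: Tu; have := diagrams_perm s^-1%g Tsu.
  by congr (diagrams _ _); apply/funext => i /=; rewrite permKV.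
by rewrite scaler0.
Qed.

Lemma diagrams_remove k (T : 'I_k.+1 -> space) i u :
  diagrams T u -> diagrams (T \o lift i) u.
Proof.
move=> [m [b [w [wA ->]]]]; exists m, b, w; split=> // i'.
have [t [l [C h]]] := wA i'; exists t, (l \o lift i), (C \o lift i) => j /=.
have [h1 h2 h3] := h (lift i j); split=> // tw.
have [twj|] := pselect (twig T (lift i j)); first exact: h3.
move=> /existsNP[j' /contrapT Tj'].
have ej' : j' = i.
  case: (unliftP i j') => [j0 e|//]; exfalso; apply: (tw j0); by rewrite /= -e.
subst j'.
have [g1 g2 g3] := h i.
apply: (lr_nested g1 h1); first by rewrite -g2 -h2.
apply: g3 => j0 Tj0; case: (unliftP i j0) => [j1 e|e].
  apply: (tw j1); rewrite /= -e; case: Tj0 => p1 p2; case: Tj' => p3 p4.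
  by split; [exact: subset_trans p3 | move=> p5; apply: p4; exact: subset_trans p1].
by move: Tj0; rewrite e; exact: properxx.
Qed.

Lemma perm_lift k (s : 'S_k.+1) (i : 'I_k.+1) :
  exists t : 'S_k, s = lift_perm i (s i) t.
Proof.
pose f (j : 'I_k) := odflt j (unlift (s i) (s (lift i j))).
have fE j : lift (s i) (f j) = s (lift i j).
  rewrite /f; case: unliftP => [j' ->//|/perm_inj e].
  by have := neq_lift i j; rewrite e eqxx.
have fi : injective f.
  by move=> j j' e; apply: (@lift_inj _ i); apply: (@perm_inj _ s); rewrite -!fE e.
exists (perm fi); apply/permP => j; case: (unliftP i j) => [j' ->|->].
  by rewrite lift_perm_lift permE fE.
by rewrite lift_perm_id.
Qed.

Fact blob_diff_respects k : respects (@blob_rel k.+1) (@blob_diff_gen k).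
Proof.
move=> _ _ [a g1 g2 g e1 e2 e|s g g' e1 e2] /=; rewrite /blob_diff_gen.
  rewrite scaler_sumr -big_split /=; apply: eq_bigr => i _.
  rewrite e e1 e2 bsym_lin; first by rewrite scalerDr !scalerA (mulrC a).
    by apply: diagrams_remove; rewrite -e1; exact: bg_mem.
  by apply: diagrams_remove; rewrite -e2; exact: bg_mem.
rewrite e1 e2 [X in _ *: X](reindex_inj (@perm_inj _ s)) scaler_sumr /=.
apply: eq_bigr => i _.
have [t st] := perm_lift s i.
have -> : (bg_conf g \o s) \o lift i = (bg_conf g \o lift (s i)) \o t.
  by apply/funext => j /=; rewrite [in LHS]st lift_perm_lift.
rewrite bsym_perm !scalerA; congr (_ *: _).
have -> : odd_perm s = odd i (+) odd (s i) (+) odd_perm t.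
  by rewrite [in LHS]st odd_lift_perm.
rewrite !signr_addb !signr_odd.
by rewrite [RHS]mulrAC -[X in _ = X * _]mulrA -expr2 sqrr_sign mulr1.
Qed.

Definition blob_diff k : {linear blob_ch k.+1 -> blob_ch k} :=
  plift (@blob_diff_gen k) (@blob_diff_respects k).

Arguments blob_diff : simpl never.

Lemma blob_diff_sym k (T : 'I_k.+1 -> space) u : diagrams T u ->
  blob_diff k (bsym T u) = \sum_(i < k.+1) (-1) ^+ i *: bsym (T \o lift i) u.
Proof. by move=> Tu; rewrite (bsymE (BlobGen Tu)); exact: plift_gen. Qed.

Lemma liftlift k (i : 'I_k.+2) (j : 'I_k.+1) (x : 'I_k) : (i <= j)%N ->
  lift i (lift j x) = lift (lift ord0 j) (lift (inord i) x).
Proof.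
move=> ij; apply: val_inj; rewrite /= inordK; last exact: leq_ltn_trans ij _.
by rewrite /bump; lia.
Qed.

Fact blob_diff2 k (x : blob_ch k.+2) : blob_diff k (blob_diff k.+1 x) = 0.
Proof.
have := @linear_gen_eq _ _ _ _
  ((blob_diff k \o blob_diff k.+1) : {linear blob_ch k.+2 -> blob_ch k})
  (\0 : {linear blob_ch k.+2 -> blob_ch k}).
apply=> {x} g.
change (blob_diff k (blob_diff k.+1 (pres_gen (@blob_rel k.+2) g)) = 0).
rewrite -bsymE; case: g => T u Tu.
change (blob_diff k (blob_diff k.+1 (bsym T u)) = 0).
rewrite blob_diff_sym // linear_sum.
under eq_bigr => i _.
  rewrite linearZ_LR blob_diff_sym ?scaler_sumr; last exact: diagrams_remove.
  over.
rewrite pair_bigA /= (bigID (fun p : 'I_k.+2 * 'I_k.+1 => (p.1 <= p.2)%N)) /=.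
pose h (p : 'I_k.+2 * 'I_k.+1) : 'I_k.+2 * 'I_k.+1 := (lift ord0 p.2, inord p.1).
pose h' (p : 'I_k.+2 * 'I_k.+1) : 'I_k.+2 * 'I_k.+1 := (inord p.2, inord p.1.-1).
rewrite [X in _ + X](reindex_onto h h') /=; last first.
  move=> [i j] /=; rewrite -ltnNge => ji; congr pair; apply: val_inj => /=.
    rewrite inordK /bump; first by lia.
    by have := ltn_ord i; lia.
  by rewrite inordK ?inordK //; have := ltn_ord j; lia.
rewrite [X in _ + X](eq_bigl (fun p : 'I_k.+2 * 'I_k.+1 => (p.1 <= p.2)%N)); last first.
  move=> [i j]; apply/andP/idP => /= [[ij /eqP[e _]]|ij].
    have ik : (i < k.+1)%N.
      by rewrite -e inordK //; have := ltn_ord (inord i : 'I_k.+1); lia.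
    by move: ij; rewrite inordK // /bump; lia.
  have ik : (i < k.+1)%N by have := ltn_ord j; lia.
  split; first by rewrite inordK // /bump; lia.
  apply/eqP; congr pair; apply: val_inj => /=.
    by rewrite !inordK //; lia.
  by rewrite add0n inord_val.
rewrite -big_split big1 // => -[i j] /= ij.
have ik : (i < k.+1)%N by have := ltn_ord j; lia.
have -> : (T \o lift (lift ord0 j)) \o lift (inord i) = (T \o lift i) \o lift j.
  by apply/funext => x /=; rewrite (liftlift x ij).
rewrite inordK // /bump leq0n add1n exprS !scalerA mulN1r mulNr scaleNr.
by rewrite [X in _ - X *: _]mulrC subrr.
Qed.

Definition blob : complex K := Complex blob_diff2.

End Blob.

Arguments blob_diagram {R K n F} U {k X} T x.
Arguments diagrams {R K n F} U {X} c {k} T.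
Arguments bsym {R K n F} U {X} c {k} T u.
Arguments blob {R K n F} U {X} c.

Section Functoriality.
Context {R : realType} {K : fieldType} {n : nat} {F : system_of_fields R K n}.
Context (U : local_relations F).
Local Notation space := (@space R).
Local Notation pt := (@pt R).

(* phi is the chain map induced by the homeomorphism f *)
Definition induced_by X X' (f : pt -> pt)
    (c : fl F n (bnd n.+1 X)) (c' : fl F n (bnd n.+1 X'))
    (phi : chain_map (blob U c) (blob U c')) : Prop :=
  forall k (T : 'I_k -> space) (u : topf F c) (u' : topf F c'),
    diagrams U c T u -> inc F u' = fpush F f (inc F u) ->
    phi k (bsym U c T u) = bsym U c' (fun i => f @` T i) u'.

Lemma quo_iter_sub X (x : fl F n.+1 X) (s : splitting x) i k :
  (i + k <= len s)%N ->
  quo_iter (quo s) i k @` stage s i `<=` stage s (i + k)%N.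
Proof.
elim: k => [|k IH] le; first by rewrite addn0 image_id.
have lt : (i + k < len s)%N by lia.
have [Y1 [Y2 [h [W [y [c [g _ _]]]]]]] := stage_glue lt.
move=> _ [p ip <-]; rewrite addnS -(glu_surj g).
exists (quo_iter (quo s) i k p) => //.
by apply: IH; [lia | exists p].
Qed.

Lemma to_end_sub X (x : fl F n.+1 X) (s : splitting x) l C :
  stage_ball s l C -> to_end s l @` C `<=` X.
Proof.
move=> [le [CM _ _ _ _] _] _ [p Cp <-]; rewrite /to_end /=.
have [_ finX _] := last_homeoP s.
suff : (last_homeo s @` stage s (len s)) (last_homeo s (quo_iter (quo s) l (len s - l) p)).
  by rewrite finX.
exists (quo_iter (quo s) l (len s - l) p) => //.
have := @quo_iter_sub _ _ s l (len s - l); rewrite subnKC //; apply=> //.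
by exists p => //; exact: CM.
Qed.

Lemma blob_diagram_homeo X X' f k (T : 'I_k -> space) (x : fl F n.+1 X) :
  mfd n.+1 X -> mfd n.+1 X' -> homeo X X' f -> blob_diagram U T x ->
  blob_diagram U (fun i => f @` T i) (fpush F f x : fl F n.+1 X').
Proof.
move=> mX mX' hf [s [l [C h]]].
have E : (fpush F f x : fl F n.+1 X') = fpush F (f \o last_homeo s) (sfl s (len s)).
  rewrite {1}(last_field s); symmetry.
  apply: (fpush_comp (sof_fields F)) => //; last exact: last_homeoP.
  exact: stage_mfd.
exists (Splitting (@stage_mfd _ _ _ _ _ _ s) (@stage_glue _ _ _ _ _ _ s)
  (split_start s) (homeo_comp (last_homeoP s) hf) E), l, C => i.
have [h1 h2 h3] := h i; split=> //.
  by rewrite h2 image_comp.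
move=> tw; apply: h3 => j [Tji Tij]; apply: (tw j); split.
  exact: image_subset.
move=> sub; apply: Tij => p Tip.
have TX i' : T i' `<=` X by have [g1 -> _] := h i'; exact: to_end_sub g1.
have [q Tjq e] : (f @` T j) (f p) by apply: sub; exists p.
have [_ _ [g [_ _ gK _]]] := hf.
have Xp := TX _ _ Tip; have Xq := TX _ _ Tjq.
by rewrite -(gK p Xp) -e gK.
Qed.

Lemma diagrams_homeo X X' f (c : fl F n (bnd n.+1 X))
    (L : {linear topf F c -> topf F (fpush F f c : fl F n (bnd n.+1 X'))})
    k (T : 'I_k -> space) u :
  mfd n.+1 X -> mfd n.+1 X' -> homeo X X' f ->
  (forall u, fpush F f (inc F u) = inc F (L u)) ->
  diagrams U c T u -> diagrams U (fpush F f c) (fun i => f @` T i) (L u).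
Proof.
move=> mX mX' hf LE [m [a [w [wT ->]]]].
exists m, a, (fun i => L (w i)); split.
  move=> i /=; rewrite -LE; apply: (blob_diagram_homeo mX mX' hf); exact: wT.
by rewrite linear_sum; apply: eq_bigr => i _; rewrite linearZ_LR.
Qed.

Lemma induced_map X X' f (c : fl F n (bnd n.+1 X)) :
  mfd n.+1 X -> mfd n.+1 X' -> homeo X X' f ->
  exists phi : chain_map (blob U c) (blob U (fpush F f c : fl F n (bnd n.+1 X'))),
    induced_by f phi.
Proof.
move=> mX mX' hf.
have [L LE] := fpush_linear (sof_fields F) c mX mX' hf.
pose c' : fl F n (bnd n.+1 X') := fpush F f c.
pose fg k (g : blob_gen U c k) : blob_ch U c' k :=
  bsym U c' (fun i => f @` bg_conf g i) (L (bg_field g)).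
have dL k (T : 'I_k -> space) u := @diagrams_homeo _ _ _ _ L k T u mX mX' hf LE.
have fR k : respects (@blob_rel _ _ _ _ U _ c k) (@fg k).
  move=> _ _ [a g1 g2 g e1 e2 e|s g g' e1 e2] /=; rewrite /fg.
    rewrite e1 e2 e linearP bsym_lin //; apply: dL.
      by rewrite -e1; exact: bg_mem.
    by rewrite -e2; exact: bg_mem.
  rewrite e1 e2 -bsym_perm; congr (bsym U c' _ _).
pose phi k := plift (@fg k) (fR k).
have phiE k (T : 'I_k -> space) u : diagrams U c T u ->
    phi k (bsym U c T u) = bsym U c' (fun i => f @` T i) (L u).
  by move=> Tu; rewrite (bsymE (BlobGen Tu)); exact: plift_gen.
have phiP k (x : ch (blob U c) k.+1) :
    phi k (dif (blob U c) k x) = dif (blob U c') k (phi k.+1 x).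
  have := @linear_gen_eq _ _ _ _
    ((phi k \o blob_diff U c k) : {linear blob_ch U c k.+1 -> blob_ch U c' k})
    ((blob_diff U c' k \o phi k.+1) : {linear blob_ch U c k.+1 -> blob_ch U c' k}).
  apply=> {x} g.
  change (phi k (blob_diff U c k (pres_gen (@blob_rel _ _ _ _ U _ c k.+1) g)) =
    blob_diff U c' k (phi k.+1 (pres_gen (@blob_rel _ _ _ _ U _ c k.+1) g))).
  rewrite -bsymE; have Tu := bg_mem g.
  rewrite blob_diff_sym // phiE // blob_diff_sym; last exact: dL.
  rewrite linear_sum; apply: eq_bigr => i _.
  by rewrite linearZ_LR phiE //; exact: diagrams_remove.
exists (@ChainMap K (blob U c) (blob U c') phi phiP) => k T u u' Tu e /=.
apply: etrans (phiE k T u Tu) _; congr (bsym U c' _ _).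
by apply: (inc_inj (sof_fields F) mX'); rewrite e LE.
Qed.

(* the homeomorphism f1 + f2 of disjoint unions *)
Definition dsum_map (f1 f2 : pt -> pt) : pt -> pt :=
  fun v => if v 0%N == 0 then inj1 (f1 (ptl v)) else inj2 (f2 (ptl v)).

(* the boundary condition c1 u c2 on the disjoint union *)
Definition dsum_bc X1 X2 (c1 : fl F n (bnd n.+1 X1)) (c2 : fl F n (bnd n.+1 X2)) :
    fl F n (bnd n.+1 (dsum X1 X2)) :=
  du F (fpush F inj1 c1 : fl F n (inj1 @` bnd n.+1 X1))
       (fpush F inj2 c2 : fl F n (inj2 @` bnd n.+1 X2)).

End Functoriality.

Record manifold (R : realType) (n : nat) := Manifold {
  carrier :> @space R;
  manifoldP : mfd n.+1 carrier }.

Notation boundary_condition F n X := (fl F n (bnd n.+1 X)).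

Arguments induced_by {R K n F U X X'} f {c c'} phi.

(* Main.v *)
Require Import Defs.
From HB Require Import structures.
From mathcomp Require Import all_boot all_order all_algebra all_fingroup.
From mathcomp Require Import ring lra zify.
From mathcomp Require Import all_classical all_reals.
From mathcomp Require Import topology normedtype.

Set Implicit Arguments.
Unset Strict Implicit.
Unset Printing Implicit Defensive.
Import Order.TTheory GRing.Theory Num.Theory.
Import numFieldNormedType.Exports.
Local Open Scope classical_set_scope.
Local Open Scope ring_scope.

(** On a disjoint union, top-dimensional fields form a tensor product:
    F(X1 u X2; c1 u c2) is F(X1; c1) (x) F(X2; c2), see [dsum_tens].  What has to
    be compared is therefore the configurations and the subspaces of diagrams.

    A blob is the image of a connected ball, so it lies in X1 or in X2, and every
    configuration in X1 u X2 is, up to the order of the blobs, a juxtaposition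
    [jconf T1 T2] of a configuration in X1 and one in X2 ([jconf_sort]).  The key
    fact is that D(jconf T1 T2) is the image of D(T1) (x) D(T2), where D(T) is the
    space of diagrams with configuration T.

    - For two diagrams on X1 and X2, pad their gluing decompositions with idle
      steps to the same length and carry them out simultaneously on disjoint
      copies; this is a decomposition of X1 u X2 ([blob_diagram_join]).
    - Conversely, let M_0 -> ... -> M_m be a decomposition of X1 u X2.  The points
      of M_l that end up in X_i form a union of components of M_l, hence a manifold
      ([mfd_part]); these parts are glued independently of each other
      ([glue_step_part]).  The field on M_0 splits as a disjoint union because it
      is componentwise ([cw_split]), and then so do all later ones.  There is one
      subtle point: on a twig blob C the field on M_l is y u z with y in U(C), and
      it is also x1 u x2, but z is only a sum of tensors, so it need not have the
      form z' u x2.  If x2 is non-zero, a linear form with value 1 on x2 turns z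
      into a z' with x1 = y u z' ([du_cancel]); if x2 is zero, then so is the whole
      field and there is nothing to prove ([blob_diagram_split]).

    The isomorphism sends the diagram a u b with configuration jconf T1 T2 to
    (T1, a) (x) (T2, b), and a reordered diagram to the same with the sign of the
    permutation.  It is well defined because linear projections onto D(T1) and
    D(T2) extend the bilinear map from D(T1) x D(T2) to all fields ([projection],
    [theta]), and because a juxtaposition of non-empty blobs determines T1 and T2
    up to permuting each of them ([jconf_uniq]).  Juxtaposing diagrams is bilinear
    and provides the inverse.  As juxtaposed diagrams span the blob complex of
    X1 u X2 ([blob_dsum_eq]), compatibility with the differentials and with
    homeomorphisms has to be checked on them only. *)

(** * Linear algebra over a field *)

Section Projections.
Context {K : fieldType}.

Lemma linear_fun (V W : lmodType K) (f : V -> W) : linear f ->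
  exists L : {linear V -> W}, forall v, L v = f v.
Proof.
move=> lf.
pose L : {linear V -> W} := HB.pack f (GRing.isLinear.Build K V W *:%R f lf).
by exists L.
Qed.

Definition submod (V : lmodType K) (D : set V) : Prop :=
  D 0 /\ forall a u v, D u -> D v -> D (a *: u + v).

(** By Zorn's lemma D has a complement E, a maximal subspace that meets D only in
    zero; the projection is the one along E. *)
Lemma projection (V : lmodType K) (D : set V) : submod D ->
  exists p : {linear V -> V}, (forall v, D (p v)) /\ forall v, D v -> p v = v.
Proof.
move=> [D0 DL].
pose P (E : set V) := (forall a u v, E u -> E v -> E (a *: u + v)) /\
  forall v, E v -> D v -> v = 0.
have [E [[EL ED] Emax]] : exists E, P E /\ forall B, E `<` B -> ~ P B.
  apply: Zorn_bigcup => C CP Ctot; split.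
    move=> a u v [X CX Xu] [Y CY Yv].
    have [XY|YX] := Ctot X Y CX CY.
      by exists Y => //; have [h _] := CP _ CY; apply: h => //; exact: XY.
    by exists X => //; have [h _] := CP _ CX; apply: h => //; exact: YX.
  by move=> v [X CX Xv]; have [_ h] := CP _ CX; exact: h.
(* [Zorn_bigcup] also considers the empty chain, so [P] allows [E] to be empty. *)
have E0 : E 0.
  apply: contrapT => nE0.
  have Ene v : ~ E v.
    by move=> Ev; apply: nE0; have := EL (-1) v v Ev Ev; rewrite scaleN1r addNr.
  apply: (Emax [set 0]).
    by split=> [v /Ene|/(_ 0 erefl)].
  by split=> [a _ _ -> ->|v -> _] //; rewrite scaler0 addr0.
have EZ a v : E v -> E (a *: v) by move=> Ev; rewrite -[_ *: _]addr0; exact: EL.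
have DZ a v : D v -> D (a *: v) by move=> Dv; rewrite -[_ *: _]addr0; exact: DL.
have ED_sum v : exists d, D d /\ E (v - d).
  apply: contrapT => nv.
  apply: (Emax [set w | exists a e, E e /\ w = a *: v + e]).
    split=> [e Ee|sub]; first by exists 0, e; rewrite scale0r add0r.
    have Ev : E v by apply: sub; exists 1, 0; rewrite scale1r addr0.
    by apply: nv; exists 0; rewrite subr0.
  split.
    move=> c _ _ [a [e [Ee ->]]] [b [f [Ef ->]]].
    exists (c * a + b), (c *: e + f); split; first exact: EL.
    by rewrite scalerDr scalerA addrACA -scalerDl.
  move=> _ [a [e [Ee ->]]]; have [->|a0] := eqVneq a 0.
    by rewrite scale0r add0r => /(ED _ Ee).
  move=> Dv; case: nv; exists (a^-1 *: (a *: v + e)); split; first exact: DZ.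
  rewrite scalerDr scalerA mulVf // scale1r opprD addrA subrr add0r -scalerN.
  by apply: (EZ); rewrite -scaleN1r; exact: EZ.
have [p pP] := choice ED_sum.
have uniq v d : D d -> E (v - d) -> p v = d.
  move=> Dd Ed; have [Dp Ep] := pP v.
  apply/eqP; rewrite -subr_eq0; apply/eqP; apply: ED.
    have := EL (-1) _ _ Ep Ed.
    by rewrite scaleN1r opprB addrA subrK.
  by rewrite addrC -scaleN1r; exact: DL.
have pl : linear p.
  move=> a u v; have [Du Eu] := pP u; have [Dv Ev] := pP v.
  apply: uniq; first exact: DL.
  have := EL a _ _ Eu Ev.
  by rewrite scalerBr addrACA -opprD.
have [L LE] := linear_fun pl.
exists L; split=> v; first by rewrite LE; case: (pP v).
by move=> Dv; rewrite LE; apply: uniq => //; rewrite subrr.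
Qed.

(** The coefficient with respect to v of the projection onto the line of v. *)
Lemma linear_form1 (V : lmodType K) (v : V) : v <> 0 ->
  exists f : {linear V -> K^o}, f v = 1.
Proof.
move=> /eqP v0.
have inj a b : a *: v = b *: v -> a = b.
  move=> /eqP; rewrite -subr_eq0 -scalerBl scaler_eq0 (negbTE v0) orbF subr_eq0.
  by move=> /eqP.
have sD : submod [set w | exists a, w = a *: v].
  split; first by exists 0; rewrite scale0r.
  by move=> a _ _ [b ->] [c ->]; exists (a * b + c); rewrite scalerDl scalerA.
have [p [pD pid]] := projection sD.
have [f fP] := choice pD.
have fl : linear (f : V -> K^o).
  by move=> a u w; apply: inj; rewrite -fP linearP !fP scalerDl scalerA.
have [L LE] := linear_fun fl; exists L; rewrite LE.
by apply: inj; rewrite -fP pid ?scale1r //; exists 1; rewrite scale1r.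
Qed.

Lemma linear_scale (V W : lmodType K) (f : {linear V -> W}) (a : K) :
  exists L : {linear V -> W}, forall v, L v = a *: f v.
Proof. by apply: linear_fun => b u v; rewrite linearP scalerDr !scalerA mulrC. Qed.

End Projections.

Section Tensors.
Context {K : fieldType}.

Lemma pure_lin_l (V W : lmodType K) a (v v' : V) (w : W) :
  pure_tens (a *: v + v') w = a *: pure_tens v w + pure_tens v' w.
Proof. by rewrite /pure_tens /pres_gen -clsZE -clsDE; apply/eq_cls/cong_rel/tens_l. Qed.

Lemma pure_lin_r (V W : lmodType K) a (v : V) (w w' : W) :
  pure_tens v (a *: w + w') = a *: pure_tens v w + pure_tens v w'.
Proof. by rewrite /pure_tens /pres_gen -clsZE -clsDE; apply/eq_cls/cong_rel/tens_r. Qed.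

Lemma pureZ_l (V W : lmodType K) a (v : V) (w : W) :
  pure_tens (a *: v) w = a *: pure_tens v w.
Proof.
have h0 : pure_tens (0 : V) w = 0.
  by have := pure_lin_l (-1) (0 : V) 0 w; rewrite scaler0 add0r scaleN1r addNr.
by have := pure_lin_l a v 0 w; rewrite addr0 h0 addr0.
Qed.

Lemma pureZ_r (V W : lmodType K) a (v : V) (w : W) :
  pure_tens v (a *: w) = a *: pure_tens v w.
Proof.
have h0 : pure_tens v (0 : W) = 0.
  by have := pure_lin_r (-1) v (0 : W) 0; rewrite scaler0 add0r scaleN1r addNr.
by have := pure_lin_r a v w 0; rewrite addr0 h0 addr0.
Qed.

Lemma tens_ind (V W : lmodType K) (P : tens V W -> Prop) :
  (forall v w, P (pure_tens v w)) -> (forall x y, P x -> P y -> P (x + y)) ->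
  (forall a x, P x -> P (a *: x)) -> forall t, P t.
Proof.
move=> hp hD hZ t; rewrite -(Defs.reprK t); elim: (pres_repr t) => [[v w]||x hx y hy|a x hx].
- exact: hp.
- have := hZ 0 _ (hp 0 0); by rewrite scale0r.
- by rewrite clsDE; exact: hD.
- by rewrite clsZE; exact: hZ.
Qed.

Lemma tens_lift (V W M : lmodType K) (f : V -> W -> M) :
  (forall a v v' w, f (a *: v + v') w = a *: f v w + f v' w) ->
  (forall a v w w', f v (a *: w + w') = a *: f v w + f v w') ->
  exists L : {linear tens V W -> M}, forall v w, L (pure_tens v w) = f v w.
Proof.
move=> fl fr.
have fR : respects (@tens_rel _ V W) (fun p => f p.1 p.2).
  by move=> _ _ [a v v' w|a v w w'] /=.
by exists (plift _ fR) => v w; rewrite [LHS]plift_gen.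
Qed.

End Tensors.

(** * Polyhedra and piecewise linear maps *)

Section Polyhedra.
Context {R : realType}.
Local Notation pt := (@pt R).
Local Notation space := (@Defs.space R).

Lemma disjoint_out (A B : space) x : A `&` B = set0 -> A x -> B x -> False.
Proof. by move=> e Ax Bx; have : (A `&` B) x by []; rewrite e. Qed.

Lemma dis0 (A B : space) : (forall v, A v -> B v -> False) -> A `&` B = set0.
Proof. by move=> h; rewrite -subset0 => v [/h]. Qed.

Lemma aff_delta N (i : nat) (c : R) (v : pt) : (i < N)%N ->
  aff N 0 (fun j => if j == i then c else 0) v = c * v i.
Proof.
move=> iN; rewrite /aff add0r (bigD1 (Ordinal iN)) //= eqxx big1 ?addr0 // => j.
by rewrite -val_eqE /= => /negbTE ->; rewrite mul0r.
Qed.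

Lemma aff_const N (c : R) (v : pt) : aff N c (fun=> 0) v = c.
Proof. by rewrite /aff big1 ?addr0 // => j _; rewrite mul0r. Qed.

Lemma cell_bound (A : space) : cell A ->
  exists N, forall v, A v -> forall i, (N <= i)%N -> v i = 0.
Proof. by move=> [N [M [J [a [l ->]]]]]; exists N => v []. Qed.

(** A map whose coordinates are constants and coordinates of its argument is affine,
    with finitely many terms because a cell lies in some R^N. *)
Lemma affine_reindex (A : space) (o : nat -> option R) (r : nat -> nat) (f : pt -> pt) :
  cell A -> (forall v j, f v j = if o j is Some c then c else v (r j)) ->
  affine_on A f.
Proof.
move=> /cell_bound[N AN] fE.
exists N, (fun j => odflt 0 (o j)),
  (fun j i => if (o j == None) && (i == r j) then 1 else 0) => v Av j.
rewrite fE; case: (o j) => [c|] /=; first by rewrite aff_const.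
have [rN|Nr] := ltnP (r j) N; first by rewrite aff_delta // mul1r.
rewrite AN // /aff add0r big1 // => i _; case: eqP => [e|_]; last by rewrite mul0r.
by have := ltn_ord i; rewrite e ltnNge Nr.
Qed.

Lemma affine_id (A : space) : cell A -> affine_on A id.
Proof. by move=> cA; apply: (affine_reindex (o := fun=> None) (r := id) cA). Qed.

Lemma affine_ptl (A : space) : cell A -> affine_on A ptl.
Proof. by move=> cA; apply: (affine_reindex (o := fun=> None) (r := succn) cA). Qed.

Lemma affine_pcons (t : R) (A : space) : cell A -> affine_on A (pcons t).
Proof.
move=> cA; apply: (affine_reindex (r := predn)
  (o := fun j => if j is 0 then Some t else None) cA).
by move=> v [|j].
Qed.

Lemma cellI (A B : space) : cell A -> cell B -> cell (A `&` B).
Proof.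
move=> cA cB; have [N NP] := cell_bound cA.
exact: (cell_pre (f := id) cA (affine_id cA) NP cB).
Qed.

(** The copy of A at height t is the preimage of A under [ptl] in a big cell of
    height t, and preimages of cells are cells. *)
Lemma cell_pcons (t : R) (A : space) : 0 <= t -> cell A -> cell (pcons t @` A).
Proof.
move=> t0 cA; have [N NP] := cell_bound cA; have [N' [M [J [a [l AE]]]]] := cA.
(* The bound M' leaves room for the new coordinate; two inequalities fix its
   value to t. *)
pose M' := `|M| + t.
pose B : space := [set v | [/\ forall i, (N.+1 <= i)%N -> v i = 0,
  forall i, `|v i| <= M' & forall j : bool,
   0 <= aff N.+1 (if j then - t else t)
          (fun i => if i == 0%N then (-1) ^+ (~~ j) else 0) v]].
have cB : cell B by exists N.+1, M', bool, (fun j : bool => if j then - t else t),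
  (fun (j : bool) i => if i == 0%N then (-1) ^+ (~~ j) else 0).
have BE v : B v -> v 0%N = t.
  have E (x y : R) :
      aff N.+1 x (fun i => if i == 0%N then y else 0) v = x + y * v 0%N.
    by rewrite -[x in LHS]add0r -affDc aff_delta // addrC.
  move=> [_ _ h]; have := h true; have := h false; rewrite !E //=.
  by rewrite expr1 expr0; lra.
have -> : pcons t @` A = [set v | B v /\ A (ptl v)].
  apply/seteqP; split=> [_ [v Av <-]|v [Bv Av]] /=; last first.
    by exists (ptl v) => //; apply/funext => -[|i] //=; rewrite BE.
  split=> //; split.
  - by move=> [//|i]; exact: NP.
  - move=> [|i] /=; rewrite /M'; first by rewrite ger0_norm //; have := normr_ge0 M; lra.
    have vM : `|v i| <= M by move: Av; rewrite AE => -[].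
    by have := ler_norm M; lra.
  - move=> j; rewrite -[X in aff _ X]add0r -affDc aff_delta //.
    by case: j; rewrite /= ?expr0 ?expr1; lra.
apply: (cell_pre (N := N'.+1 + N)) => //; first exact: affine_ptl.
by move=> v [Bv _ _] i le; apply: Bv; lia.
Qed.

Lemma polyhedron0 : polyhedron (set0 : space).
Proof.
exists void, (fun=> set0); split=> [|[]].
by apply/seteqP; split=> // v [[]].
Qed.

Lemma polyhedronU (A B : space) :
  polyhedron A -> polyhedron B -> polyhedron (A `|` B).
Proof.
move=> [I [a [-> ca]]] [J [b [-> cb]]].
exists (I + J)%type, (fun x => match x with inl i => a i | inr j => b j end); split.
  apply/seteqP; split=> v /=.
    by move=> [[i h]|[j h]]; [exists (inl i) | exists (inr j)].
  by move=> [[i|j] h]; [left; exists i | right; exists j].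
by case.
Qed.

Lemma pl_id (A : space) : polyhedron A -> pl A id.
Proof.
move=> [I [a [-> ca]]]; exists I, a; split=> // i; split=> //; by apply: affine_id.
Qed.

Lemma pl_ptl (A : space) : polyhedron A -> pl A ptl.
Proof.
move=> [I [a [-> ca]]]; exists I, a; split=> // i; split=> //; by apply: affine_ptl.
Qed.

Lemma pl_pcons (t : R) (A : space) : polyhedron A -> pl A (pcons t).
Proof.
move=> [I [a [-> ca]]]; exists I, a; split=> // i; split=> //; by apply: affine_pcons.
Qed.

Lemma pl_ext (A : space) f g : (forall v, A v -> f v = g v) -> pl A f -> pl A g.
Proof.
move=> e [I [a [AE h]]]; exists I, a; split=> // i; have [h1 [N [b [l h2]]]] := h i.
by split=> //; exists N, b, l => v av j; rewrite -e ?h2 //; rewrite AE; exists i.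
Qed.

Lemma plU (A B : space) f : pl A f -> pl B f -> pl (A `|` B) f.
Proof.
move=> [I [a [-> ca]]] [J [b [-> cb]]].
exists (I + J)%type, (fun x => match x with inl i => a i | inr j => b j end); split.
  apply/seteqP; split=> v /=.
    by move=> [[i h]|[j h]]; [exists (inl i) | exists (inr j)].
  by move=> [[i|j] h]; [left; exists i | right; exists j].
by case.
Qed.

(** Intersect the cells on which f is affine with the cells of A. *)
Lemma pl_sub (X A : space) f : pl X f -> polyhedron A -> A `<=` X -> pl A f.
Proof.
move=> Xf pA AX; apply: (pl_ext (f := f \o id)) => //.
move: Xf pA => [I [a [XE ha]]] [J [b [AE hb]]].
exists (I * J)%type, (fun x => a x.1 `&` b x.2); split.
  apply/seteqP; split=> v /=.
    move=> Av; have := AX _ Av; rewrite XE => -[i ai].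
    by move: Av; rewrite AE => -[j bj]; exists (i, j).
  by move=> [[i j] [_ h]]; rewrite AE; exists j.
move=> [i j] /=; have [h1 [N [c [l h2]]]] := ha i; split; first exact: cellI.
by exists N, c, l => v [/h2].
Qed.


(** Preimages of cells are cells provided that the image lies in some R^N; the
    polyhedron Y guarantees this. *)
Lemma polyhedron_pre (X Y B : space) f : pl X f -> polyhedron Y ->
  (forall v, X v -> Y (f v)) -> polyhedron B -> polyhedron (X `&` f @^-1` B).
Proof.
move=> [I [a [XE ha]]] /polyhedron_bound[N NP] fY [J [b [-> hb]]].
exists (I * J)%type, (fun x => a x.1 `&` f @^-1` (b x.2)); split.
  apply/seteqP; split=> v /=.
    by move=> [+ [j bj]]; rewrite XE => -[i ai]; exists (i, j).
  by move=> [[i j] [ai bj]]; split; [rewrite XE; exists i | exists j].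
move=> [i j] /=; have [ca fa] := ha i.
apply: (cell_pre (N := N) ca fa _ (hb j)) => v av; apply: NP; apply: fY.
by rewrite XE; exists i.
Qed.

Lemma polyhedronI (A B : space) :
  polyhedron A -> polyhedron B -> polyhedron (A `&` B).
Proof. by move=> pA pB; apply: (polyhedron_pre (pl_id pA) pA). Qed.

Lemma polyhedron_pcons (t : R) (A : space) : 0 <= t -> polyhedron A ->
  polyhedron (pcons t @` A).
Proof.
move=> t0 [I [a [-> ha]]]; exists I, (fun i => pcons t @` a i); split.
  apply/seteqP; split=> [_ [v [i ai] <-]|_ [i [v ai <-]]]; first by exists i, v.
  by exists v => //; exists i.
by move=> i; exact: cell_pcons.
Qed.

Lemma homeo_poly (X Y : space) f : homeo X Y f -> polyhedron X /\ polyhedron Y.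
Proof.
by move=> [p _ [g [q _ _ _]]]; split; [exact: pl_polyhedron p | exact: pl_polyhedron q].
Qed.

Lemma homeo_inj (X Y : space) f v w : homeo X Y f -> X v -> X w -> f v = f w -> v = w.
Proof. by move=> [_ _ [g [_ _ fK _]]] Xv Xw e; rewrite -(fK v) // e fK. Qed.

Lemma homeo_to (X Y : space) f v : homeo X Y f -> X v -> Y (f v).
Proof. by move=> [_ <- _] Xv; exists v. Qed.

Lemma homeo_onto (A B : space) f v : homeo A B f -> B v -> exists2 u, A u & f u = v.
Proof. by move=> [_ <- _] [u Au e]; exists u. Qed.

Lemma homeo_ext (X Y : space) f g : (forall v, X v -> f v = g v) ->
  homeo X Y f -> homeo X Y g.
Proof.
move=> e [p s [f' [q s' K K']]]; split; first exact: pl_ext e p.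
  rewrite -s; apply/seteqP; split=> _ [v Xv <-]; exists v => //; exact/esym/e || exact: e.
exists f'; split=> //; first by move=> x Xx; rewrite -e // K.
by move=> y Yy; rewrite -e ?K' // -s'; exists y.
Qed.

Lemma homeo_id (X : space) : polyhedron X -> homeo X X id.
Proof.
by move=> pX; split; [exact: pl_id | rewrite image_id |
  exists id; split=> //; [exact: pl_id | rewrite image_id]].
Qed.

(** The image of A is a polyhedron because it is the preimage of A under the
    inverse homeomorphism. *)
Lemma homeo_sub (X Y A : space) f : homeo X Y f -> polyhedron A -> A `<=` X ->
  homeo A (f @` A) f.
Proof.
move=> hf pA AX; have [_ pY] := homeo_poly hf.
have [p s [g [q s' K K']]] := hf; split=> //; first exact: pl_sub p pA AX.
have fAE : f @` A = Y `&` g @^-1` A.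
  apply/seteqP; split=> [_ [v Av <-]|y [Yy Agy]] /=.
    by split; [apply: (homeo_to hf); exact: AX | rewrite K //; exact: AX].
  by exists (g y) => //; exact: K'.
have pX : polyhedron X by exact: pl_polyhedron p.
exists g; split.
- apply: (pl_sub q); last by move=> _ [v Av <-]; apply: (homeo_to hf); exact: AX.
  rewrite fAE; apply: (polyhedron_pre q pX) => // y Yy.
  by rewrite -s'; exists y.
- rewrite fAE; apply/seteqP; split=> [_ [v [_ Agv] <-] //|v Av].
  exists (f v); last by rewrite K //; exact: AX.
  by split=> /=; [apply: (homeo_to hf); exact: AX | rewrite K //; exact: AX].
- by move=> x Ax; apply: K; exact: AX.
- by move=> _ [v Av <-]; rewrite K //; exact: AX.
Qed.

Lemma homeo_inv (X Y : space) f : homeo X Y f ->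
  exists g, [/\ homeo Y X g, (forall x, X x -> g (f x) = x) &
    (forall y, Y y -> f (g y) = y)].
Proof. by move=> [p s [g [q s' K K']]]; exists g; split=> //; split=> //; exists f. Qed.

Lemma ptlK t v : ptl (pcons t v : pt) = v. Proof. by []. Qed.

Lemma homeo_pcons (t : R) (X : space) : 0 <= t -> polyhedron X ->
  homeo X (pcons t @` X) (pcons t).
Proof.
move=> t0 pX; split=> //; first exact: pl_pcons.
exists ptl; split=> //.
- by apply: pl_ptl; exact: polyhedron_pcons.
- by rewrite image_comp image_id.
- by move=> _ [v _ <-].
Qed.

Lemma homeo_ptl (t : R) (X : space) : 0 <= t -> polyhedron X ->
  homeo (pcons t @` X) X ptl.
Proof.
move=> t0 pX; have [g [hg K K']] := homeo_inv (homeo_pcons t0 pX).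
by apply: homeo_ext hg => v tv; rewrite -[in RHS](K' _ tv).
Qed.

Lemma homeoU (A B A' B' : space) f : A `&` B = set0 -> A' `&` B' = set0 ->
  homeo A A' f -> homeo B B' f -> homeo (A `|` B) (A' `|` B') f.
Proof.
move=> dAB dAB' hA hB.
have [pA sA [gA [qA sA' KA KA']]] := hA; have [pB sB [gB [qB sB' KB KB']]] := hB.
have [poA poA'] := homeo_poly hA.
pose g v := if pselect (A' v) then gA v else gB v.
have gAE v : A' v -> g v = gA v by rewrite /g; case: pselect.
have gBE v : B' v -> g v = gB v.
  rewrite /g; case: pselect => // Av Bv.
  by have : (A' `&` B') v by []; rewrite dAB'.
split; [exact: plU | by rewrite image_setU sA sB | exists g; split].
- by apply: plU; [apply: pl_ext qA => v /gAE | apply: pl_ext qB => v /gBE].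
- rewrite image_setU -[in RHS]sA' -[in RHS]sB'.
  by congr (_ `|` _); apply: eq_imagel => v; [exact: gAE | exact: gBE].
- move=> x [Ax|Bx]; first by rewrite gAE ?KA //; exact: (homeo_to hA Ax).
  by rewrite gBE ?KB //; exact: (homeo_to hB Bx).
- by move=> y [Ay|By]; [rewrite gAE ?KA' | rewrite gBE ?KB'].
Qed.

End Polyhedra.

(** * Connectedness *)

Section Connected.
Context {R : realType}.
Local Notation pt := (@pt R).
Local Notation space := (@Defs.space R).

Let line (x y : pt) (t : R) : pt := fun i => x i + t * (y i - x i).

Let aff_line N a l x y t :
  aff N a l (line x y t) = aff N a l x + t * (aff N 0 l y - aff N 0 l x).
Proof.
rewrite /aff !add0r -addrA; congr (_ + _); rewrite -sumrB mulr_sumr -big_split /=.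
by apply: eq_bigr => i _; rewrite /line; ring.
Qed.

(** Along a line the conditions that cut out a cell are weak linear inequalities. *)
Let closed_cell_line (A : space) x y : cell A -> closed [set t | A (line x y t)].
Proof.
have hc c d : closed [set t : R | 0 <= c + t * d].
  apply: (@preimage_closed _ _ (fun t : R => c + t * d) [set u | 0 <= u]); last exact: closed_ge.
  move=> t _; apply: cvgD; first exact: cvg_cst.
  by apply: cvgM; [exact: cvg_id | exact: cvg_cst].
move=> [N [M [J [a [l ->]]]]].
have -> : [set t | [set v | [/\ forall i, (N <= i)%N -> v i = 0,
    forall i, `|v i| <= M & forall j, 0 <= aff N (a j) (l j) v]] (line x y t)] =
  [set t | forall i, (N <= i)%N -> 0 <= x i + t * (y i - x i)] `&`
  [set t | forall i, (N <= i)%N -> 0 <= - x i + t * (- (y i - x i))] `&`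
  [set t | forall i : nat, True -> 0 <= (x i + M) + t * (y i - x i)] `&`
  [set t | forall i : nat, True -> 0 <= (M - x i) + t * (- (y i - x i))] `&`
  [set t | forall j : J, True ->
     0 <= aff N (a j) (l j) x + t * (aff N 0 (l j) y - aff N 0 (l j) x)].
  apply/seteqP; split=> t /=.
    move=> [h1 h2 h3]; do 4?split.
    - by move=> i /h1; rewrite /line => ->.
    - by move=> i /h1; rewrite /line; lra.
    - by move=> i _; have := h2 i; rewrite ler_norml /line => /andP[]; lra.
    - by move=> i _; have := h2 i; rewrite ler_norml /line => /andP[]; lra.
    - by move=> j _; rewrite -aff_line.
  move=> [[[[h1 h2] h3] h4] h5]; split.
  - by move=> i Ni; have := h1 i Ni; have := h2 i Ni; rewrite /line; lra.
  - by move=> i; have := h3 i I; have := h4 i I; rewrite ler_norml /line; lra.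
  - by move=> j; rewrite aff_line; exact: h5.
have bigc (T : Type) (P : set T) (c d : T -> R) :
    closed [set t : R | forall i, P i -> 0 <= c i + t * d i].
  by apply: (@closed_bigI _ _ P (fun i => [set t | 0 <= c i + t * d i])) => i _.
by repeat (apply: closedI; last exact: bigc); exact: bigc.
Qed.

Lemma connected0 : pl_connected (set0 : space).
Proof.
move=> A B _ _ e _; left; rewrite -subset0 => v Av.
by rewrite e; left.
Qed.

(** Two disjoint polyhedra covering X would split a segment in X into two disjoint
    non-empty closed sets. *)
Lemma convex_connected (X : space) :
  (forall x y t, X x -> X y -> 0 <= t <= 1 -> X (line x y t)) -> pl_connected X.
Proof.
move=> cX A B pA pB XE AB0.
have clo (C : space) x y : polyhedron C -> closed [set t | C (line x y t)].
  move=> [J [c [-> hc]]].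
  have -> : [set t | [set v | exists j, c j v] (line x y t)] =
      \bigcup_(j in [set: J]) [set t | c j (line x y t)].
    by apply/seteqP; split=> t /= [j]; [exists j | move=> _; exists j].
  by apply: closed_bigcup => [|j _]; [exact: finite_finset | apply: closed_cell_line; exact: hc].
apply: contrapT => /not_orP[/eqP/set0P[a Aa] /eqP/set0P[b Bb]].
have Xa : X a by rewrite XE; left.
have Xb : X b by rewrite XE; right.
pose S := [set t : R | A (line a b t)]; pose T := [set t : R | B (line a b t)].
have l0 : line a b 0 = a by apply/funext => i; rewrite /line mul0r addr0.
have l1 : line a b 1 = b by apply/funext => i; rewrite /line; ring.
have dis v : A v -> B v -> False by move=> Av Bv; have : (A `&` B) v by []; rewrite AB0.
have in01 (t : R) : `[0, 1]%classic t = (0 <= t <= 1) :> Prop by rewrite /= in_itv.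
(* S is closed, and it is also open in [0, 1] as the complement of T. *)
have con := @segment_connected R 0 1 (`[0, 1] `&` S).
have : `[0, 1]%classic (1 : R) by rewrite in01 lexx ler01.
rewrite -con; first by case=> _; rewrite /S /= l1 => /dis; apply.
- by exists 0; split; rewrite ?in01 /S /= ?l0 // lexx ler01.
- exists (~` T); first by apply: closed_openC; exact: clo.
  apply/seteqP; split=> t [t01 h]; split=> //; first by move=> Tt; exact: dis h Tt.
  have : X (line a b t) by apply: cX => //; rewrite -in01.
  by rewrite XE => -[].
- by exists S => //; exact: clo.
Qed.

Lemma cube_connected d : pl_connected (@cube R d).
Proof.
apply: convex_connected => x y t hx hy ht i; have := hx i; have := hy i.
rewrite /line; case: ifP => _; last by move=> /eqP -> /eqP ->; apply/eqP; ring.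
by nra.
Qed.

Lemma connected_homeo (X Y : space) f : homeo X Y f -> pl_connected X -> pl_connected Y.
Proof.
move=> hf cX A B pA pB YE AB0.
have [pX pY] := homeo_poly hf; have [pf s _] := hf.
have pre C : polyhedron C -> polyhedron (X `&` f @^-1` C).
  by move=> pC; apply: (polyhedron_pre pf pY) => // v; exact: (homeo_to hf).
have imE C : C `<=` Y -> X `&` f @^-1` C = set0 -> C = set0.
  move=> CY e; rewrite -subset0 => y Cy; have := CY _ Cy; rewrite -s => -[x Xx xy].
  suff : (X `&` f @^-1` C) x by rewrite e.
  by split=> //=; rewrite xy.
have [] := cX _ _ (pre _ pA) (pre _ pB).
- rewrite -setIUr -preimage_setU -YE; apply/seteqP; split=> [x Xx|x []//].
  by split=> //; exact: (homeo_to hf Xx).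
- by rewrite -setIIr -preimage_setI AB0 preimage_set0 setI0.
- by move=> h; left; apply: imE h; rewrite YE => v; left.
- by move=> h; right; apply: imE h; rewrite YE => v; right.
Qed.

Lemma connected_in (A B C : space) : polyhedron A -> polyhedron B ->
  A `&` B = set0 -> polyhedron C -> pl_connected C -> C `<=` A `|` B ->
  C `<=` A \/ C `<=` B.
Proof.
move=> pA pB AB0 pC cC CAB.
have [] := cC (C `&` A) (C `&` B) (polyhedronI pC pA) (polyhedronI pC pB).
- by rewrite -setIUr; apply/esym/setIidl.
- by rewrite setIACA setIid AB0 setI0.
- move=> e; right=> v Cv; case: (CAB v Cv) => // Av.
  by have : (C `&` A) v by []; rewrite e.
- move=> e; left=> v Cv; case: (CAB v Cv) => // Bv.
  by have : (C `&` B) v by []; rewrite e.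
Qed.

End Connected.

(** * Manifolds, boundaries and disjoint unions *)

Section Manifolds.
Context {R : realType}.
Local Notation pt := (@pt R).
Local Notation space := (@Defs.space R).

Lemma bnd_sub k (X : space) : bnd k X `<=` X.
Proof. by case: k => [|d] x //= []. Qed.

Lemma mfd_polyhedron k (X : space) : mfd k X -> polyhedron X.
Proof. by case: k => [-> |d []//]; exact: polyhedron0. Qed.

(** A chart neighbourhood is connected, being the image of a cube, so it lies in the
    summand that contains x. *)
Lemma chart_sub d (A B : space) x f : polyhedron A -> polyhedron B ->
  A `&` B = set0 -> A x -> chart d (A `|` B) x f -> chart d A x f.
Proof.
move=> pA pB AB0 Ax [hf [C [pC XE nCx]]]; split=> //.
exists (C `&` A); split; [exact: polyhedronI | | by case].
have fx : (f @` cube d) x.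
  by have : (A `|` B) x; [left | rewrite XE => -[]].
have [_ pf] := homeo_poly hf.
have cf : pl_connected (f @` cube d) by exact: connected_homeo hf (@cube_connected _ d).
have fAB : f @` cube d `<=` A `|` B by rewrite XE; left.
have fA : f @` cube d `<=` A.
  have [//|fB] := connected_in pA pB AB0 pf cf fAB.
  by case: (disjoint_out AB0 Ax (fB _ fx)).
apply/seteqP; split=> [y Ay|y [/fA //|[]//]].
by have : (A `|` B) y; [left | rewrite XE => -[fy|Cy]; [left | right]].
Qed.

Lemma chart_union d (A B : space) x f : polyhedron B ->
  A `&` B = set0 -> A x -> chart d A x f -> chart d (A `|` B) x f.
Proof.
move=> pB AB0 Ax [hf [C [pC XE nCx]]]; split=> //.
exists (C `|` B); split; [exact: polyhedronU | by rewrite setUA -XE |].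
by case=> // Bx; exact: disjoint_out AB0 Ax Bx.
Qed.

Lemma open_cube_sub d : @open_cube R d `<=` cube d.
Proof. by move=> v h i; have := h i; case: ifP => // _ /andP[/ltW -> /ltW ->]. Qed.

Lemma interior_part d (A B : space) : polyhedron A -> polyhedron B ->
  A `&` B = set0 -> pl_interior d A = pl_interior d (A `|` B) `&` A.
Proof.
move=> pA pB AB0; apply/seteqP; split=> x.
  move=> [f [cf fx]].
  have Ax : A x.
    have [_ [C [_ -> _]]] := cf; left; move: fx => [v /open_cube_sub cv <-].
    by exists v.
  by split=> //; exists f; split=> //; exact: chart_union.
by move=> [[f [cf fx]] Ax]; exists f; split=> //; exact: chart_sub cf.
Qed.

Lemma bnd_part k (A B : space) : polyhedron A -> polyhedron B ->
  A `&` B = set0 -> bnd k A = bnd k (A `|` B) `&` A.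
Proof.
case: k => [|d] pA pB AB0 /=; first by rewrite set0I.
rewrite (interior_part d pA pB AB0); apply/seteqP; split=> x /=.
  by move=> [Ax h]; split=> //; split; [left | move=> hx; apply: h].
by move=> [[_ h] Ax]; split=> // -[].
Qed.

Lemma bndU k (A B : space) : polyhedron A -> polyhedron B ->
  A `&` B = set0 -> bnd k (A `|` B) = bnd k A `|` bnd k B.
Proof.
move=> pA pB AB0; have BA0 : B `&` A = set0 by rewrite setIC.
rewrite (bnd_part k pA pB AB0) (bnd_part k pB pA BA0) [B `|` A]setUC -setIUr.
by apply/esym/setIidl; exact: bnd_sub.
Qed.

(** Interior points and charts are local, and a boundary of the union is again the
    disjoint union of two polyhedra, so the induction runs over the dimension. *)
Lemma mfd_part k (A B : space) : polyhedron A -> polyhedron B ->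
  A `&` B = set0 -> mfd k (A `|` B) -> mfd k A.
Proof.
elim: k A B => [|k IH] A B pA pB AB0 /=.
  by move=> e; apply/seteqP; split=> // x Ax; rewrite -e; left.
move=> [pX cX mX bX].
have pbnd C : polyhedron C -> polyhedron (bnd k.+1 (A `|` B) `&` C).
  by move=> pC; apply: polyhedronI => //; exact: mfd_polyhedron mX.
have bA := bnd_part k.+1 pA pB AB0.
have bB : bnd k.+1 B = bnd k.+1 (A `|` B) `&` B.
  by rewrite setUC; apply: bnd_part; rewrite // setIC.
have pbA : polyhedron (bnd k.+1 A) by rewrite bA; exact: pbnd.
have pbB : polyhedron (bnd k.+1 B) by rewrite bB; exact: pbnd.
have b0 : bnd k.+1 A `&` bnd k.+1 B = set0.
  by rewrite bA bB setIACA AB0 setI0.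
have bAB := bndU k.+1 pA pB AB0.
split=> //.
- move=> x Ax; have [|f cf] := cX x; first by left.
  by exists f; exact: chart_sub cf.
- by apply: IH pbA pbB b0 _; rewrite -bAB.
- by rewrite (bnd_part k pbA pbB b0) -bAB [X in X `&` _]bX set0I.
Qed.

Lemma mfdU k (A B : space) : mfd k A -> mfd k B ->
  A `&` B = set0 -> mfd k (A `|` B).
Proof.
elim: k A B => [|k IH] A B.
  by move=> /= -> ->; rewrite setU0.
move=> mA mB AB0; have [pA cA mbA bA] := mA; have [pB cB mbB bB] := mB.
have bAB := bndU k.+1 pA pB AB0.
have b0 : bnd k.+1 A `&` bnd k.+1 B = set0.
  rewrite -subset0 => x [/bnd_sub Ax /bnd_sub Bx].
  exact: disjoint_out AB0 Ax Bx.
split.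
- exact: polyhedronU.
- move=> x [Ax|Bx].
    by have [f cf] := cA x Ax; exists f; exact: chart_union.
  by have [f cf] := cB x Bx; exists f; rewrite setUC; apply: chart_union; rewrite // setIC.
- by rewrite bAB; exact: IH.
- rewrite bAB bndU // ?[X in X `|` _]bA ?[X in _ `|` X]bB ?setU0 //.
    exact: mfd_polyhedron mbA.
  exact: mfd_polyhedron mbB.
Qed.

Lemma mfd0 k : mfd k (set0 : space).
Proof.
elim: k => [//|k IH] /=; have e : bnd k.+1 (set0 : space) = set0 by rewrite /= set0D.
split=> //; [exact: polyhedron0 | by rewrite set0D | rewrite set0D].
by case: k {IH e} => //= k; rewrite set0D.
Qed.

Lemma bnd0 k : bnd k (set0 : space) = set0.
Proof. by case: k => //= k; rewrite set0D. Qed.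

Lemma chart_homeo d (X Y : space) f x c : homeo X Y f -> X x ->
  chart d X x c -> chart d Y (f x) (f \o c).
Proof.
move=> hf Xx [hc [A [pA XE nAx]]].
have [_ pc] := homeo_poly hc.
have cX : c @` cube d `<=` X by rewrite XE; left.
have AX : A `<=` X by rewrite XE; right.
split.
  rewrite -image_comp; apply: homeo_comp hc _; exact: homeo_sub hf pc cX.
exists (f @` A); split.
- by have [] := homeo_poly (homeo_sub hf pA AX).
- by rewrite -image_comp -image_setU -XE; have [_ -> _] := hf.
- move=> [a Aa e]; apply: nAx; rewrite -(homeo_inj hf _ _ e) //; exact: AX.
Qed.

(** Charts can be transported along homeomorphisms in both directions. *)
Lemma bnd_homeo k (X Y : space) f : homeo X Y f -> bnd k Y = f @` bnd k X.
Proof.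
case: k => [|d] hf /=; first by rewrite image_set0.
have [g [hg K K']] := homeo_inv hf.
have int (X' Y' : space) f' x : homeo X' Y' f' -> X' x -> pl_interior d X' x ->
    pl_interior d Y' (f' x).
  move=> hf' Xx [c [cc [v ov e]]]; exists (f' \o c); split.
    exact: chart_homeo cc.
  by exists v; rewrite //= e.
apply/seteqP; split=> [y [Yy nint]|_ [x [Xx nint] <-]].
  have Xgy := homeo_to hg Yy.
  exists (g y); last exact: K'.
  by split=> // h; apply: nint; rewrite -(K' y Yy); exact: int hf Xgy h.
have Yfx := homeo_to hf Xx.
by split=> // h; apply: nint; rewrite -(K x Xx); exact: int hg Yfx h.
Qed.

Lemma mfd_homeo k (X Y : space) f : homeo X Y f -> mfd k X -> mfd k Y.
Proof.
elim: k X Y => [|k IH] X Y hf /=.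
  by move=> e; have [_ <- _] := hf; rewrite e image_set0.
move=> [pX cX mX bX]; have [_ pY] := homeo_poly hf.
have hb : homeo (bnd k.+1 X) (bnd k.+1 Y) f.
  rewrite (bnd_homeo k.+1 hf); apply: homeo_sub hf _ _; last exact: bnd_sub.
  exact: mfd_polyhedron mX.
split=> //.
- move=> y Yy; have [_ s _] := hf; move: Yy; rewrite -{1}s => -[x Xx <-].
  by have [c cc] := cX x Xx; exists (f \o c); exact: chart_homeo cc.
- exact: IH hb mX.
- by rewrite (bnd_homeo k hb) bX image_set0.
Qed.

Lemma homeo_bnd k (X Y : space) f : mfd k.+1 X -> homeo X Y f ->
  homeo (bnd k.+1 X) (bnd k.+1 Y) f.
Proof.
move=> [_ _ mb _] hf; rewrite (bnd_homeo k.+1 hf); apply: (homeo_sub hf).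
  exact: mfd_polyhedron mb.
exact: bnd_sub.
Qed.

Lemma component_homeo (X X' C : space) f : homeo X X' f -> pl_component X C ->
  pl_component X' (f @` C).
Proof.
move=> hf [CX [v Cv] pC pXC cC].
have hC := homeo_sub hf pC CX.
have XCX : X `\` C `<=` X by move=> u [].
split.
- by move=> _ [u Cu <-]; exact: homeo_to hf (CX _ Cu).
- by exists (f v); exists v.
- by have [] := homeo_poly hC.
- have -> : X' `\` f @` C = f @` (X `\` C).
    apply/seteqP; split=> [y [X'y nC]|_ [u [Xu nCu] <-]].
      have [_ s _] := hf; move: (X'y); rewrite -s => -[u Xu uy].
      by exists u => //; split=> // Cu; apply: nC; exists u.
    split; first exact: homeo_to hf Xu.
    by move=> [w Cw e]; apply: nCu; rewrite -(homeo_inj hf (CX _ Cw) Xu e).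
  by have [] := homeo_poly (homeo_sub hf pXC XCX).
- exact: connected_homeo hC cC.
Qed.

Lemma component_union (A B C : space) : polyhedron B -> A `&` B = set0 ->
  pl_component A C -> pl_component (A `|` B) C.
Proof.
move=> pB d0 [CA C0 pC pAC cC]; split=> //; first by move=> v /CA; left.
have -> : (A `|` B) `\` C = (A `\` C) `|` B.
  rewrite setDUl; congr (_ `|` _); apply/seteqP; split=> [v []//|v Bv]; split=> //.
  by move=> /CA Av; exact: disjoint_out d0 Av Bv.
exact: polyhedronU.
Qed.

Lemma component_part (A B C : space) : polyhedron A -> C `<=` A ->
  pl_component (A `|` B) C -> pl_component A C.
Proof.
move=> pA CA [_ C0 pC pAC cC]; split=> //.
have -> : A `\` C = ((A `|` B) `\` C) `&` A.
  apply/seteqP; split=> v; first by move=> [Av nC]; split=> //; split=> //; left.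
  by move=> [[_ nC] Av].
exact: polyhedronI.
Qed.

Lemma ball_homeo d (B B' : space) f : pl_ball d B -> homeo B B' f -> pl_ball d B'.
Proof. by move=> [g hg] hf; exists (f \o g); exact: homeo_comp hg hf. Qed.

End Manifolds.

(** * Gluings of manifolds *)

Section Gluings.
Context {R : realType}.
Local Notation pt := (@pt R).
Local Notation space := (@Defs.space R).

(** Y meets A and B in two disjoint polyhedra. *)
Lemma mfd_cap k (A B Y : space) : polyhedron A -> polyhedron B ->
  A `&` B = set0 -> Y `<=` A `|` B -> mfd k Y ->
  mfd k (Y `&` A) /\ bnd k (Y `&` A) = bnd k Y `&` A.
Proof.
move=> pA pB AB0 YAB mY; have pY := mfd_polyhedron mY.
have YE : Y = (Y `&` A) `|` (Y `&` B) by rewrite -setIUr; apply/esym/setIidl.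
have YA : polyhedron (Y `&` A) by exact: polyhedronI.
have YB : polyhedron (Y `&` B) by exact: polyhedronI.
have Y0 : (Y `&` A) `&` (Y `&` B) = set0 by rewrite setIACA AB0 setI0.
split; first by apply: mfd_part YA YB Y0 _; rewrite -YE.
rewrite (bnd_part k YA YB Y0) -YE setIA; congr (_ `&` _).
by apply: setIidl; exact: bnd_sub.
Qed.

Lemma is_dsumU k (A B : space) : mfd k A -> mfd k B -> A `&` B = set0 ->
  is_dsum k A B (A `|` B).
Proof. by move=> mA mB d0; split=> //; exact: mfdU. Qed.

Lemma is_dsumC k (A B Z : space) : is_dsum k A B Z -> is_dsum k B A Z.
Proof. by move=> [mA mB mZ e d0]; split=> //; rewrite 1?setUC 1?setIC. Qed.

Lemma is_dsum_bnd k (A B Z : space) : is_dsum k.+1 A B Z ->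
  is_dsum k (bnd k.+1 A) (bnd k.+1 B) (bnd k.+1 Z).
Proof.
move=> [mA mB mZ -> d0]; have pA := mfd_polyhedron mA; have pB := mfd_polyhedron mB.
have [_ _ mbA _] := mA; have [_ _ mbB _] := mB.
have b0 : bnd k.+1 A `&` bnd k.+1 B = set0.
  by apply: dis0 => v /bnd_sub Av /bnd_sub Bv; exact: disjoint_out d0 Av Bv.
by rewrite bndU //; exact: is_dsumU.
Qed.

Lemma is_dsum_cap k (A B Y : space) : polyhedron A -> polyhedron B ->
  A `&` B = set0 -> Y `<=` A `|` B -> mfd k Y ->
  is_dsum k (Y `&` A) (Y `&` B) Y.
Proof.
move=> pA pB d0 YAB mY; have [mYA _] := mfd_cap pA pB d0 YAB mY.
have [mYB _] : mfd k (Y `&` B) /\ bnd k (Y `&` B) = bnd k Y `&` B.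
  by apply: (mfd_cap pB pA); rewrite 1?setIC 1?setUC.
split=> //; first by rewrite -setIUr; apply/esym/setIidl.
by rewrite setIACA d0 setI0.
Qed.

Section Consequences.
Context (d : nat) (X Y1 Y2 : space) (h : pt -> pt) (W X' : space) (q : pt -> pt).
Hypothesis G : gluing d X Y1 Y2 h W X' q.

Lemma glu_subY1 : Y1 `<=` X.
Proof. by move=> v Yv; apply: (@bnd_sub _ d.+1); rewrite (glu_bnd G); left; left. Qed.
Lemma glu_subY2 : Y2 `<=` X.
Proof. by move=> v Yv; apply: (@bnd_sub _ d.+1); rewrite (glu_bnd G); left; right. Qed.
Lemma glu_subW : W `<=` X.
Proof. by move=> v Yv; apply: (@bnd_sub _ d.+1); rewrite (glu_bnd G); right. Qed.
Lemma glu_mfdY : mfd d (Y1 `|` Y2).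
Proof. by apply: mfdU; [exact: glu_Y1 G | exact: glu_Y2 G | exact: glu_disj G]. Qed.

End Consequences.

(** Points that are identified have the same image, hence lie in the same summand:
    h maps the part of Y1 in A to the part of Y2 in A. *)
Lemma gluing_part d (A B Y1 Y2 : space) h W A' B' q :
  gluing d (A `|` B) Y1 Y2 h W (A' `|` B') q ->
  polyhedron A -> polyhedron B -> A `&` B = set0 ->
  polyhedron A' -> polyhedron B' -> A' `&` B' = set0 ->
  (forall v, A v -> A' (q v)) -> (forall v, B v -> B' (q v)) ->
  gluing d A (Y1 `&` A) (Y2 `&` A) h (W `&` A) A' q.
Proof.
move=> G pA pB d0 pA' pB' d0' qA qB.
have cap k Y := @mfd_cap k A B Y pA pB d0.
have capY1 := cap _ _ (glu_subY1 G) (glu_Y1 G).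
have capY2 := cap _ _ (glu_subY2 G) (glu_Y2 G).
have capW := cap _ _ (glu_subW G) (glu_W G).
have subY : Y1 `|` Y2 `<=` A `|` B.
  by move=> v [/(glu_subY1 G)|/(glu_subY2 G)].
have capY := cap _ _ subY (glu_mfdY G).
(* the image of a point decides in which summand it lies *)
have ynb v : (A `|` B) v -> A' (q v) -> A v.
  by case=> // /qB Bq Aq; case: (disjoint_out d0' Aq Bq).
have hh := glu_h G.
have qh y : Y1 y -> q y = q (h y).
  move=> Yy; apply/(glu_eq G); first exact: (glu_subY1 G).
    by apply: (glu_subY2 G); exact: (homeo_to hh).
  by constructor 2.
split.
- exact: mfd_part pA pB d0 (glu_src G).
- exact: mfd_part pA' pB' d0' (glu_tgt G).
- by have [] := capY1.
- by have [] := capY2.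
- by have [] := capW.
- have -> : Y2 `&` A = h @` (Y1 `&` A).
    apply/seteqP; split=> [z [Yz Az]|_ [y [Yy Ay] <-]].
      have [_ s _] := hh; move: (Yz); rewrite -s => -[y Yy e].
      exists y => //; split=> //; apply: ynb; first exact: (glu_subY1 G).
      by rewrite qh // e; exact: qA.
    have Yhy := homeo_to hh Yy; split=> //.
    by apply: ynb; [exact: (glu_subY2 G) | rewrite -qh //; exact: qA].
  apply: (homeo_sub hh) => [|v []//].
  by apply: polyhedronI => //; exact: mfd_polyhedron (glu_Y1 G).
- by rewrite setIACA (glu_disj G) set0I.
- by rewrite (bnd_part d.+1 pA pB d0) (glu_bnd G) -!setIUl.
- by have [_ ->] := capW; rewrite (glu_bndW G) -setIUl setIACA setIid.
- by rewrite -setIUl; have [_ ->] := capY; rewrite (glu_bndY G) setIACA setIid.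
- by apply: pl_sub (glu_pl G) pA _; left.
- apply/seteqP; split=> [_ [v Av <-]|y A'y]; first exact: qA.
  have : (A' `|` B') y by left.
  rewrite -(glu_surj G) => -[x Xx e]; exists x => //.
  by apply: ynb; rewrite ?e.
- move=> x x' Ax Ax'; rewrite (glu_eq G); [|by left|by left].
  split=> -[e|[y e]|[y e]].
  + by constructor 1.
  + by constructor 2.
  + by constructor 3.
  + by constructor 1.
  + by case: y => y _; constructor 2.
  + by case: y => y _; constructor 3.
Qed.

Definition union_map (A : space) (h k : pt -> pt) (v : pt) : pt :=
  if pselect (A v) then h v else k v.

Lemma union_mapl A h k v : A v -> union_map A h k v = h v.
Proof. by rewrite /union_map; case: pselect. Qed.

Lemma union_mapr (A B : space) h k v : A `&` B = set0 -> B v ->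
  union_map A h k v = k v.
Proof.
rewrite /union_map; case: pselect => // Av d0 Bv.
by case: (disjoint_out d0 Av Bv).
Qed.

Lemma gluing_union d (A Y1 Y2 : space) h W A' (B T1 T2 : space) k V B' q :
  gluing d A Y1 Y2 h W A' q -> gluing d B T1 T2 k V B' q ->
  A `&` B = set0 -> A' `&` B' = set0 ->
  gluing d (A `|` B) (Y1 `|` T1) (Y2 `|` T2) (union_map A h k) (W `|` V)
    (A' `|` B') q.
Proof.
move=> G H d0 d0'.
have sub0 (C D : space) : C `<=` A -> D `<=` B -> C `&` D = set0.
  move=> CA DB; rewrite -subset0 => v [/CA Av /DB Bv].
  exact: disjoint_out d0 Av Bv.
have y1 := glu_subY1 G; have y2 := glu_subY2 G; have w := glu_subW G.
have t1 := glu_subY1 H; have t2 := glu_subY2 H; have u := glu_subW H.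
have hE v : A v -> union_map A h k v = h v by exact: union_mapl.
have kE v : B v -> union_map A h k v = k v by exact: union_mapr.
have pA := mfd_polyhedron (glu_src G); have pB := mfd_polyhedron (glu_src H).
have pW := mfd_polyhedron (glu_W G); have pV := mfd_polyhedron (glu_W H).
have yy : Y1 `|` Y2 `<=` A by move=> v [/y1|/y2].
have tt : T1 `|` T2 `<=` B by move=> v [/t1|/t2].
have capE (Y T : space) : Y `<=` A -> T `<=` B ->
    (Y `&` W) `|` (T `&` V) = (Y `|` T) `&` (W `|` V).
  move=> YA TB; rewrite setIUl !setIUr (sub0 Y V) // setU0.
  by rewrite [T `&` W]setIC (sub0 W T) // set0U.
split.
- exact: mfdU (glu_src G) (glu_src H) d0.
- exact: mfdU (glu_tgt G) (glu_tgt H) d0'.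
- exact: mfdU (glu_Y1 G) (glu_Y1 H) (sub0 _ _ y1 t1).
- exact: mfdU (glu_Y2 G) (glu_Y2 H) (sub0 _ _ y2 t2).
- exact: mfdU (glu_W G) (glu_W H) (sub0 _ _ w u).
- apply: homeoU (sub0 _ _ y1 t1) (sub0 _ _ y2 t2) _ _.
    by apply: homeo_ext (glu_h G) => v /y1 Av; rewrite hE.
  by apply: homeo_ext (glu_h H) => v /t1 Bv; rewrite kE.
- rewrite setIUl !setIUr (glu_disj G) (glu_disj H) (sub0 _ _ y1 t2).
  by rewrite [T1 `&` Y2]setIC (sub0 _ _ y2 t1) !setU0.
- by rewrite bndU // (glu_bnd G) (glu_bnd H) setUACA (setUACA Y1).
- by rewrite (bndU _ pW pV (sub0 _ _ w u)) (glu_bndW G) (glu_bndW H) capE // (setUACA Y1).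
- rewrite setUACA (bndU _ (mfd_polyhedron (glu_mfdY G))
    (mfd_polyhedron (glu_mfdY H)) (sub0 _ _ yy tt)).
  by rewrite (glu_bndY G) (glu_bndY H) capE.
- by apply: plU; [exact: glu_pl G | exact: glu_pl H].
- by rewrite image_setU (glu_surj G) (glu_surj H).
- have toA v : A v -> A' (q v) by rewrite -(glu_surj G) => Av; exists v.
  have toB v : B v -> B' (q v) by rewrite -(glu_surj H) => Bv; exists v.
  have hA v : Y1 v -> A (h v) by move=> Yv; apply: y2; exact: (homeo_to (glu_h G)).
  have kB v : T1 v -> B (k v) by move=> Yv; apply: t2; exact: (homeo_to (glu_h H)).
  have no v : A v -> B v -> False by exact: disjoint_out.
  have noY v : Y1 v -> B v -> False by move=> /y1; exact: no.
  have noT v : A v -> T1 v -> False by move=> Av /t1; exact: no.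
  move=> x x' [Ax|Bx] [Ax'|Bx'].
  + rewrite (glu_eq G) //; split.
      move=> [e|[? ?]|[? ?]]; [by constructor 1 | constructor 2 | constructor 3];
      by split; [left | rewrite hE].
    move=> [?|[[?|?] e]|[[?|?] e]]; [by constructor 1 | constructor 2 | | constructor 3 |].
    * by rewrite -hE.
    * by case: (noT x).
    * by rewrite -hE.
    * by case: (noT x').
  + split=> [e|]; first by case: (disjoint_out d0' (toA _ Ax) _); rewrite e; exact: toB.
    move=> [e|[[y|t] e]|[[y|t] e]].
    * by case: (no x) => //; rewrite e.
    * by case: (no x'); rewrite // e hE //; exact: hA.
    * by case: (noT x).
    * by case: (noY x').
    * by case: (no x); rewrite // e kE //; exact: kB.
  + split=> [e|]; first by case: (disjoint_out d0' (toA _ Ax') _); rewrite -e; exact: toB.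
    move=> [e|[[y|t] e]|[[y|t] e]].
    * by case: (no x) => //; rewrite e.
    * by case: (noY x).
    * by case: (no x'); rewrite // e kE //; exact: kB.
    * by case: (no x); rewrite // e hE //; exact: hA.
    * by case: (noT x').
  + rewrite (glu_eq H) //; split.
      move=> [e|[? ?]|[? ?]]; [by constructor 1 | constructor 2 | constructor 3];
      by split; [right | rewrite kE].
    move=> [?|[[?|?] e]|[[?|?] e]]; [by constructor 1 | | constructor 2 | | constructor 3].
    * by case: (noY x).
    * by rewrite -kE.
    * by case: (noY x').
    * by rewrite -kE.
Qed.

(** Conjugation of all the data by f; g is an inverse of f on X. *)
Lemma gluing_homeo d (X Y1 Y2 : space) h W X' q (Z Z' : space) f f' g r :
  gluing d X Y1 Y2 h W X' q -> homeo X Z f -> homeo X' Z' f' ->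
  (forall v, X v -> g (f v) = v) -> (forall v, X v -> f' (q v) = r (f v)) ->
  gluing d Z (f @` Y1) (f @` Y2) (f \o h \o g) (f @` W) Z' r.
Proof.
move=> G hf hf' gK qr.
have y1 := glu_subY1 G; have y2 := glu_subY2 G; have w := glu_subW G.
have yy : Y1 `|` Y2 `<=` X by move=> v [/y1|/y2].
have pY1 := mfd_polyhedron (glu_Y1 G); have pY2 := mfd_polyhedron (glu_Y2 G).
have pW := mfd_polyhedron (glu_W G).
have pY := mfd_polyhedron (glu_mfdY G).
have hs A := @homeo_sub _ X Z A f hf.
have [g0 [hg K K']] := homeo_inv hf.
have gE v : Z v -> g v = g0 v by move=> Zv; rewrite -{1}(K' v) // gK //; exact: (homeo_to hg).
have qs := glu_surj G.
have qX' v : X v -> X' (q v) by rewrite -qs => Xv; exists v.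
have imI (A B : space) : A `<=` X -> B `<=` X -> f @` (A `&` B) = f @` A `&` f @` B.
  move=> AX BX; apply/seteqP; split=> [_ [v [Av Bv] <-]|y]; first by split; exists v.
  move=> [[v Av <-] [u Bu e]]; exists v => //; split=> //.
  by rewrite -(homeo_inj hf _ _ e) //; [exact: BX | exact: AX].
split.
- exact: mfd_homeo hf (glu_src G).
- exact: mfd_homeo hf' (glu_tgt G).
- exact: mfd_homeo (hs _ pY1 y1) (glu_Y1 G).
- exact: mfd_homeo (hs _ pY2 y2) (glu_Y2 G).
- exact: mfd_homeo (hs _ pW w) (glu_W G).
- have [g1 [hg1 K1 K1']] := homeo_inv (hs _ pY1 y1).
  apply: homeo_ext (homeo_comp (homeo_comp hg1 (glu_h G)) (hs _ pY2 y2)).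
  by move=> _ [v Yv <-] /=; rewrite K1 // gK //; exact: y1.
- by rewrite -imI // (glu_disj G) image_set0.
- by rewrite (bnd_homeo d.+1 hf) (glu_bnd G) !image_setU.
- by rewrite (bnd_homeo d (hs _ pW w)) (glu_bndW G) imI // image_setU.
- by rewrite -image_setU (bnd_homeo d (hs _ pY yy)) (glu_bndY G) imI.
- have [plg sg _] := hg; have [plf' _ _] := hf'.
  apply: (pl_ext (f := (f' \o q) \o g0)).
    by move=> v Zv /=; rewrite qr ?K' //; exact: (homeo_to hg).
  exact: pl_comp plg sg (pl_comp (glu_pl G) qs plf').
- have [_ <- _] := hf; have [_ <- _] := hf'.
  rewrite -[in RHS]qs !image_comp.
  by apply: eq_imagel => v Xv /=; rewrite qr.
- move=> z z'; have [_ <- _] := hf => -[x Xx <-] [x' Xx' <-].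
  rewrite -!qr //; transitivity (q x = q x').
    split=> [|->//]; apply: (homeo_inj hf'); exact: qX'.
  have hX v : Y1 v -> X (h v) by move=> Yv; apply: y2; exact: (homeo_to (glu_h G)).
  rewrite (glu_eq G) //; split.
    move=> [->|[Yx ->]|[Yx ->]]; [by constructor 1 | constructor 2 | constructor 3].
      by split; [exists x | rewrite /= gK].
    by split; [exists x' | rewrite /= gK].
  have yx v u : Y1 v -> X u -> f v = f u -> v = u.
    by move=> Yv Xu; apply: (homeo_inj hf) => //; exact: y1.
  move=> [e|[[y Yy e] e']|[[y Yy e] e']].
  + by constructor 1; exact: (homeo_inj hf) e.
  + have yxE := yx _ _ Yy Xx e; subst y.
    constructor 2; split=> //; apply: (homeo_inj hf) => //; first exact: hX.
    by rewrite e' /= gK.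
  + have yxE := yx _ _ Yy Xx' e; subst y.
    constructor 3; split=> //; apply: (homeo_inj hf) => //; first exact: hX.
    by rewrite e' /= gK.
Qed.

Lemma gluing_empty d (X X' : space) h q : mfd d.+1 X -> homeo X X' q ->
  gluing d X set0 set0 h (bnd d.+1 X) X' q.
Proof.
move=> mX hq; have [pX _ mb bb] := mX; have [pq sq _] := hq.
split=> //; rewrite ?set0U ?set0I //; try exact: mfd0; try exact: bnd0.
- exact: mfd_homeo hq mX.
- have e0 : homeo (set0 : space) set0 id by apply: homeo_id; exact: polyhedron0.
  by apply: homeo_ext e0.
- move=> x x' Xx Xx'; split=> [e|[->//|[]//|[]//]].
  by constructor 1; exact: (homeo_inj hq) e.
Qed.

Lemma bnd_pcons k (t : R) (X : space) : 0 <= t -> polyhedron X ->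
  bnd k (pcons t @` X) = pcons t @` bnd k X.
Proof. by move=> t0 pX; exact: bnd_homeo (homeo_pcons t0 pX). Qed.

Lemma mfd_pcons k (t : R) (X : space) : 0 <= t -> mfd k X -> mfd k (pcons t @` X).
Proof.
move=> t0 mX; have pX := mfd_polyhedron mX.
exact: mfd_homeo (homeo_pcons t0 pX) mX.
Qed.

Lemma inj12 (A B : space) : inj1 @` A `&` inj2 @` B = set0.
Proof.
rewrite -subset0 => _ [[v _ <-] [w _ /(congr1 (fun x => x 0%N))]] /=.
by move=> /eqP; rewrite oner_eq0.
Qed.

Lemma mfd_inj1 k (X : space) : mfd k X -> mfd k (inj1 @` X).
Proof. by apply: mfd_pcons. Qed.
Lemma mfd_inj2 k (X : space) : mfd k X -> mfd k (inj2 @` X).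
Proof. by apply: mfd_pcons; exact: ler01. Qed.
Lemma homeo_inj1 (X : space) : polyhedron X -> homeo X (inj1 @` X) inj1.
Proof. by apply: homeo_pcons. Qed.
Lemma homeo_inj2 (X : space) : polyhedron X -> homeo X (inj2 @` X) inj2.
Proof. by apply: homeo_pcons; exact: ler01. Qed.
Lemma homeo_ptl1 (X : space) : polyhedron X -> homeo (inj1 @` X) X ptl.
Proof. by apply: homeo_ptl. Qed.
Lemma homeo_ptl2 (X : space) : polyhedron X -> homeo (inj2 @` X) X ptl.
Proof. by apply: homeo_ptl; exact: ler01. Qed.
Lemma bnd_inj1 k (X : space) : polyhedron X -> bnd k (inj1 @` X) = inj1 @` bnd k X.
Proof. by apply: bnd_pcons. Qed.
Lemma bnd_inj2 k (X : space) : polyhedron X -> bnd k (inj2 @` X) = inj2 @` bnd k X.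
Proof. by apply: bnd_pcons; exact: ler01. Qed.

Lemma dsum_is_dsum k (A B : space) : mfd k A -> mfd k B ->
  is_dsum k (inj1 @` A) (inj2 @` B) (dsum A B).
Proof.
move=> mA mB; split=> //; try exact: mfd_inj1; try exact: mfd_inj2; last exact: inj12.
by apply: mfdU; [exact: mfd_inj1 | exact: mfd_inj2 | exact: inj12].
Qed.

(** S is obtained from P and W by gluing them along their whole common boundary.  It
    is the shape of the boundary of a manifold that is to be glued: P is the pair of
    pieces to be glued and W the rest ([gluing_closes_bnd]). *)
Definition closes k (P W S : space) : Prop :=
  [/\ mfd k P, mfd k W, mfd k S, S = P `|` W &
      bnd k P = P `&` W /\ bnd k W = P `&` W].

(** The result is closed, so nothing remains of the boundary of the two pieces. *)
Lemma gluing_closes k (P W S : space) : closes k.+1 P W S ->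
  gluing k (dsum P W) (inj1 @` (P `&` W)) (inj2 @` (P `&` W)) (inj2 \o ptl)
    set0 S ptl.
Proof.
move=> [mP mW mS SE [bP bW]].
have mPW : mfd k (P `&` W) by rewrite -bP; case: mP.
have bPW : bnd k (P `&` W) = set0 by rewrite -bP; case: mP.
have pP := mfd_polyhedron mP; have pW := mfd_polyhedron mW.
have pPW := mfd_polyhedron mPW.
split=> //.
- by case: (dsum_is_dsum mP mW).
- exact: mfd_inj1.
- exact: mfd_inj2.
- exact: mfd0.
- exact: homeo_comp (homeo_ptl1 pPW) (homeo_inj2 pPW).
- exact: inj12.
- rewrite bndU ?bnd_inj1 ?bnd_inj2 ?bP ?bW ?setU0 //; last exact: inj12.
  + exact: mfd_polyhedron (mfd_inj1 mP).
  + exact: mfd_polyhedron (mfd_inj2 mW).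
- by rewrite bnd0 setI0.
- rewrite bndU ?bnd_inj1 ?bnd_inj2 ?bPW ?image_set0 ?setI0 ?setU0 //; last exact: inj12.
  + exact: mfd_polyhedron (mfd_inj1 mPW).
  + exact: mfd_polyhedron (mfd_inj2 mPW).
- apply: plU; apply: pl_ptl; first exact: mfd_polyhedron (mfd_inj1 mP).
  exact: mfd_polyhedron (mfd_inj2 mW).
- by rewrite SE /dsum image_setU !image_comp !image_id.
- move=> _ _ [[v Pv <-]|[v Wv <-]] [[w Pw <-]|[w Ww <-]]; rewrite !ptlK.
  + split=> [->|]; first by constructor 1.
    move=> [/(congr1 ptl)//|[_ /= e]|[_ /= e]].
      by have := congr1 (fun x => x 0%N) e => /= /esym /eqP; rewrite oner_eq0.
    by have := congr1 (fun x => x 0%N) e => /= /esym /eqP; rewrite oner_eq0.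
  + split=> [e|].
      by constructor 2; split; [exists v => //; split => //; rewrite e | rewrite /= e].
    by move=> [/(congr1 ptl)//|[_ /(congr1 ptl)//]|[_ /(congr1 ptl)//]].
  + split=> [e|].
      by constructor 3; split; [exists w => //; split => //; rewrite -e | rewrite /= e].
    by move=> [/(congr1 ptl)//|[_ /(congr1 ptl)//]|[_ /(congr1 ptl)//]].
  + split=> [->|]; first by constructor 1.
    by move=> [/(congr1 ptl)//|[_ /(congr1 ptl)//]|[_ /(congr1 ptl)//]].
Qed.

Lemma gluing_closes_bnd d (X Y1 Y2 : space) h W X' q :
  gluing d X Y1 Y2 h W X' q -> closes d (Y1 `|` Y2) W (bnd d.+1 X).
Proof.
move=> G; split; [exact: glu_mfdY G | exact: glu_W G | | exact: glu_bnd G |].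
  by have [] := glu_src G.
by split; [exact: glu_bndY G | exact: glu_bndW G].
Qed.

Lemma closes_homeo k (P W S S' : space) f : closes k P W S -> homeo S S' f ->
  closes k (f @` P) (f @` W) S'.
Proof.
move=> [mP mW mS SE [bP bW]] hf.
have PS : P `<=` S by rewrite SE; left.
have WS : W `<=` S by rewrite SE; right.
have hP := homeo_sub hf (mfd_polyhedron mP) PS.
have hW := homeo_sub hf (mfd_polyhedron mW) WS.
have imI : f @` (P `&` W) = f @` P `&` f @` W.
  apply/seteqP; split=> [_ [v [Av Bv] <-]|y]; first by split; exists v.
  move=> [[v Av <-] [u Bu e]]; exists v => //; split=> //.
  by rewrite -(homeo_inj hf _ _ e) //; [exact: WS | exact: PS].
split; [exact: mfd_homeo hP mP | exact: mfd_homeo hW mW | exact: mfd_homeo hf mS | |].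
  by have [_ <- _] := hf; rewrite SE image_setU.
by rewrite (bnd_homeo k hP) (bnd_homeo k hW) bP bW imI.
Qed.

Lemma homeo_dsum (P P' W W' : space) (f g : pt -> pt) :
  homeo P P' f -> homeo W W' g ->
  homeo (dsum P W) (dsum P' W') (dsum_map f g).
Proof.
move=> hf hg; have [pP pP'] := homeo_poly hf; have [pW pW'] := homeo_poly hg.
apply: homeoU; [exact: inj12 | exact: inj12 | |].
  apply: homeo_ext (homeo_comp (homeo_comp (homeo_ptl1 pP) hf) (homeo_inj1 pP')).
  by move=> _ [v _ <-]; rewrite /dsum_map /= eqxx.
apply: homeo_ext (homeo_comp (homeo_comp (homeo_ptl2 pW) hg) (homeo_inj2 pW')).
by move=> _ [v _ <-]; rewrite /dsum_map /= oner_eq0.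
Qed.

Lemma homeo_dsum1 (P P' : space) (f g : pt -> pt) : homeo P P' f ->
  homeo (inj1 @` P) (inj1 @` P') (dsum_map f g).
Proof.
move=> hf; have [pP pP'] := homeo_poly hf.
apply: homeo_ext (homeo_comp (homeo_comp (homeo_ptl1 pP) hf) (homeo_inj1 pP')).
by move=> _ [v _ <-]; rewrite /dsum_map /= eqxx.
Qed.

Lemma homeo_dsum2 (W W' : space) (f g : pt -> pt) : homeo W W' g ->
  homeo (inj2 @` W) (inj2 @` W') (dsum_map f g).
Proof.
move=> hg; have [pW pW'] := homeo_poly hg.
apply: homeo_ext (homeo_comp (homeo_comp (homeo_ptl2 pW) hg) (homeo_inj2 pW')).
by move=> _ [v _ <-]; rewrite /dsum_map /= oner_eq0.
Qed.

Lemma closes_bnd k (P W S : space) : closes k P W S -> bnd k P = bnd k W.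
Proof. by move=> [_ _ _ _ [-> ->]]. Qed.

Lemma closes_dsum k (P W S : space) : closes k P W S ->
  is_dsum k (inj1 @` P) (inj2 @` W) (dsum P W).
Proof. by move=> [mP mW _ _ _]; exact: dsum_is_dsum. Qed.

Lemma is_dsum_glu d (X Y1 Y2 : space) h W X' q : gluing d X Y1 Y2 h W X' q ->
  is_dsum d Y1 Y2 (Y1 `|` Y2).
Proof.
by move=> G; apply: is_dsumU; [exact: glu_Y1 G | exact: glu_Y2 G | exact: glu_disj G].
Qed.

End Gluings.

(** * Boundary data of fields *)

Section Fields.
Context {R : realType} {K : fieldType} {n : nat} {F : system_of_fields R K n}.
Local Notation pt := (@pt R).
Local Notation space := (@Defs.space R).
Let H := sof_fields F.

(** A field z on the empty manifold decomposes as z u e and as e u z, where e is the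
    neutral field; decompositions are unique, so z = e. *)
Lemma fl0_eq k (a b : fl F k set0) : (k <= n)%N -> a = b.
Proof.
move=> kn; have kn1 : (k <= n.+1)%N by exact: leqW.
have m0 := @mfd0 R k; have d0 : is_dsum k (set0 : space) set0 set0.
  by split=> //; rewrite ?setU0 ?setI0.
have [e eP] := du_unit H kn1.
have all z : z = e.
  have [[u v] [_ uq]] := du_bij H kn d0 z.
  have e1 := uq (z, e); have e2 := uq (e, z).
  have E1 : z = du F z e by rewrite eP.
  have E2 : z = du F e z by rewrite (du_comm H _ _ kn1 d0).
  by have [-> _] : (z, e) = (e, z) by rewrite -e1 // -e2.
by rewrite (all a) (all b).
Qed.

Lemma flE k X (a b : fl F k X) : (k <= n)%N -> X = set0 -> a = b.
Proof. by move=> kn e; subst X; exact: fl0_eq. Qed.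

Lemma du_unit2 k : (k <= n.+1)%N -> exists e : fl F k set0,
  forall X (x : fl F k X), mfd k X -> du F x e = x /\ du F e x = x.
Proof.
move=> kn; have [e eP] := du_unit H kn; exists e => X x mX; split; first exact: eP.
rewrite (du_comm H _ _ kn) ?eP //; split; rewrite ?set0U ?set0I //; exact: mfd0.
Qed.

Lemma du_inj k A B Z (a a' : fl F k A) (b b' : fl F k B) : (k <= n)%N ->
  is_dsum k A B Z -> du F a b = du F a' b' :> fl F k Z -> a = a' /\ b = b'.
Proof.
move=> kn dZ e; have [ab [_ uq]] := du_bij H kn dZ (du F a b).
have e1 := uq (a, b) erefl; have e2 := uq (a', b') e.
by have [-> ->] : (a, b) = (a', b') by rewrite -e1.
Qed.

(** Associativity and commutativity of the union of fields, each with its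
    geometric side conditions. *)
Lemma du_ACA k A B C D AB CD AC BD Z
    (a : fl F k A) (b : fl F k B) (c : fl F k C) (d : fl F k D) : (k <= n.+1)%N ->
  is_dsum k A B AB -> is_dsum k C D CD -> is_dsum k A C AC -> is_dsum k B D BD ->
  is_dsum k AB CD Z ->
  du F (du F a b : fl F k AB) (du F c d : fl F k CD) =
  du F (du F a c : fl F k AC) (du F b d : fl F k BD) :> fl F k Z.
Proof.
move=> kn hAB hCD hAC hBD hZ.
have [mA mB mAB eAB dAB] := hAB; have [mC mD mCD eCD dCD] := hCD.
have [_ _ mAC eAC dAC] := hAC; have [_ _ mBD eBD dBD] := hBD.
have [_ _ mZ eZ dZ] := hZ.
have dis (P Q : space) : (forall v, P v -> Q v -> (A v /\ B v) \/ (C v /\ D v) \/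
     ((A v \/ B v) /\ (C v \/ D v))) -> P `&` Q = set0.
  move=> h; apply: dis0 => v Pv Qv; have [[Av Bv]|[[Cv Dv]|[ABv CDv]]] := h v Pv Qv.
  - exact: disjoint_out dAB Av Bv.
  - exact: disjoint_out dCD Cv Dv.
  - by apply: (disjoint_out dZ (x := v)); rewrite ?eAB ?eCD.
pose BCD := B `|` CD.
have iBCD : is_dsum k B CD BCD.
  by apply: is_dsumU => //; apply: dis => v; rewrite eCD /setU /=; tauto.
have mBC : is_dsum k B C (B `|` C).
  by apply: is_dsumU => //; apply: dis => v; tauto.
have iBC_D : is_dsum k (B `|` C) D BCD.
  have [_ _ m1 _ _] := iBCD; have [_ _ m2 _ _] := mBC.
  split=> //; first by rewrite /BCD eCD setUA.
  by apply: dis => v; rewrite /setU /=; tauto.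
have iC_BD : is_dsum k C BD BCD.
  have [_ _ m1 _ _] := iBCD.
  split=> //; first by rewrite /BCD eCD eBD setUCA.
  by apply: dis => v; rewrite eBD /setU /=; tauto.
have iA_BCD : is_dsum k A BCD Z.
  have [_ _ m1 _ _] := iBCD.
  split=> //; first by rewrite eZ eAB /BCD setUA.
  by apply: dis => v; rewrite /BCD eCD /setU /=; tauto.
have iAC_BD : is_dsum k AC BD Z.
  split=> //; first by rewrite eZ eAB eCD eAC eBD setUACA.
  by apply: dis => v; rewrite eBD eAC /setU /=; tauto.
rewrite -(du_assoc H a b _ kn hAB iBCD iA_BCD hZ).
rewrite (du_assoc H b c d kn mBC hCD iBCD iBC_D).
rewrite (du_comm H b c kn mBC).
rewrite -(du_assoc H c b d kn (is_dsumC mBC) hBD iC_BD iBC_D).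
exact: (du_assoc H a c _ kn hAC iC_BD iA_BCD iAC_BD).
Qed.

(** A closed manifold is glued along the empty set only, so gluing acts as the
    homeomorphism [ptl]. *)
Lemma gl_ptl d t S D (x : fl F d.+1 S) (z : fl F d.+1 D) : (d < n)%N -> 0 <= t ->
  mfd d.+1 S -> bnd d.+1 S = set0 ->
  D = pcons t @` S -> fpush F (pcons t) x = z -> gl F ptl z = x.
Proof.
move=> dn t0 mS bS e zE; subst D; rewrite -zE.
have pS := mfd_polyhedron mS; have mD := mfd_pcons t0 mS.
have hp := homeo_pcons t0 pS; have hq := homeo_ptl t0 pS.
rewrite (gl_empty H _ (ltnW dn) (gluing_empty id mD hq)).
rewrite -(fpush_comp H x _ mS mD mS hp hq) ?ltnS ?(ltnW dn) //.
by rewrite (fpush_ext H (g := id)) ?(fpush_id H) // ?ltnS ltnW.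
Qed.

Lemma bullet_unitr k S P W (x : fl F k S) (p : fl F k P) (e : fl F k W) : (k <= n)%N ->
  mfd k S -> bnd k S = set0 -> P = S -> fpush F id x = p -> W = set0 ->
  bullet S p e = x.
Proof.
move=> kn mS bS PS pE W0; subst P W; rewrite (fpush_id H) // in pE; last exact: leqW.
subst p; case: k kn S x e mS bS => [|d] kn S x e mS bS; first exact: flE.
have [u uP] := du_unit2 (leqW kn).
apply: (gl_ptl (t := 0)) => //; first by rewrite /dsum image_set0 setU0.
move: (fpush F inj2 e : fl F d.+1 (inj2 @` set0)).
have -> : dsum S set0 = inj1 @` S by rewrite /dsum image_set0 setU0.
rewrite image_set0 => e'; rewrite (fl0_eq e' u) // (proj1 (uP _ _ _)) //.
exact: mfd_inj1.
Qed.

Lemma bullet_unitl k S P (e : fl F k P) (x : fl F k S) : (k <= n)%N ->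
  mfd k S -> bnd k S = set0 -> P = set0 -> bullet S e x = x.
Proof.
move=> kn mS bS P0; subst P.
case: k kn S x e mS bS => [|d] kn S x e mS bS; first exact: flE.
have [u uP] := du_unit2 (leqW kn).
apply: (gl_ptl (t := 1)) => //; first by rewrite /dsum image_set0 set0U.
move: (fpush F inj1 e : fl F d.+1 (inj1 @` set0)).
have -> : dsum set0 S = inj2 @` S by rewrite /dsum image_set0 set0U.
rewrite image_set0 => e'; rewrite (fl0_eq e' u) // (proj2 (uP _ _ _)) //.
exact: mfd_inj2.
Qed.

Lemma agree_closed k P W (p : fl F k P) (w : fl F k W) : (k <= n)%N ->
  bnd k W = set0 -> agree p w.
Proof. by case: k p w => //= e p w en bW; apply: flE => //; exact: ltnW. Qed.

(** [bullet] folds the two copies of the common boundary onto each other; agreeing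
    fields restrict to corresponding fields on these copies. *)
Lemma bullet_compat d P W S (p : fl F d.+1 P) (w : fl F d.+1 W) (e : fl F d set0) :
  (d < n)%N -> closes d.+1 P W S -> agree p w ->
  compat (inj2 @` (P `&` W)) (inj2 \o ptl)
    (res F (du F (fpush F inj1 p : fl F d.+1 (inj1 @` P))
                 (fpush F inj2 w : fl F d.+1 (inj2 @` W)) : fl F d.+1 (dsum P W)))
    (fpush F inj1 (res F p) : fl F d (inj1 @` (P `&` W))) e.
Proof.
move=> dn clo ag; have [mP mW mS SE [bP bW]] := clo.
have dnW : (d <= n)%N by exact: ltnW.
have dn1 : (d <= n.+1)%N by exact: leqW.
have pP := mfd_polyhedron mP; have pW := mfd_polyhedron mW.
have mb : mfd d (P `&` W) by rewrite -bP; case: mP.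
have bb : bnd d (P `&` W) = set0 by rewrite -bP; case: mP.
have pb := mfd_polyhedron mb.
split.
  by apply: agree_closed => //; exact: bnd0.
rewrite (du_res H _ _ dnW (closes_dsum clo)).
rewrite (res_fpush H p dnW mP (mfd_inj1 mP) (homeo_inj1 pP)).
rewrite (res_fpush H w dnW mW (mfd_inj2 mW) (homeo_inj2 pW)).
rewrite -[res F w]ag.
move: (res F p) => rp {ag p w}.
have E1 := bnd_inj1 d.+1 pP; have E2 := bnd_inj2 d.+1 pW.
have iD := dsum_is_dsum mb mb.
have E3 : bnd d.+1 (dsum P W) = inj1 @` (P `&` W) `|` inj2 @` (P `&` W).
  rewrite bndU; [by rewrite E1 E2 bP bW| | |exact: inj12].
    exact: mfd_polyhedron (mfd_inj1 mP).
  exact: mfd_polyhedron (mfd_inj2 mW).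
move: E1 E2 rp; rewrite bP bW => -> -> rp.
rewrite E3; apply/esym/bullet_unitr => //.
- by case: iD.
- rewrite bndU ?inj12 ?bnd_inj1 ?bnd_inj2 ?bb ?image_set0 ?setU0 //.
    exact: mfd_polyhedron (mfd_inj1 mb).
  exact: mfd_polyhedron (mfd_inj2 mb).
rewrite (fpush_id H) //; last by case: iD.
congr (du F _ _).
rewrite (fpush_id H) // -(fpush_comp H _ _ mb (mfd_inj1 mb) (mfd_inj2 mb)) //.
  exact: homeo_inj1.
exact: homeo_comp (homeo_ptl1 pb) (homeo_inj2 pb).
Qed.

Lemma agree_du k P1 P2 P W1 W2 W (p1 : fl F k P1) (p2 : fl F k P2)
    (w1 : fl F k W1) (w2 : fl F k W2) : (k <= n)%N ->
  is_dsum k P1 P2 P -> is_dsum k W1 W2 W ->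
  bnd k P1 = bnd k W1 -> bnd k P2 = bnd k W2 ->
  agree (du F p1 p2 : fl F k P) (du F w1 w2 : fl F k W) <->
  agree p1 w1 /\ agree p2 w2.
Proof.
case: k p1 p2 w1 w2 => // e p1 p2 w1 w2 en dP dW b1 b2 /=.
have en' := ltnW en.
have dbP := is_dsum_bnd dP; have dbW := is_dsum_bnd dW.
have bPW : bnd e.+1 P = bnd e.+1 W.
  by have [_ _ _ -> _] := dbP; rewrite [bnd e.+1 P1]b1 [bnd e.+1 P2]b2; have [_ _ _ <- _] := dbW.
rewrite (du_res H p1 p2 en' dP) (du_res H w1 w2 en' dW).
have [m1 m2 m3 _ _] := dbP.
have idh (A B : space) : mfd e A -> A = B -> homeo A B id.
  by move=> mA <-; apply: homeo_id; exact: mfd_polyhedron mA.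
rewrite (du_fpush H _ _ (leqW en') dbP dbW (idh _ _ m3 bPW) (idh _ _ m1 b1) (idh _ _ m2 b2)).
split; first by move=> /(du_inj en' dbW).
by move=> [-> ->].
Qed.

Lemma agree_fpush k P P' W W' (p : fl F k P) (w : fl F k W) f : (k <= n)%N ->
  mfd k P -> mfd k W -> bnd k P = bnd k W -> homeo P P' f -> homeo W W' f ->
  agree p w ->
  agree (fpush F f p : fl F k P') (fpush F f w : fl F k W').
Proof.
case: k p w => // e p w en mP mW b hP hW /= ag.
have en' := ltnW en; have mP' := mfd_homeo hP mP; have mW' := mfd_homeo hW mW.
rewrite (res_fpush H p en' mP mP' hP) (res_fpush H w en' mW mW' hW) -ag.
have bE : bnd e.+1 P' = bnd e.+1 W' by rewrite (bnd_homeo _ hP) (bnd_homeo _ hW) b.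
have [_ _ mbP _] := mP; have [_ _ mbW _] := mW.
have [_ _ mbP' _] := mP'; have [_ _ mbW' _] := mW'.
have hi (A B : space) : mfd e A -> A = B -> homeo A B id.
  by move=> mA <-; apply: homeo_id; exact: mfd_polyhedron mA.
rewrite -(fpush_comp H _ (leqW en') mbP mbP' mbW' (homeo_bnd mP hP) (hi _ _ mbP' bE)).
rewrite -(fpush_comp H _ (leqW en') mbP mbW mbW' (hi _ _ mbP b) (homeo_bnd mW hW)).
by apply: (fpush_ext H) => //; exact: leqW.
Qed.

(** Gluing commutes with disjoint unions.  At level 0 all the manifolds
    involved are empty. *)
Lemma bullet_du k P1 P2 P W1 W2 W S1 S2 S (p1 : fl F k P1) (p2 : fl F k P2)
    (w1 : fl F k W1) (w2 : fl F k W2) : (k <= n)%N ->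
  closes k P1 W1 S1 -> closes k P2 W2 S2 ->
  is_dsum k P1 P2 P -> is_dsum k W1 W2 W -> is_dsum k S1 S2 S ->
  agree p1 w1 -> agree p2 w2 ->
  bullet S (du F p1 p2 : fl F k P) (du F w1 w2 : fl F k W) =
  du F (bullet S1 p1 w1) (bullet S2 p2 w2).
Proof.
case: k p1 p2 w1 w2 => [|d] p1 p2 w1 w2 kn c1 c2 dP dW dS ag1 ag2.
  by apply: flE => //; case: dS.
have kn1 : (d.+1 <= n.+1)%N by exact: leqW.
have [mP1 mP2 mP eP P0] := dP; have [mW1 mW2 mW eW W0] := dW.
have [mS1 mS2 mS eS S0] := dS.
have [_ _ _ eS1 _] := c1; have [_ _ _ eS2 _] := c2.
have pp := @mfd_polyhedron R.
have i1P : is_dsum d.+1 (inj1 @` P1) (inj1 @` P2) (inj1 @` P).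
  split; [exact: mfd_inj1|exact: mfd_inj1|exact: mfd_inj1|by rewrite eP image_setU|].
  apply: dis0 => _ [v h1 <-] [u h2 /(congr1 ptl) e].
  by apply: (disjoint_out P0 h1); rewrite -(e : u = v).
have i2W : is_dsum d.+1 (inj2 @` W1) (inj2 @` W2) (inj2 @` W).
  split; [exact: mfd_inj2|exact: mfd_inj2|exact: mfd_inj2|by rewrite eW image_setU|].
  apply: dis0 => _ [v h1 <-] [u h2 /(congr1 ptl) e].
  by apply: (disjoint_out W0 h1); rewrite -(e : u = v).
rewrite /bullet.
rewrite (du_fpush H p1 p2 kn1 dP i1P (homeo_inj1 (pp _ _ mP))
  (homeo_inj1 (pp _ _ mP1)) (homeo_inj1 (pp _ _ mP2))).
rewrite (du_fpush H w1 w2 kn1 dW i2W (homeo_inj2 (pp _ _ mW))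
  (homeo_inj2 (pp _ _ mW1)) (homeo_inj2 (pp _ _ mW2))).
have D1 := closes_dsum c1; have D2 := closes_dsum c2.
have DPW := dsum_is_dsum mP mW.
rewrite (du_ACA _ _ _ _ kn1 i1P i2W D1 D2 DPW).
have [u _] := du_unit2 (ltnW kn1).
have DD : is_dsum d.+1 (dsum P1 W1) (dsum P2 W2) (dsum P W).
  have [_ _ m1 _ _] := D1; have [_ _ m2 _ _] := D2; have [_ _ m3 _ _] := DPW.
  split=> //; first by rewrite /dsum eP eW !image_setU setUACA.
  have o1 (x y : pt) : inj1 x = inj2 y -> False.
    by move=> /(congr1 (fun x => x 0%N)) /= /esym /eqP; rewrite oner_eq0.
  apply: dis0 => _ [[v a <-]|[v a <-]] [[z b /esym e]|[z b /esym e]].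
  - by apply: (disjoint_out P0 a); rewrite (congr1 ptl e : v = z).
  - exact: o1 e.
  - exact: o1 (esym e).
  - by apply: (disjoint_out W0 a); rewrite (congr1 ptl e : v = z).
exact: (gl_du H (ltnW kn) (gluing_closes c1) (gluing_closes c2) DD dS
  (bullet_compat u kn c1 ag1) (bullet_compat u kn c2 ag2)).
Qed.

Lemma fpush_inj1 k P P' (f g : pt -> pt) (p : fl F k P) :
  (k <= n.+1)%N -> mfd k P -> homeo P P' f ->
  fpush F (dsum_map f g) (fpush F inj1 p : fl F k (inj1 @` P)) =
  fpush F inj1 (fpush F f p : fl F k P') :> fl F k (inj1 @` P').
Proof.
move=> kn mP hf; have [pP pP'] := homeo_poly hf.
have mP' := mfd_homeo hf mP; have mi := mfd_inj1 mP; have mi' := mfd_inj1 mP'.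
rewrite -(fpush_comp H p kn mP mi mi' (homeo_inj1 pP) (homeo_dsum1 g hf)).
rewrite -(fpush_comp H p kn mP mP' mi' hf (homeo_inj1 pP')).
by apply: (fpush_ext H) => // v _; rewrite /dsum_map /= eqxx.
Qed.

Lemma fpush_inj2 k P P' (f g : pt -> pt) (p : fl F k P) :
  (k <= n.+1)%N -> mfd k P -> homeo P P' g ->
  fpush F (dsum_map f g) (fpush F inj2 p : fl F k (inj2 @` P)) =
  fpush F inj2 (fpush F g p : fl F k P') :> fl F k (inj2 @` P').
Proof.
move=> kn mP hf; have [pP pP'] := homeo_poly hf.
have mP' := mfd_homeo hf mP; have mi := mfd_inj2 mP; have mi' := mfd_inj2 mP'.
rewrite -(fpush_comp H p kn mP mi mi' (homeo_inj2 pP) (homeo_dsum2 f hf)).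
rewrite -(fpush_comp H p kn mP mP' mi' hf (homeo_inj2 pP')).
by apply: (fpush_ext H) => // v _; rewrite /dsum_map /= oner_eq0.
Qed.

Lemma fpush_dsum k P P' W W' (f g : pt -> pt) (p : fl F k P) (w : fl F k W) :
  (k <= n.+1)%N ->
  mfd k P -> mfd k W -> homeo P P' f -> homeo W W' g ->
  fpush F (dsum_map f g)
    (du F (fpush F inj1 p : fl F k (inj1 @` P)) (fpush F inj2 w : fl F k (inj2 @` W))
      : fl F k (dsum P W)) =
  du F (fpush F inj1 (fpush F f p : fl F k P') : fl F k (inj1 @` P'))
       (fpush F inj2 (fpush F g w : fl F k W') : fl F k (inj2 @` W')) :> fl F k (dsum P' W').
Proof.
move=> kn mP mW hf hg.
have D := dsum_is_dsum mP mW.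
have D' := dsum_is_dsum (mfd_homeo hf mP) (mfd_homeo hg mW).
rewrite (du_fpush H _ _ kn D D' (homeo_dsum hf hg) (homeo_dsum1 g hf) (homeo_dsum2 f hg)).
by rewrite (fpush_inj1 g p kn mP hf) (fpush_inj2 f w kn mW hg).
Qed.

(** Gluing is natural: f on S is covered by two copies of f on the disjoint pieces. *)
Lemma bullet_fpush k P W S S' P' W' (p : fl F k P) (w : fl F k W) f : (k <= n)%N ->
  closes k P W S -> homeo S S' f -> P' = f @` P -> W' = f @` W -> agree p w ->
  fpush F f (bullet S p w) =
  bullet S' (fpush F f p : fl F k P') (fpush F f w : fl F k W').
Proof.
case: k p w => [|d] p w kn clo hf -> -> ag.
  by apply: flE => //; have [_ _ mS _ _] := clo; have [_ <- _] := hf; rewrite mS image_set0.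
have kn1 : (d.+1 <= n.+1)%N by exact: leqW.
have [mP mW mS SE _] := clo.
have pP := mfd_polyhedron mP; have pW := mfd_polyhedron mW.
have hP : homeo P (f @` P) f by apply: (homeo_sub hf pP); rewrite SE; left.
have hW : homeo W (f @` W) f by apply: (homeo_sub hf pW); rewrite SE; right.
have [u _] := du_unit2 (ltnW kn1).
have co := bullet_compat u kn clo ag.
rewrite /bullet -(fpush_dsum p w kn1 mP mW hP hW).
apply: (gl_fpush H (ltnW kn) (gluing_closes clo) (gluing_closes (closes_homeo clo hf))
  (homeo_dsum hP hW) hf _ co).
by move=> _ [[v _ <-]|[v _ <-]]; rewrite /dsum_map /= ?eqxx ?oner_eq0.
Qed.

End Fields.

(** * Gluing steps with fields *)

Section Steps.
Context {R : realType} {K : fieldType} {n : nat} {F : system_of_fields R K n}.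
Local Notation pt := (@pt R).
Local Notation space := (@Defs.space R).
Let H := sof_fields F.

(** The condition imposed on two consecutive stages of a splitting. *)
Definition glue_step M (x : fl F n.+1 M) M' (x' : fl F n.+1 M') (q : pt -> pt) : Prop :=
  exists Y1 Y2 h W (y : fl F n Y1) (c : fl F n W),
  [/\ gluing n M Y1 Y2 h W M' q, compat Y2 h (res F x) y c & x' = gl F q x].

Lemma glue_step_fun M x M' x' q : @glue_step M x M' x' q -> q @` M = M'.
Proof. by move=> [Y1 [Y2 [h [W [y [c [G _ _]]]]]]]; exact: glu_surj G. Qed.

(** A field on a disjoint union together with its copy on the second glued
    boundary piece is the disjoint union of the two such pairs. *)
Lemma fpush_twin Y1 T1 Y2 T2 Y T P1 P2 P h k u (y : fl F n Y1) (t : fl F n T1) :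
  is_dsum n Y1 T1 Y -> is_dsum n Y2 T2 T -> is_dsum n Y1 Y2 P1 ->
  is_dsum n T1 T2 P2 -> is_dsum n Y T P -> homeo Y1 Y2 h -> homeo T1 T2 k ->
  (forall v, Y1 v -> u v = h v) -> (forall v, T1 v -> u v = k v) ->
  du F (du F y t : fl F n Y) (fpush F u (du F y t : fl F n Y) : fl F n T) =
  du F (du F y (fpush F h y : fl F n Y2) : fl F n P1)
       (du F t (fpush F k t : fl F n T2) : fl F n P2) :> fl F n P.
Proof.
move=> dY dT dP1 dP2 dP hh hk uh uk.
have [mY1 mT1 _ eY Y0] := dY; have [mY2 mT2 _ eT T0] := dT.
have n1 : (n <= n.+1)%N by [].
have hu1 : homeo Y1 Y2 u by apply: homeo_ext hh => v /uh.
have hu2 : homeo T1 T2 u by apply: homeo_ext hk => v /uk.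
have hu : homeo Y T u by rewrite eY eT; exact: homeoU.
rewrite (du_fpush H y t n1 dY dT hu hu1 hu2) (fpush_ext H y n1 mY1 mY2 uh).
rewrite (fpush_ext H t n1 mT1 mT2 uk).
exact: du_ACA.
Qed.

Lemma glue_step_union A B M A' B' M' (a : fl F n.+1 A) (b : fl F n.+1 B)
    (a' : fl F n.+1 A') (b' : fl F n.+1 B') q :
  is_dsum n.+1 A B M -> is_dsum n.+1 A' B' M' ->
  glue_step a a' q -> glue_step b b' q ->
  glue_step (du F a b : fl F n.+1 M) (du F a' b' : fl F n.+1 M') q.
Proof.
move=> dM dM' [Y1 [Y2 [h [W [y [c [G [ag bE] ->]]]]]]].
move=> [T1 [T2 [k [V [t [v [L [ag' bE'] ->]]]]]]].
have [_ _ _ e d0] := dM; have [_ _ _ e' d0'] := dM'; subst M M'.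
have GL := gluing_union G L d0 d0'.
exists (Y1 `|` T1), (Y2 `|` T2), (union_map A h k), (W `|` V), (du F y t), (du F c v).
split=> //; last by rewrite (gl_du H (leqnn n) G L dM dM' (conj ag bE) (conj ag' bE')).
have sub0 (C D : space) : C `<=` A -> D `<=` B -> C `&` D = set0.
  by move=> CA DB; apply: dis0 => w /CA Aw /DB Bw; exact: disjoint_out d0 Aw Bw.
have dW : is_dsum n W V (W `|` V).
  apply: is_dsumU; [exact: glu_W G | exact: glu_W L | apply: sub0].
    exact: (glu_subW G).
  exact: (glu_subW L).
have dY1 : is_dsum n Y1 T1 (Y1 `|` T1).
  apply: is_dsumU; [exact: glu_Y1 G | exact: glu_Y1 L | apply: sub0].
    exact: (glu_subY1 G).
  exact: (glu_subY1 L).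
have dY2 : is_dsum n Y2 T2 (Y2 `|` T2).
  apply: is_dsumU; [exact: glu_Y2 G | exact: glu_Y2 L | apply: sub0].
    exact: (glu_subY2 G).
  exact: (glu_subY2 L).
have dP : is_dsum n (Y1 `|` Y2) (T1 `|` T2) ((Y1 `|` T1) `|` (Y2 `|` T2)).
  rewrite setUACA; apply: is_dsumU; [exact: glu_mfdY G | exact: glu_mfdY L | apply: sub0].
    by move=> w [/(glu_subY1 G)|/(glu_subY2 G)].
  by move=> w [/(glu_subY1 L)|/(glu_subY2 L)].
have clG := gluing_closes_bnd G; have clL := gluing_closes_bnd L.
rewrite /compat (fpush_twin y t dY1 dY2 (is_dsum_glu G) (is_dsum_glu L)
   (is_dsum_glu GL) (glu_h G) (glu_h L)).
- split; first by apply/(agree_du _ _ _ _ (leqnn n) dP dW (closes_bnd clG) (closes_bnd clL)).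
  rewrite (du_res H a b (leqnn n) dM) bE bE'; symmetry.
  exact: bullet_du clG clL dP dW (is_dsum_bnd dM) ag ag'.
- by move=> w /(glu_subY1 G) Aw; rewrite union_mapl.
- by move=> w /(glu_subY1 L) Bw; rewrite (union_mapr _ _ d0).
Qed.

(** Below the top dimension fields on a disjoint union decompose uniquely.  Hence
    the boundary data decompose, and so does the condition that they can be glued. *)
Lemma glue_step_part A B M A' B' M' (a : fl F n.+1 A) (b : fl F n.+1 B)
    (x' : fl F n.+1 M') q :
  is_dsum n.+1 A B M -> is_dsum n.+1 A' B' M' ->
  (forall v, A v -> A' (q v)) -> (forall v, B v -> B' (q v)) ->
  glue_step (du F a b : fl F n.+1 M) x' q ->
  [/\ glue_step a (gl F q a : fl F n.+1 A') q, glue_step b (gl F q b : fl F n.+1 B') q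
    & x' = du F (gl F q a : fl F n.+1 A') (gl F q b : fl F n.+1 B')].
Proof.
move=> dM dM' qA qB [Y1 [Y2 [h [W [y [c [G [ag bE] ->]]]]]]].
have [mA mB mM e d0] := dM; have [mA' mB' _ e' d0'] := dM'; subst M M'.
have pA := mfd_polyhedron mA; have pB := mfd_polyhedron mB.
have pA' := mfd_polyhedron mA'; have pB' := mfd_polyhedron mB'.
have GA := gluing_part G pA pB d0 pA' pB' d0' qA qB.
have GB : gluing n B (Y1 `&` B) (Y2 `&` B) h (W `&` B) B' q.
  apply: (@gluing_part _ _ B A _ _ _ _ _ A') => //; rewrite 1?setIC //.
  by rewrite [B `|` A]setUC [B' `|` A']setUC.
have cap := is_dsum_cap pA pB d0.
have dY1 := cap _ _ (glu_subY1 G) (glu_Y1 G).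
have dY2 := cap _ _ (glu_subY2 G) (glu_Y2 G).
have dW := cap _ _ (glu_subW G) (glu_W G).
have YAB : Y1 `|` Y2 `<=` A `|` B by move=> v [/(glu_subY1 G)|/(glu_subY2 G)].
have := cap _ _ YAB (glu_mfdY G); rewrite !setIUl => dP.
have [[y1 y2] [/= yE _]] := du_bij H (leqnn n) dY1 y.
have [[c1 c2] [/= cE _]] := du_bij H (leqnn n) dW c.
subst y c.
have clA := gluing_closes_bnd GA; have clB := gluing_closes_bnd GB.
have tw := fpush_twin y1 y2 dY1 dY2 (is_dsum_glu GA) (is_dsum_glu GB)
   (is_dsum_glu G) (glu_h GA) (glu_h GB) (fun _ _ => erefl) (fun _ _ => erefl).
rewrite tw in ag bE.
have [ag1 ag2] := (agree_du _ _ _ _ (leqnn n) dP dW (closes_bnd clA) (closes_bnd clB)).1 ag.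
rewrite (du_res H a b (leqnn n) dM) in bE.
rewrite (bullet_du (leqnn n) clA clB dP dW (is_dsum_bnd dM) ag1 ag2) in bE.
have [bA bB] := du_inj (leqnn n) (is_dsum_bnd dM) bE.
split.
- by exists (Y1 `&` A), (Y2 `&` A), h, (W `&` A), y1, c1.
- by exists (Y1 `&` B), (Y2 `&` B), h, (W `&` B), y2, c2.
- by rewrite (gl_du H (leqnn n) GA GB dM dM' (conj ag1 bA) (conj ag2 bB)).
Qed.

Lemma glue_step_homeo M N M' N' (x : fl F n.+1 M) (x' : fl F n.+1 M') q f f' r :
  homeo M N f -> homeo M' N' f' -> (forall v, M v -> f' (q v) = r (f v)) ->
  glue_step x x' q ->
  glue_step (fpush F f x : fl F n.+1 N) (fpush F f' x' : fl F n.+1 N') r.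
Proof.
move=> hf hf' qr [Y1 [Y2 [h [W [y [c [G [ag bE] ->]]]]]]].
have [g [_ gK _]] := homeo_inv hf.
have GN := gluing_homeo G hf hf' gK qr.
have n1 : (n <= n.+1)%N by [].
exists (f @` Y1), (f @` Y2), (f \o h \o g), (f @` W), (fpush F f y), (fpush F f c).
split=> //; last exact: (gl_fpush H (leqnn n) G GN hf hf' qr (conj ag bE)).
have clM := gluing_closes_bnd G.
have mM := glu_src G; have mN := glu_src GN.
have sub (A : space) : mfd n A -> A `<=` M -> homeo A (f @` A) f.
  by move=> mA AM; exact: homeo_sub hf (mfd_polyhedron mA) AM.
have h1 := sub _ (glu_Y1 G) (glu_subY1 G).
have h2 := sub _ (glu_Y2 G) (glu_subY2 G).
have hW := sub _ (glu_W G) (glu_subW G).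
have hY : homeo (Y1 `|` Y2) (f @` Y1 `|` f @` Y2) f.
  rewrite -image_setU; apply: sub (glu_mfdY G) _.
  by move=> v [/(glu_subY1 G)|/(glu_subY2 G)].
have -> : compat (f @` Y2) (f \o h \o g) (res F (fpush F f x : fl F n.+1 N))
    (fpush F f y : fl F n (f @` Y1)) (fpush F f c : fl F n (f @` W)) =
  (agree (fpush F f (du F y (fpush F h y : fl F n Y2) : fl F n (Y1 `|` Y2)) :
     fl F n (f @` Y1 `|` f @` Y2)) (fpush F f c : fl F n (f @` W)) /\
   res F (fpush F f x : fl F n.+1 N) = bullet (bnd n.+1 N)
     (fpush F f (du F y (fpush F h y : fl F n Y2) : fl F n (Y1 `|` Y2)) :
     fl F n (f @` Y1 `|` f @` Y2)) (fpush F f c : fl F n (f @` W))).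
  rewrite /compat.
  have -> // : du F (fpush F f y : fl F n (f @` Y1))
      (fpush F (f \o h \o g) (fpush F f y : fl F n (f @` Y1)) : fl F n (f @` Y2)) =
      fpush F f (du F y (fpush F h y : fl F n Y2) : fl F n (Y1 `|` Y2)) :>
      fl F n (f @` Y1 `|` f @` Y2).
  rewrite (du_fpush H _ _ n1 (is_dsum_glu G) (is_dsum_glu GN) hY h1 h2).
  rewrite -(fpush_comp H _ n1 (glu_Y1 G) (glu_Y1 GN) (glu_Y2 GN) h1 (glu_h GN)).
  rewrite -(fpush_comp H _ n1 (glu_Y1 G) (glu_Y2 G) (glu_Y2 GN) (glu_h G) h2).
  congr (du F _ _); apply: (fpush_ext H) => //; [exact: glu_Y1 G | exact: glu_Y2 GN |].
  by move=> v Yv /=; rewrite gK //; exact: (glu_subY1 G).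
split.
  exact: agree_fpush (leqnn n) (glu_mfdY G) (glu_W G) (closes_bnd clM) hY hW ag.
rewrite (res_fpush H x (leqnn n) mM mN hf) bE.
by apply: (bullet_fpush (leqnn n) clM (homeo_bnd mM hf)) => //; rewrite image_setU.
Qed.

(** Gluing along the empty set. *)
Lemma glue_step_id M M' (x : fl F n.+1 M) q : mfd n.+1 M -> homeo M M' q ->
  glue_step x (fpush F q x : fl F n.+1 M') q.
Proof.
move=> mM hq; have G := gluing_empty id mM hq.
have [e _] := du_unit2 (F := F) (leqnSn n).
exists set0, set0, id, (bnd n.+1 M), e, (res F x); split=> //.
  have [_ _ mb bb] := mM.
  split; first by apply: agree_closed.
  by apply/esym/bullet_unitl; rewrite ?setU0.
by rewrite (gl_empty H _ (leqnn n) G).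
Qed.

(** ** Zero fields *)

(** Fields in different spaces F(X;c) cannot be added, so zero fields are described
    by a property. *)
Definition fzero X (x : fl F n.+1 X) : Prop := exists c, x = inc F (0 : topf F c).

Lemma inc_ex X (x : fl F n.+1 X) c : mfd n.+1 X -> res F x = c ->
  exists u : topf F c, inc F u = x.
Proof. by move=> mX <-; exact: (inc_surj H). Qed.

Lemma fzero_inc X c (u : topf F c) : mfd n.+1 X -> fzero (inc F u : fl F n.+1 X) -> u = 0.
Proof.
move=> mX [c' e]; have := congr1 (res F) e.
rewrite !(res_inc H) // => e'; subst c'.
exact: (Defs.inc_inj H mX e).
Qed.

Lemma fzero_fpush X X' (x : fl F n.+1 X) f : mfd n.+1 X -> homeo X X' f ->
  fzero x -> fzero (fpush F f x : fl F n.+1 X').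
Proof.
move=> mX hf [c ->]; have [L LE] := fpush_linear H c mX (mfd_homeo hf mX) hf.
by exists (fpush F f c); rewrite LE linear0.
Qed.

Lemma fzero_step M (x : fl F n.+1 M) M' (x' : fl F n.+1 M') q :
  glue_step x x' q -> fzero x -> fzero x'.
Proof.
move=> [Y1 [Y2 [h [W [y [c [G co ->]]]]]]] [b xE]; subst x.
rewrite (res_inc H) in co; last exact: glu_src G.
have [L LE] := gl_linear H G co; exists (gl F q c); by rewrite LE linear0.
Qed.

(** The boundary field is a variable, so that two expressions for the same field can
    be used for one space. *)
Lemma du_tens_at A B Z (a : fl F n (bnd n.+1 A)) (b : fl F n (bnd n.+1 B)) c :
  is_dsum n.+1 A B Z -> c = du F a b ->
  exists L : {linear tens (topf F a) (topf F b) -> topf F (c : fl F n (bnd n.+1 Z))},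
    bijective L /\ forall u v, inc F (L (pure_tens u v)) = du F (inc F u) (inc F v).
Proof. by move=> dZ ->; exact: (du_tens H). Qed.

(** The tensor product of zero and anything is zero. *)
Lemma fzero_du A B Z (a : fl F n.+1 A) (b : fl F n.+1 B) : is_dsum n.+1 A B Z ->
  fzero a -> fzero (du F a b : fl F n.+1 Z).
Proof.
move=> dZ [c ->]; have [mA mB _ _ _] := dZ.
have [u <-] := inc_ex mB (erefl (res F b)).
have [L [_ LE]] := du_tens H c (res F b) dZ.
exists (du F c (res F b)); rewrite -LE -[X in pure_tens X](scale0r 0) pureZ_l.
by rewrite scale0r linear0.
Qed.

(** In terms of tensors, a (x) b = y (x) z where z is a sum of products v (x) w of
    fields on D and on B.  Evaluating the last factor by a linear form with value 1
    on b gives a = y (x) z', where z' is the sum of the v with coefficients given by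
    the values of the form on the w. *)
Lemma du_cancel A B C D E M (a : fl F n.+1 A) (b : fl F n.+1 B)
    (y : fl F n.+1 C) (z : fl F n.+1 E) :
  is_dsum n.+1 A B M -> is_dsum n.+1 C E M -> is_dsum n.+1 C D A ->
  is_dsum n.+1 D B E -> ~ fzero b ->
  du F a b = du F y z :> fl F n.+1 M ->
  exists z' : fl F n.+1 D, a = du F y z'.
Proof.
move=> dAB dCE dCD dDB nb e.
have [mA mB mM _ _] := dAB; have [mC mE _ _ _] := dCE; have [_ mD _ _ _] := dCD.
have n1 : (n <= n.+1)%N by [].
have [[z1 z2] [/= zE _]] := du_bij H (leqnn n) (is_dsum_bnd dDB) (res F z).
have := congr1 (res F) e; rewrite (du_res H _ _ (leqnn n) dAB) (du_res H _ _ (leqnn n) dCE).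
rewrite zE (du_assoc H _ _ _ n1 (is_dsum_bnd dCD) (is_dsum_bnd dDB)
  (is_dsum_bnd dCE) (is_dsum_bnd dAB)).
move=> /(du_inj (leqnn n) (is_dsum_bnd dAB))[aE bE].
set a0 := du F (res F y) z1 in aE.
have [ua uaE] := inc_ex mA aE; have [ub ubE] := inc_ex mB bE.
have [uy uyE] := inc_ex mC (erefl (res F y)).
have [uz uzE] := inc_ex mE zE.
have [lam lamE] : exists f : {linear topf F z2 -> K^o}, f ub = 1.
  by apply: linear_form1 => ub0; apply: nb; exists z2; rewrite -ubE ub0.
have [L1 [[L1' _ L1K] L1E]] := du_tens H z1 z2 dDB.
have [L2 [_ L2E]] := du_tens H (res F y) z1 dCD.
have [L3 [[L3' L3K _] L3E]] := du_tens H a0 z2 dAB.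
have [L4 [_ L4E]] := du_tens_at (c := du F a0 z2) dCE
  (esym (du_assoc H (res F y) z1 z2 n1 (is_dsum_bnd dCD) (is_dsum_bnd dDB)
    (is_dsum_bnd dCE) (is_dsum_bnd dAB))).
have [Psi PsiE] : exists L : {linear tens (topf F a0) (topf F z2) -> topf F a0},
    forall v w, L (pure_tens v w) = (lam w : K) *: v.
  apply: tens_lift => [c v v' w|c v w w'].
    by rewrite scalerDr !scalerA mulrC.
  by rewrite linearP scalerDl -scalerA.
(* t is a field on D u B.  Then t' is y u t, seen as a field on A u B, and [Psi]
   evaluates its second factor by [lam]. *)
have main t : exists t' s, L3 t' = L4 (pure_tens uy (L1 t)) /\ Psi t' = L2 (pure_tens uy s).
  move: t; apply: tens_ind =>
    [v w|t1 t2 [t1' [s1 [e1 e1']]] [t2' [s2 [e2 e2']]]|c t [t' [s [h1 h2]]]].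
  - exists (pure_tens (L2 (pure_tens uy v)) w), ((lam w : K) *: v); split.
      apply: (Defs.inc_inj H mM); rewrite L3E L4E L2E L1E.
      exact/esym/(du_assoc H _ _ _ (leqnn n.+1) dCD dDB dCE dAB).
    by rewrite PsiE pureZ_r linearZ.
  - exists (t1' + t2'), (s1 + s2); rewrite !linearD e1 e2 e1' e2'.
    have addp (V W : lmodType K) (v : V) (w w' : W) :
        pure_tens v (w + w') = pure_tens v w + pure_tens v w'.
      by rewrite -[w]scale1r pure_lin_r !scale1r.
    by rewrite !addp !linearD.
  - by exists (c *: t'), (c *: s); rewrite !linearZ h1 h2 !pureZ_r !linearZ.
have [t' [s [e1 e2]]] := main (L1' uz).
have t'E : t' = pure_tens ua ub.
  apply: (can_inj L3K); rewrite e1 L1K; apply: (Defs.inc_inj H mM).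
  by rewrite L4E L3E uyE uzE uaE ubE.
exists (inc F s); rewrite -uaE; move: e2.
by rewrite t'E PsiE lamE scale1r => ->; rewrite L2E uyE.
Qed.

End Steps.

(** * Restricting a gluing decomposition to a summand *)

Section Splittings.
Context {R : realType} {K : fieldType} {n : nat} {F : system_of_fields R K n}.
Local Notation pt := (@pt R).
Local Notation space := (@Defs.space R).
Let H := sof_fields F.

Lemma cw_fpush Z (x : fl F n.+1 Z) Z' f : homeo Z Z' f -> componentwise x ->
  componentwise (fpush F f x : fl F n.+1 Z').
Proof.
move=> hf cx; elim: cx Z' hf => {Z x} [Z x cZ|A B Z a b dZ _ IHa _ IHb] Z' hf.
  by apply: cw_connected; exact: connected_homeo hf cZ.
have [mA mB mZ ZE d0] := dZ.
have AZ : A `<=` Z by rewrite ZE; left.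
have BZ : B `<=` Z by rewrite ZE; right.
have hA := homeo_sub hf (mfd_polyhedron mA) AZ.
have hB := homeo_sub hf (mfd_polyhedron mB) BZ.
have dZ' : is_dsum n.+1 (f @` A) (f @` B) Z'.
  split; [exact: mfd_homeo hA mA | exact: mfd_homeo hB mB | exact: mfd_homeo hf mZ | |].
    by have [_ <- _] := hf; rewrite ZE image_setU.
  apply: dis0 => _ [v Av <-] [w Bw e].
  have vw := homeo_inj hf (BZ _ Bw) (AZ _ Av) e; subst w.
  exact: disjoint_out d0 Av Bw.
rewrite (du_fpush H a b (leqnn n.+1) dZ dZ' hf hA hB).
by apply: cw_du => //; [exact: IHa | exact: IHb].
Qed.

(** Each connected piece lies in A or in B. *)
Lemma cw_split Z (z : fl F n.+1 Z) A B : componentwise z -> is_dsum n.+1 A B Z ->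
  exists (a : fl F n.+1 A) (b : fl F n.+1 B),
    [/\ z = du F a b, componentwise a & componentwise b].
Proof.
move=> cz; elim: cz A B => {Z z} [Z z cZ|C D Z c d dZ _ IHc _ IHd] A B dAB.
  have [mA mB mZ ZE d0] := dAB.
  have pA := mfd_polyhedron mA; have pB := mfd_polyhedron mB.
  have [e eP] := du_unit2 (F := F) (leqnn n.+1).
  have ce : componentwise e by apply: cw_connected; exact: connected0.
  have sub : Z `<=` A `|` B by rewrite ZE.
  have [ZA|ZB] := connected_in pA pB d0 (mfd_polyhedron mZ) cZ sub.
    have AE : A = Z by apply/seteqP; split=> // v Av; rewrite ZE; left.
    have BE : B = set0.
      rewrite -subset0 => v Bv; apply: (disjoint_out d0 (x := v)) => //.
      by apply: ZA; rewrite ZE; right.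
    move: {dAB ZE d0 mA mB pA pB sub ZA} AE BE => -> ->; exists z, e; split=> //.
      by rewrite (eP _ _ mZ).1.
    exact: cw_connected.
  have BE : B = Z by apply/seteqP; split=> // v Av; rewrite ZE; right.
  have AE : A = set0.
    rewrite -subset0 => v Av; apply: (disjoint_out d0 (x := v)) => //.
    by apply: ZB; rewrite ZE; left.
  move: {dAB ZE d0 mA mB pA pB sub ZB} AE BE => -> ->; exists e, z; split=> //.
    by rewrite (eP _ _ mZ).2.
  exact: cw_connected.
have [mA mB mZ ZE d0] := dAB; have [mC mD _ ZE' d0'] := dZ.
have pA := mfd_polyhedron mA; have pB := mfd_polyhedron mB.
have pC := mfd_polyhedron mC; have pD := mfd_polyhedron mD.
have CAB : C `<=` A `|` B by rewrite -ZE ZE'; left.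
have DAB : D `<=` A `|` B by rewrite -ZE ZE'; right.
have ACD : A `<=` C `|` D by rewrite -ZE' ZE; left.
have BCD : B `<=` C `|` D by rewrite -ZE' ZE; right.
have dC := is_dsum_cap pA pB d0 CAB mC; have dD := is_dsum_cap pA pB d0 DAB mD.
have dA := is_dsum_cap pC pD d0' ACD mA; have dB := is_dsum_cap pC pD d0' BCD mB.
rewrite (setIC A) (setIC A) in dA; rewrite (setIC B) (setIC B) in dB.
have [c1 [c2 [-> cc1 cc2]]] := IHc _ _ dC.
have [d1 [d2 [-> cd1 cd2]]] := IHd _ _ dD.
exists (du F c1 d1), (du F c2 d2); split; [exact: du_ACA | exact: cw_du | exact: cw_du].
Qed.

(** ** The part of a splitting over a summand *)

Section Part.
Context {X : space} {x : fl F n.+1 X} (s : splitting x).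

Lemma splitting_step l : (l < len s)%N -> glue_step (sfl s l) (sfl s l.+1) (quo s l).
Proof. exact: stage_glue. Qed.

Lemma quo_iter_front (q : nat -> pt -> pt) i k v :
  quo_iter q i k.+1 v = quo_iter q i.+1 k (q i v).
Proof.
elim: k => [|k IH]; first by rewrite /= addn0.
change (q (i + k.+1)%N (quo_iter q i k.+1 v) = q (i.+1 + k)%N (quo_iter q i.+1 k (q i v))).
by rewrite IH addSnnS.
Qed.

Lemma to_end_step l v : (l < len s)%N -> to_end s l v = to_end s l.+1 (quo s l v).
Proof.
move=> lt; rewrite /to_end /= -quo_iter_front.
by have -> : (len s - l = (len s - l.+1).+1)%N by lia.
Qed.

Lemma to_end_last v : to_end s (len s) v = last_homeo s v.
Proof. by rewrite /to_end /= subnn. Qed.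

Lemma to_end_pl l : (l <= len s)%N ->
  pl (stage s l) (to_end s l) /\ to_end s l @` stage s l = X.
Proof.
have [m] := ubnP (len s - l); elim: m l => // m IH l lm le.
have [e|lt] := eqVneq l (len s).
  subst l; have [pl' s' _] := last_homeoP s.
  split; first by apply: pl_ext pl' => v _; rewrite to_end_last.
  by rewrite -[in RHS]s'; apply: eq_imagel => v _; rewrite to_end_last.
have {lt}le' : (l < len s)%N by rewrite ltn_neqAle lt.
have [|p' s'] := IH l.+1 _ le'; first by lia.
have st := splitting_step le'; have fs := glue_step_fun st.
split.
  apply: (pl_ext (f := to_end s l.+1 \o quo s l)).
    by move=> v _; rewrite to_end_step.
  by have [Y1 [Y2 [h [W [y [c [G _ _]]]]]]] := st; exact: pl_comp (glu_pl G) fs p'.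
rewrite -[in RHS]s' -fs image_comp; apply: eq_imagel => v _; exact: to_end_step.
Qed.

Lemma to_end_in l v : (l <= len s)%N -> stage s l v -> X (to_end s l v).
Proof.
move=> le Sv; suff : (to_end s l @` stage s l) (to_end s l v).
  by rewrite (to_end_pl le).2.
by exists v.
Qed.

(** The points of M_l whose image in X lies in A. *)
Definition part (A : space) (l : nat) : space := stage s l `&` to_end s l @^-1` A.

(** The map M_l -> X is piecewise linear, so preimages of polyhedra are polyhedra. *)
Lemma part_dsum X1 X2 l : is_dsum n.+1 X1 X2 X -> (l <= len s)%N ->
  is_dsum n.+1 (part X1 l) (part X2 l) (stage s l).
Proof.
move=> [mX1 mX2 mX XE d0] le; have [pe _] := to_end_pl le.
have mS := stage_mfd le.
have pP A : mfd n.+1 A -> polyhedron (part A l).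
  move=> mA; apply: (polyhedron_pre pe (mfd_polyhedron mX)); last exact: mfd_polyhedron mA.
  by move=> v; exact: to_end_in.
have SE : stage s l = part X1 l `|` part X2 l.
  rewrite /part -setIUr -preimage_setU -XE; apply/esym/setIidl => v Sv.
  exact: to_end_in.
have P0 : part X1 l `&` part X2 l = set0.
  by apply: dis0 => v [_ h1] [_ h2]; exact: disjoint_out d0 h1 h2.
split=> //.
  by apply: (mfd_part (pP _ mX1) (pP _ mX2) P0); rewrite -SE.
apply: (mfd_part (pP _ mX2) (pP _ mX1)); first by rewrite setIC.
by rewrite setUC -SE.
Qed.

Lemma part_quo A l v : (l < len s)%N -> part A l v -> part A l.+1 (quo s l v).
Proof.
move=> lt [Sv Av]; split; last by rewrite /= -to_end_step.
by rewrite -(glue_step_fun (splitting_step lt)); exists v.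
Qed.

Lemma part_last A : A `<=` X -> polyhedron (part A (len s)) ->
  homeo (part A (len s)) A (last_homeo s).
Proof.
move=> AX pP; have hl := last_homeoP s.
have -> : homeo (part A (len s)) A (last_homeo s) =
    homeo (part A (len s)) (last_homeo s @` part A (len s)) (last_homeo s).
  congr homeo; apply/seteqP; split=> [v Av|_ [u [_ Au] <-]].
    have [u Su e] := homeo_onto hl (AX _ Av).
    by exists u => //; split=> //=; rewrite to_end_last e.
  by rewrite -to_end_last.
by apply: (homeo_sub hl) => // v [].
Qed.

Fixpoint part_fl (A : space) (a : fl F n.+1 (part A 0)) l : fl F n.+1 (part A l) :=
  if l is l'.+1 return fl F n.+1 (part A l) then gl F (quo s l') (part_fl a l') else a.

(** The fields on the parts of M_0 come from [cw_split]; those on later stages are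
    obtained by gluing. *)
Lemma splitting_part X1 X2 : is_dsum n.+1 X1 X2 X ->
  exists (x1 : fl F n.+1 X1) (x2 : fl F n.+1 X2) (s1 : splitting x1) (s2 : splitting x2),
  [/\ x = du F x1 x2,
      [/\ len s1 = len s, stage s1 = part X1, quo s1 = quo s & last_homeo s1 = last_homeo s],
      [/\ len s2 = len s, stage s2 = part X2, quo s2 = quo s & last_homeo s2 = last_homeo s]
    & forall l, (l <= len s)%N -> sfl s l = du F (sfl s1 l) (sfl s2 l)].
Proof.
move=> dX; have [mX1 mX2 mX XE d0] := dX.
have [a [b [abE ca cb]]] := cw_split (split_start s) (part_dsum dX (leq0n _)).
have flP l : (l <= len s)%N -> sfl s l = du F (part_fl a l) (part_fl b l).
  elim: l => [//|l IH] lt; have st := splitting_step lt.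
  rewrite (IH (ltnW lt)) in st.
  have [_ _ e] := glue_step_part (part_dsum dX (ltnW lt)) (part_dsum dX lt)
    (fun v => part_quo (A := X1) lt) (fun v => part_quo (A := X2) lt) st.
  exact: e.
have stP l : (l < len s)%N -> glue_step (part_fl a l) (part_fl a l.+1) (quo s l) /\
    glue_step (part_fl b l) (part_fl b l.+1) (quo s l).
  move=> lt; have st := splitting_step lt; rewrite (flP l (ltnW lt)) in st.
  by have [h1 h2 _] := glue_step_part (part_dsum dX (ltnW lt)) (part_dsum dX lt)
    (fun v => part_quo (A := X1) lt) (fun v => part_quo (A := X2) lt) st.
have dL := part_dsum dX (leqnn _); have [mP1 mP2 mL _ _] := dL.
have h1 : homeo (part X1 (len s)) X1 (last_homeo s).
  by apply: part_last (mfd_polyhedron mP1); rewrite XE; left.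
have h2 : homeo (part X2 (len s)) X2 (last_homeo s).
  by apply: part_last (mfd_polyhedron mP2); rewrite XE; right.
have m1 l : (l <= len s)%N -> mfd n.+1 (part X1 l) by move=> le; case: (part_dsum dX le).
have m2 l : (l <= len s)%N -> mfd n.+1 (part X2 l) by move=> le; case: (part_dsum dX le).
exists (fpush F (last_homeo s) (part_fl a (len s))),
  (fpush F (last_homeo s) (part_fl b (len s))),
  (Splitting m1 (fun l lt => (stP l lt).1) ca h1 erefl),
  (Splitting m2 (fun l lt => (stP l lt).2) cb h2 erefl).
split=> //.
rewrite {1}(last_field s) (flP _ (leqnn _)).
exact: (du_fpush H _ _ (leqnn n.+1) dL dX (last_homeoP s) h1 h2).
Qed.

(** Gluing and homeomorphisms are linear. *)
Lemma fzero_stage l : (l <= len s)%N -> fzero (sfl s l) -> fzero x.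
Proof.
move=> le fz; have fzl : fzero (sfl s (len s)).
  rewrite -(subnKC le); have : (l + (len s - l) <= len s)%N by lia.
  elim: (len s - l)%N => [|k IH] lt; first by rewrite addn0.
  rewrite addnS in lt *; exact: fzero_step (splitting_step lt) (IH (ltnW lt)).
rewrite (last_field s); apply: fzero_fpush fzl; last exact: last_homeoP.
exact: stage_mfd.
Qed.

End Part.

Context (U : local_relations F).

(** A ball C whose image lies in X1 is a component of the part of M_l over X1.  The
    field of U(C) splits off from this part by [du_cancel], as the field on the
    other part is non-zero by [fzero_stage]. *)
Lemma splitting_part_restr X1 X2 X (x : fl F n.+1 X) (s : splitting x)
    (x1 : fl F n.+1 X1) (x2 : fl F n.+1 X2) (s1 : splitting x1) (s2 : splitting x2) :
  is_dsum n.+1 X1 X2 X ->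
  [/\ len s1 = len s, stage s1 = part s X1, quo s1 = quo s & last_homeo s1 = last_homeo s] ->
  [/\ len s2 = len s, stage s2 = part s X2, quo s2 = quo s & last_homeo s2 = last_homeo s] ->
  (forall l, (l <= len s)%N -> sfl s l = du F (sfl s1 l) (sfl s2 l)) ->
  ~ fzero x2 -> forall l C, stage_ball s l C -> to_end s l @` C `<=` X1 ->
  [/\ stage_ball s1 l C, to_end s1 l @` C = to_end s l @` C &
      restr_in U s l C -> restr_in U s1 l C].
Proof.
move=> dX [l1 st1 q1 lh1] [l2 st2 _ _] flE nz l C [le cC bC] CX1.
have dS := part_dsum dX le; rewrite -st1 -st2 in dS.
have [mP1 mP2 mS SE d0] := dS.
have CS : C `<=` stage s l by case: cC.
have CP : C `<=` stage s1 l.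
  by move=> v Cv; rewrite st1; split; [exact: CS | apply: CX1; exists v].
have cP : pl_component (stage s1 l) C.
  by apply: (component_part (B := stage s2 l) (mfd_polyhedron mP1) CP); rewrite -SE.
split.
- by split=> //; rewrite l1.
- by rewrite /to_end q1 lh1 l1.
- move=> [dC [y [z [yz Uy]]]].
  have [mC mD _ _ _] := dC.
  have [_ _ pC pPC _] := cP.
  have dPC : is_dsum n.+1 C (stage s1 l `\` C) (stage s1 l).
    have PE : stage s1 l = C `|` (stage s1 l `\` C) by rewrite setDUK.
    have P0 : C `&` (stage s1 l `\` C) = set0 by apply: dis0 => v Cv [].
    split=> //; apply: (mfd_part pPC pC); first by rewrite setIC.
    by rewrite setUC -PE.
  split=> //.
  have dE : is_dsum n.+1 (stage s1 l `\` C) (stage s2 l) (stage s l `\` C).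
    have [_ mPC _ _ _] := dPC.
    split=> //.
      rewrite SE setDUl; congr (_ `|` _); apply/seteqP; split=> [v []//|v P2v].
      by split=> // /CP P1v; exact: disjoint_out d0 P1v P2v.
    by apply: dis0 => v [P1v _] P2v; exact: disjoint_out d0 P1v P2v.
  have e : du F (sfl s1 l) (sfl s2 l) = du F y z :> fl F n.+1 (stage s l) by rewrite -flE.
  have nz2 : ~ fzero (sfl s2 l) by move=> /fzero_stage; rewrite l2 => /(_ le).
  have [z' z'E] := du_cancel dS dC dPC dE nz2 e.
  by exists y, z'.
Qed.

(** A blob is the image of a connected set. *)
Lemma blob_side X1 X2 X (x : fl F n.+1 X) k (T : 'I_k -> space) :
  is_dsum n.+1 X1 X2 X -> blob_diagram U T x ->
  forall i, T i !=set0 /\ (T i `<=` X1 \/ T i `<=` X2).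
Proof.
move=> dX [s [l [C h]]] i; have [[le [CS [v Cv] pC _ cC] _] -> _] := h i.
split; first by exists (to_end s (l i) v); exists v.
have [mP1 mP2 _ SE d0] := part_dsum dX le.
have [] := connected_in (mfd_polyhedron mP1) (mfd_polyhedron mP2) d0 pC cC.
- by rewrite -SE.
- by move=> sub; left=> _ [u Cu <-]; have [] := sub _ Cu.
- by move=> sub; right=> _ [u Cu <-]; have [] := sub _ Cu.
Qed.

(** e1 and e2 enumerate the blobs in X1 and those in X2.  A blob that is a twig among
    those in X1 is a twig of the whole configuration, because every blob inside it
    also lies in X1. *)
Lemma blob_diagram_part X1 X2 X (x : fl F n.+1 X) k p q (T : 'I_k -> space)
    (e1 : 'I_p -> 'I_k) (e2 : 'I_q -> 'I_k) :
  is_dsum n.+1 X1 X2 X -> blob_diagram U T x -> ~ fzero x ->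
  (forall j, T (e1 j) `<=` X1) -> (forall i, T i `<=` X1 -> exists j, i = e1 j) ->
  (forall j, T (e2 j) `<=` X2) -> (forall i, T i `<=` X2 -> exists j, i = e2 j) ->
  exists (x1 : fl F n.+1 X1) (x2 : fl F n.+1 X2),
    [/\ x = du F x1 x2, blob_diagram U (T \o e1) x1 & blob_diagram U (T \o e2) x2].
Proof.
move=> dX [s [l [C h]]] nz T1 e1P T2 e2P.
have [x1 [x2 [s1 [s2 [xE h1 h2 flE]]]]] := splitting_part s dX.
have dX' := is_dsumC dX; have [mX1 mX2 _ _ _] := dX.
have flE' i : (i <= len s)%N -> sfl s i = du F (sfl s2 i) (sfl s1 i).
  move=> le; rewrite flE //.
  have dS := part_dsum dX le; have [[_ st1 _ _] [_ st2 _ _]] := (h1, h2).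
  by rewrite -st1 -st2 in dS; exact: (du_comm H _ _ (leqnn n.+1) dS).
have nz2 : ~ fzero x2.
  move=> fz; apply: nz; rewrite xE (du_comm H _ _ (leqnn n.+1) dX).
  exact: fzero_du dX' fz.
have nz1 : ~ fzero x1 by move=> fz; apply: nz; rewrite xE; exact: fzero_du dX fz.
exists x1, x2; split=> //.
  exists s1, (l \o e1), (C \o e1) => j; have [b TE tw] := h (e1 j).
  have sub : to_end s (l (e1 j)) @` C (e1 j) `<=` X1 by rewrite -TE.
  have [b' tE rE] := splitting_part_restr dX h1 h2 flE nz2 b sub.
  split=> //=; first by rewrite tE.
  move=> tw1; apply: rE; apply: tw => i Ti; have [|j' ij] := e1P i.
    by apply: subset_trans (T1 j); case: Ti.
  by apply: (tw1 j'); rewrite /= -ij.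
exists s2, (l \o e2), (C \o e2) => j; have [b TE tw] := h (e2 j).
have sub : to_end s (l (e2 j)) @` C (e2 j) `<=` X2 by rewrite -TE.
have [b' tE rE] := splitting_part_restr dX' h2 h1 flE' nz1 b sub.
split=> //=; first by rewrite tE.
move=> tw1; apply: rE; apply: tw => i Ti; have [|j' ij] := e2P i.
  by apply: subset_trans (T2 j); case: Ti.
by apply: (tw1 j'); rewrite /= -ij.
Qed.

End Splittings.

(** * Juxtaposing blob diagrams *)

(** The default value d is never reached when p + q = k.  No equation between the
    sizes is built into the type, which avoids casts between ordinals. *)
Definition juxt (A : Type) (d : A) p q k (f : 'I_p -> A) (g : 'I_q -> A) (i : 'I_k) : A :=
  if insub (val i) is Some j then f j else
  if insub (i - p)%N is Some j then g j else d.

Lemma juxtl A d p q k f g (i : 'I_k) (j : 'I_p) : i = j :> nat ->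
  @juxt A d p q k f g i = f j.
Proof. by move=> e; rewrite /juxt [val i]e (valK j). Qed.

Lemma juxtr A d p q k f g (i : 'I_k) (j : 'I_q) : i = (p + j)%N :> nat ->
  @juxt A d p q k f g i = g j.
Proof.
move=> e; rewrite /juxt insubN; last by rewrite [val i]e -leqNgt leq_addr.
by rewrite e addKn (valK j).
Qed.

Arguments juxtl {A d p q k f g} i j.
Arguments juxtr {A d p q k f g} i j.

Lemma juxtP k p q (i : 'I_k) : (p + q = k)%N ->
  (exists j : 'I_p, i = j :> nat) \/ (exists j : 'I_q, i = (p + j)%N :> nat).
Proof.
move=> e; subst k; case: (splitP i) => j ij; first by left; exists j.
by right; exists j.
Qed.

Section Join.
Context {R : realType} {K : fieldType} {n : nat} {F : system_of_fields R K n}.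
Context (U : local_relations F).
Local Notation pt := (@pt R).
Local Notation space := (@Defs.space R).
Let H := sof_fields F.

(** ** Idle steps *)

Section Pad.
Context {X : space} {x : fl F n.+1 X} (s : splitting x) (m : nat).

Let quo' i := if (i < len s)%N then quo s i else id.

Hypothesis le_len : (len s <= m)%N.

Let glue' i : (i < m)%N ->
  glue_step (sfl s (minn i (len s))) (sfl s (minn i.+1 (len s))) (quo' i).
Proof.
move=> im; rewrite /quo'; case: ltnP => [lt|ge].
  have -> : minn i.+1 (len s) = i.+1 by lia.
  exact: splitting_step.
have -> : minn i.+1 (len s) = len s by lia.
have mL := stage_mfd (leqnn (len s)).
have := glue_step_id (sfl s (len s)) mL (homeo_id (mfd_polyhedron mL)).
by rewrite (fpush_id H).
Qed.

Let mfd' i : (i <= m)%N -> mfd n.+1 (stage s (minn i (len s))).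
Proof. by move=> _; apply: stage_mfd; exact: geq_minr. Qed.

Let start' : componentwise (sfl s (minn 0 (len s))).
Proof. by rewrite min0n; exact: split_start. Qed.

Let homeo' : homeo (stage s (minn m (len s))) X (last_homeo s).
Proof. by rewrite (minn_idPr le_len); exact: last_homeoP. Qed.

Let last' : x = fpush F (last_homeo s) (sfl s (minn m (len s))).
Proof. by rewrite (minn_idPr le_len); exact: last_field. Qed.

(** Idle steps glue the last stage along the empty set. *)
Definition pad : splitting x :=
  @Splitting _ _ _ _ _ x m _ quo' (fun i => sfl s (minn i (len s)))
    (last_homeo s) mfd' glue' start' homeo' last'.

Lemma pad_end l : (l <= len s)%N -> to_end pad l = to_end s l.
Proof.
move=> le; rewrite /to_end.
suff -> : quo_iter (quo pad) l (len pad - l) = quo_iter (quo s) l (len s - l) by [].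
rewrite /=.
have short k : (l + k <= len s)%N -> quo_iter quo' l k = quo_iter (quo s) l k.
  elim: k => [//|k IH] lt /=; rewrite addnS in lt.
  by rewrite IH ?(ltnW lt) // /quo' lt.
have -> : (m - l = (len s - l) + (m - len s))%N by lia.
elim: (m - len s)%N => [|k IH]; first by rewrite addn0 short // subnKC.
rewrite addnS /= IH /quo'.
by have -> : (l + (len s - l + k) < len s)%N = false by apply/negbTE; lia.
Qed.

Lemma pad_ball l C : stage_ball s l C -> stage_ball pad l C.
Proof.
move=> [le cC bC]; split=> //=; first exact: leq_trans le le_len.
by rewrite (minn_idPl le).
Qed.

Lemma pad_restr l C : (l <= len s)%N -> restr_in U s l C -> restr_in U pad l C.
Proof. by move=> le h; rewrite /restr_in /= (minn_idPl le). Qed.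

End Pad.

Definition blob_diagram_len (m : nat) k X (T : 'I_k -> space) (x : fl F n.+1 X) :=
  exists (s : splitting x) (l : 'I_k -> nat) (C : 'I_k -> space), len s = m /\
    forall i, [/\ stage_ball s (l i) (C i), T i = to_end s (l i) @` C i
                & twig T i -> restr_in U s (l i) (C i)].

Lemma blob_diagram_pad k X (T : 'I_k -> space) (x : fl F n.+1 X) :
  blob_diagram U T x -> exists m0, forall m, (m0 <= m)%N -> blob_diagram_len m T x.
Proof.
move=> [s [l [C h]]]; exists (len s) => m le.
exists (pad le), l, C; split=> // i; have [b TE tw] := h i.
have [li _ _] := b.
split; [exact: pad_ball | by rewrite pad_end |].
by move=> /tw; exact: pad_restr.
Qed.

(** ** Simultaneous gluing of two splittings *)

Section Sum.
Context {X1 X2 : space} {x1 : fl F n.+1 X1} {x2 : fl F n.+1 X2}.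
Context (mX1 : mfd n.+1 X1) (mX2 : mfd n.+1 X2).
Context (s1 : splitting x1) (s2 : splitting x2) (len12 : len s1 = len s2).

Definition field_dsum A B (a : fl F n.+1 A) (b : fl F n.+1 B) : fl F n.+1 (dsum A B) :=
  du F (fpush F inj1 a : fl F n.+1 (inj1 @` A)) (fpush F inj2 b : fl F n.+1 (inj2 @` B)).

Let le2 i : (i <= len s1)%N -> (i <= len s2)%N. Proof. by rewrite len12. Qed.
Let stage' i := dsum (stage s1 i) (stage s2 i).
Let quo' i := dsum_map (quo s1 i) (quo s2 i).
Let sfl' i := field_dsum (sfl s1 i) (sfl s2 i).

Let dS i : (i <= len s1)%N ->
  is_dsum n.+1 (inj1 @` stage s1 i) (inj2 @` stage s2 i) (stage' i).
Proof. by move=> le; apply: dsum_is_dsum; apply: stage_mfd => //; exact: le2. Qed.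

Let mfd' i : (i <= len s1)%N -> mfd n.+1 (stage' i).
Proof. by move=> /dS[]. Qed.

Let poly1 i : (i <= len s1)%N -> polyhedron (stage s1 i).
Proof. by move=> le; exact: mfd_polyhedron (stage_mfd le). Qed.
Let poly2 i : (i <= len s1)%N -> polyhedron (stage s2 i).
Proof. by move=> le; exact: mfd_polyhedron (stage_mfd (le2 le)). Qed.

Let glue' i : (i < len s1)%N -> glue_step (sfl' i) (sfl' i.+1) (quo' i).
Proof.
move=> lt; have lt2 : (i < len s2)%N by rewrite -len12.
apply: (glue_step_union (dS (ltnW lt)) (dS lt)).
  apply: (glue_step_homeo _ _ _ (splitting_step lt)); try exact: homeo_inj1 (poly1 _).
    exact: homeo_inj1 (poly1 (ltnW lt)).
  by move=> v _; rewrite /quo' /dsum_map /= eqxx.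
apply: (glue_step_homeo _ _ _ (splitting_step lt2)); try exact: homeo_inj2 (poly2 _).
  exact: homeo_inj2 (poly2 (ltnW lt)).
by move=> v _; rewrite /quo' /dsum_map /= oner_eq0.
Qed.

Let start' : componentwise (sfl' 0).
Proof.
apply: cw_du; first exact: dS.
  by apply: cw_fpush (split_start s1); apply: homeo_inj1; exact: poly1.
by apply: cw_fpush (split_start s2); apply: homeo_inj2; exact: poly2.
Qed.

Let last1 := last_homeoP s1.
Let last2 : homeo (stage s2 (len s1)) X2 (last_homeo s2).
Proof. by rewrite len12; exact: last_homeoP. Qed.

Let last' : field_dsum x1 x2 =
  fpush F (dsum_map (last_homeo s1) (last_homeo s2)) (sfl' (len s1)).
Proof.
rewrite (fpush_dsum _ _ (leqnn _) (stage_mfd (leqnn _)) (stage_mfd (le2 (leqnn _))) last1 last2).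
rewrite /field_dsum [in LHS](last_field s1) [in LHS](last_field s2).
by rewrite len12.
Qed.

Definition splitting_dsum : splitting (field_dsum x1 x2) :=
  @Splitting _ _ _ _ _ (field_dsum x1 x2) (len s1) stage' quo' sfl'
    (dsum_map (last_homeo s1) (last_homeo s2)) mfd' glue' start'
    (homeo_dsum last1 last2) last'.

Lemma dsum_end1 l v : to_end splitting_dsum l (inj1 v) = inj1 (to_end s1 l v).
Proof.
rewrite /to_end /=.
have -> k : quo_iter quo' l k (inj1 v) = inj1 (quo_iter (quo s1) l k v).
  by elim: k => [//|k /= ->]; rewrite /quo' /dsum_map /= eqxx.
by rewrite /dsum_map /= eqxx.
Qed.

Lemma dsum_end2 l v : to_end splitting_dsum l (inj2 v) = inj2 (to_end s2 l v).
Proof.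
rewrite /to_end /= len12.
have -> k : quo_iter quo' l k (inj2 v) = inj2 (quo_iter (quo s2) l k v).
  by elim: k => [//|k /= ->]; rewrite /quo' /dsum_map /= oner_eq0.
by rewrite /dsum_map /= oner_eq0.
Qed.

Lemma dsum_ball1 l C : stage_ball s1 l C -> stage_ball splitting_dsum l (inj1 @` C).
Proof.
move=> [le cC bC]; have [_ _ pC _ _] := cC; split=> //=.
  apply: component_union; [|exact: inj12|].
    exact: mfd_polyhedron (mfd_inj2 (stage_mfd (le2 le))).
  exact: component_homeo (homeo_inj1 (poly1 le)) cC.
exact: ball_homeo bC (homeo_inj1 pC).
Qed.

Lemma dsum_ball2 l C : stage_ball s2 l C -> stage_ball splitting_dsum l (inj2 @` C).
Proof.
move=> [le cC bC]; have [_ _ pC _ _] := cC; have le1 : (l <= len s1)%N by rewrite len12.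
split=> //=; last exact: ball_homeo bC (homeo_inj2 pC).
rewrite /stage' /dsum setUC; apply: component_union.
- exact: mfd_polyhedron (mfd_inj1 (stage_mfd le1)).
- by rewrite setIC inj12.
- exact: component_homeo (homeo_inj2 (poly2 le1)) cC.
Qed.

(** If y splits off from the field on A, then it splits off from the field on A u B,
    with B added to the complement; f moves A to a copy A' that is disjoint from B. *)
Lemma restr_add A A' B M C (a : fl F n.+1 A) (b : fl F n.+1 B) f :
  is_dsum n.+1 C (A `\` C) A -> homeo A A' f -> is_dsum n.+1 A' B M ->
  pl_ball n C ->
  (exists (y : fl F n.+1 C) (z : fl F n.+1 (A `\` C)), a = du F y z /\ U C y) ->
  is_dsum n.+1 (f @` C) (M `\` f @` C) M /\
  exists (y : fl F n.+1 (f @` C)) (z : fl F n.+1 (M `\` f @` C)),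
    du F (fpush F f a : fl F n.+1 A') b = du F y z :> fl F n.+1 M /\ U (f @` C) y.
Proof.
move=> dA hf dM bC [y [z [-> Uy]]].
have [mC mD mA AE A0] := dA; have [mA' mB mM ME M0] := dM.
have CA : C `<=` A by rewrite AE; left.
have DA : A `\` C `<=` A by move=> v [].
have hC := homeo_sub hf (mfd_polyhedron mC) CA.
have hD := homeo_sub hf (mfd_polyhedron mD) DA.
have CDE : A' = f @` C `|` f @` (A `\` C).
  by have [_ <- _] := hf; rewrite -image_setU -AE.
have CD0 : f @` C `&` f @` (A `\` C) = set0.
  apply: dis0 => _ [v Cv <-] [w [Aw nCw] e]; apply: nCw.
  by rewrite (homeo_inj hf Aw (CA _ Cv) e).
have dA' : is_dsum n.+1 (f @` C) (f @` (A `\` C)) A'.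
  by split=> //; [exact: mfd_homeo hC mC | exact: mfd_homeo hD mD].
have [mfC mfD _ _ _] := dA'.
have MDE : M `\` f @` C = f @` (A `\` C) `|` B.
  rewrite ME CDE; apply/seteqP; split=> v; first by move=> [[[|]|]]; [| left | right].
  move=> [Dv|Bv].
    by split=> [|Cv]; [left; right | exact: disjoint_out CD0 Cv Dv].
  split=> [|Cv]; first by right.
  by apply: (disjoint_out M0 (x := v)) => //; rewrite CDE; left.
have dDB : is_dsum n.+1 (f @` (A `\` C)) B (M `\` f @` C).
  have DB0 : f @` (A `\` C) `&` B = set0.
    by apply: dis0 => v Dv Bv; apply: (disjoint_out M0 (x := v)) => //; rewrite CDE; right.
  by rewrite MDE; apply: is_dsumU.
have dCM : is_dsum n.+1 (f @` C) (M `\` f @` C) M.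
  have [_ _ mDB _ _] := dDB.
  split=> //; last by apply: dis0 => v Cv [].
  by rewrite MDE setUA -CDE.
split=> //; exists (fpush F f y), (du F (fpush F f z : fl F n.+1 (f @` (A `\` C))) b).
split; last by rewrite (lr_homeo U bC hC); exists y.
rewrite (du_fpush H y z (leqnn n.+1) dA dA' hf hC hD).
by rewrite -(du_assoc H _ _ _ (leqnn n.+1) dA' dDB dCM dM).
Qed.

Lemma dsum_restr1 l C : stage_ball s1 l C -> restr_in U s1 l C ->
  restr_in U splitting_dsum l (inj1 @` C).
Proof.
move=> [le _ bC] [dC yz].
exact: (restr_add _ dC (homeo_inj1 (poly1 le)) (dS le) bC yz).
Qed.

Lemma dsum_restr2 l C : stage_ball s2 l C -> restr_in U s2 l C ->
  restr_in U splitting_dsum l (inj2 @` C).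
Proof.
move=> [le _ bC] [dC yz]; have le1 : (l <= len s1)%N by rewrite len12.
rewrite /restr_in /= /sfl' /field_dsum (du_comm H _ _ (leqnn n.+1) (dS le1)).
exact: (restr_add _ dC (homeo_inj2 (poly2 le1)) (is_dsumC (dS le1)) bC yz).
Qed.

End Sum.

(** ** Configurations on a disjoint union *)

Definition jconf p q k (T1 : 'I_p -> space) (T2 : 'I_q -> space) : 'I_k -> space :=
  juxt set0 (fun j => inj1 @` T1 j) (fun j => inj2 @` T2 j).

Lemma image_proper (A B : space) (f : pt -> pt) : injective f ->
  f @` A `<` f @` B <-> A `<` B.
Proof.
move=> fI; have sub (C D : space) : f @` C `<=` f @` D <-> C `<=` D.
  split=> [h v Cv|]; last exact: image_subset.
  by have [w Dw /fI <-] : (f @` D) (f v) by apply: h; exists v.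
by split=> -[h1 h2]; split; try move=> /sub //; exact/sub.
Qed.

Lemma inj1I : injective (inj1 : pt -> pt). Proof. by move=> v w /(congr1 ptl). Qed.
Lemma inj2I : injective (inj2 : pt -> pt). Proof. by move=> v w /(congr1 ptl). Qed.

Lemma blob_diagram_join X1 X2 (x1 : fl F n.+1 X1) (x2 : fl F n.+1 X2) p q k
    (T1 : 'I_p -> space) (T2 : 'I_q -> space) :
  (p + q = k)%N -> blob_diagram U T1 x1 -> blob_diagram U T2 x2 ->
  blob_diagram U (jconf T1 T2 : 'I_k -> space) (field_dsum x1 x2).
Proof.
move=> e /blob_diagram_pad[m1 h1] /blob_diagram_pad[m2 h2].
have [s1 [l1 [C1 [len1 {}h1]]]] := h1 _ (leq_maxl m1 m2).
have [s2 [l2 [C2 [len2 {}h2]]]] := h2 _ (leq_maxr m1 m2).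
have len12 : len s1 = len s2 by rewrite len1.
exists (splitting_dsum len12), (juxt 0%N l1 l2),
  (juxt set0 (fun j => inj1 @` C1 j) (fun j => inj2 @` C2 j)) => i.
have [[j ij]|[j ij]] := juxtP i e.
  have [b TE tw] := h1 j.
  rewrite /jconf !(juxtl _ _ ij); split; first exact: dsum_ball1.
    by rewrite TE !image_comp; apply: eq_imagel => v _; exact/esym/dsum_end1.
  move=> twi; apply: dsum_restr1 => //; apply: tw => j' Tj'.
  have j'k : (j' < k)%N by have := ltn_ord j'; lia.
  apply: (twi (Ordinal j'k)); rewrite /jconf (juxtl _ _ ij).
  by rewrite (juxtl _ j') //; apply/(image_proper _ _ inj1I).
have [b TE tw] := h2 j.
rewrite /jconf !(juxtr _ _ ij); split; first exact: dsum_ball2.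
  by rewrite TE !image_comp; apply: eq_imagel => v _; exact/esym/dsum_end2.
move=> twi; apply: dsum_restr2 => //; apply: tw => j' Tj'.
have j'k : (p + j' < k)%N by have := ltn_ord j'; lia.
apply: (twi (Ordinal j'k)); rewrite /jconf (juxtr _ _ ij).
by rewrite (juxtr _ j') //; apply/(image_proper _ _ inj2I).
Qed.

Lemma blob_diagram_split X1 X2 p q k (T1 : 'I_p -> space) (T2 : 'I_q -> space)
    (x : fl F n.+1 (dsum X1 X2)) :
  mfd n.+1 X1 -> mfd n.+1 X2 -> (p + q = k)%N ->
  (forall j, T1 j `<=` X1) -> (forall j, T2 j `<=` X2) ->
  blob_diagram U (jconf T1 T2 : 'I_k -> space) x -> ~ fzero x ->
  exists (x1 : fl F n.+1 X1) (x2 : fl F n.+1 X2),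
    [/\ x = field_dsum x1 x2, blob_diagram U T1 x1 & blob_diagram U T2 x2].
Proof.
move=> mX1 mX2 e TX1 TX2 bd nz.
have dX := dsum_is_dsum mX1 mX2.
have [p1 p2] := (mfd_polyhedron mX1, mfd_polyhedron mX2).
have side := blob_side dX bd.
have lt1 (j : 'I_p) : (j < k)%N by have := ltn_ord j; lia.
have lt2 (j : 'I_q) : (p + j < k)%N by have := ltn_ord j; lia.
pose e1 j := Ordinal (lt1 j); pose e2 j := Ordinal (lt2 j).
have E1 j : jconf T1 T2 (e1 j) = inj1 @` T1 j by rewrite /jconf (juxtl _ j).
have E2 j : jconf T1 T2 (e2 j) = inj2 @` T2 j by rewrite /jconf (juxtr _ j).
have mixed (A B : space) i : (jconf T1 T2 : 'I_k -> space) i `<=` inj1 @` A ->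
    (jconf T1 T2 : 'I_k -> space) i `<=` inj2 @` B -> False.
  move=> h1 h2; have [[v Tv] _] := side i.
  exact: disjoint_out (inj12 A B) (h1 _ Tv) (h2 _ Tv).
have [||||x1 [x2 [xE b1 b2]]] := blob_diagram_part (e1 := e1) (e2 := e2) dX bd nz.
- by move=> j; rewrite E1; exact: image_subset.
- move=> i Ti; have [[j ij]|[j ij]] := juxtP i e; first by exists j; exact: val_inj.
  have ij' : i = e2 j by exact: val_inj.
  by case: (mixed X1 (T2 j) i) => //; rewrite ij' E2.
- by move=> j; rewrite E2; exact: image_subset.
- move=> i Ti; have [[j ij]|[j ij]] := juxtP i e; last by exists j; exact: val_inj.
  have ij' : i = e1 j by exact: val_inj.
  by case: (mixed (T1 j) X2 i) => //; rewrite ij' E1.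
have h1 := homeo_ptl1 p1; have h2 := homeo_ptl2 p2.
have n1 := leqnn n.+1.
exists (fpush F ptl x1), (fpush F ptl x2); split.
- rewrite xE /field_dsum; congr (du F _ _).
    rewrite -(fpush_comp H x1 n1 (mfd_inj1 mX1) mX1 (mfd_inj1 mX1) h1 (homeo_inj1 p1)).
    rewrite -[LHS](fpush_id H) //; last exact: mfd_inj1.
    by apply: (fpush_ext H) => //; try exact: mfd_inj1; move=> _ [v _ <-].
  rewrite -(fpush_comp H x2 n1 (mfd_inj2 mX2) mX2 (mfd_inj2 mX2) h2 (homeo_inj2 p2)).
  rewrite -[LHS](fpush_id H) //; last exact: mfd_inj2.
  by apply: (fpush_ext H) => //; try exact: mfd_inj2; move=> _ [v _ <-].
- have := blob_diagram_homeo (mfd_inj1 mX1) mX1 h1 b1.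
  congr blob_diagram; apply/funext => j /=.
  by rewrite E1 image_comp image_id.
- have := blob_diagram_homeo (mfd_inj2 mX2) mX2 h2 b2.
  congr blob_diagram; apply/funext => j /=.
  by rewrite E2 image_comp image_id.
Qed.

End Join.

(** * Bilinear maps on modules presented by generators and relations *)

Section Bilift.
Context {K : fieldType} {G1 G2 : Type} {M : lmodType K}.
Context {rel1 : expr K G1 -> expr K G1 -> Prop} {rel2 : expr K G2 -> expr K G2 -> Prop}.

Lemma eval_lin (G : Type) (f g : G -> M) a (x : expr K G) :
  Defs.eval (fun i => a *: f i + g i) x = a *: Defs.eval f x + Defs.eval g x.
Proof.
elim: x => [i||x hx y hy|b x hx] //=.
- by rewrite scaler0 addr0.
- by rewrite hx hy scalerDr addrACA.
- by rewrite hx scalerDr !scalerA mulrC.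
Qed.

Lemma eval_const0 (G : Type) (x : expr K G) : Defs.eval (fun=> 0 : M) x = 0.
Proof.
elim: x => [i||x hx y hy|b x hx] //=; first by rewrite hx hy addr0.
by rewrite hx scaler0.
Qed.

Context (f : G1 -> G2 -> M).
Hypothesis f1 : forall j, respects rel1 (fun i => f i j).
Hypothesis f2 : forall i, respects rel2 (f i).

Definition bilift_gen (b : pres rel2) (i : G1) : M := plift (f i) (@f2 i) b.

(** By induction on an expression for b the statement reduces to generators. *)
Lemma bilift_respects b : respects rel1 (bilift_gen b).
Proof.
move=> x y xy; rewrite -(Defs.reprK b); elim: (pres_repr b) => [j||e h e' h'|a e h].
- have E i : bilift_gen (pres_cls rel2 (Egen j)) i = f i j by exact: plift_gen.
  by rewrite /= (funext E); exact: f1.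
- have E i : bilift_gen (pres_cls rel2 (Ezero : expr K G2)) i = 0.
    by rewrite /bilift_gen cls0E linear0.
  by rewrite (funext E) !eval_const0.
- have E i : bilift_gen (pres_cls rel2 (Eadd e e')) i =
      1 *: bilift_gen (pres_cls rel2 e) i + bilift_gen (pres_cls rel2 e') i.
    by rewrite /bilift_gen clsDE linearD scale1r.
  by rewrite (funext E) !eval_lin h h'.
- have E i : bilift_gen (pres_cls rel2 (Escale a e)) i =
      a *: bilift_gen (pres_cls rel2 e) i + 0.
    by rewrite /bilift_gen clsZE linearZ addr0.
  by rewrite (funext E) !eval_lin h !eval_const0.
Qed.

(** The bilinear map with prescribed values on pairs of generators, obtained by
    extending first in the second and then in the first argument. *)
Definition bilift (a : pres rel1) (b : pres rel2) : M :=
  plift (bilift_gen b) (@bilift_respects b) a.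

Lemma bilift_genE i j : bilift (pres_gen rel1 i) (pres_gen rel2 j) = f i j.
Proof. by rewrite /bilift plift_gen /bilift_gen plift_gen. Qed.

Lemma bilift_lin_l c a a' b : bilift (c *: a + a') b = c *: bilift a b + bilift a' b.
Proof. by rewrite /bilift linearP. Qed.

Lemma bilift_lin_r c a b b' : bilift a (c *: b + b') = c *: bilift a b + bilift a b'.
Proof.
have E d : bilift a d = Defs.eval (bilift_gen d) (pres_repr a).
  by rewrite -{1}(Defs.reprK a); exact: (plift_cls (@bilift_respects d)).
rewrite !E -eval_lin.
congr (Defs.eval _ _); apply/funext => i; by rewrite /bilift_gen linearP.
Qed.

End Bilift.

Lemma bilinear_gen_eq (K : fieldType) (G1 G2 : Type) (M : lmodType K)
    (rel1 : expr K G1 -> expr K G1 -> Prop) (rel2 : expr K G2 -> expr K G2 -> Prop)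
    (f g : pres rel1 -> pres rel2 -> M) :
  (forall b, linear (f^~ b)) -> (forall a, linear (f a)) ->
  (forall b, linear (g^~ b)) -> (forall a, linear (g a)) ->
  (forall i j, f (pres_gen rel1 i) (pres_gen rel2 j) =
               g (pres_gen rel1 i) (pres_gen rel2 j)) ->
  forall a b, f a b = g a b.
Proof.
move=> fl fr gl gr h a b.
have [Lf LfE] := linear_fun (fl b); have [Lg LgE] := linear_fun (gl b).
rewrite -LfE -LgE; apply: (linear_gen_eq Lf Lg) => i; rewrite LfE LgE.
have [Mf MfE] := linear_fun (fr (pres_gen rel1 i)).
have [Mg MgE] := linear_fun (gr (pres_gen rel1 i)).
by rewrite -MfE -MgE; apply: (linear_gen_eq Mf Mg) => j; rewrite MfE MgE.
Qed.

(** * Permutations of two blocks *)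

(** The permutation matrix is block diagonal, so the signs can be read off from
    determinants. *)
Lemma block_perm p q (t1 : 'S_p) (t2 : 'S_q) : exists t : 'S_(p + q),
  [/\ forall i, t (lshift q i) = lshift q (t1 i),
      forall j, t (rshift p j) = rshift p (t2 j) &
      odd_perm t = odd_perm t1 (+) odd_perm t2].
Proof.
pose f (i : 'I_(p + q)) := match fintype.split i with
  | inl a => lshift q (t1 a) | inr b => rshift p (t2 b) end.
have fl i : f (lshift q i) = lshift q (t1 i) by rewrite /f (unsplitK (inl i)).
have fr j : f (rshift p j) = rshift p (t2 j) by rewrite /f (unsplitK (inr j)).
have fI : injective f.
  move=> i i'; case: (split_ordP i) => a ->; case: (split_ordP i') => b ->;
  rewrite ?fl ?fr => /eqP.
  - by rewrite eq_lshift => /eqP/perm_inj ->.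
  - by rewrite eq_lrshift.
  - by rewrite eq_rlshift.
  - by rewrite eq_rshift => /eqP/perm_inj ->.
exists (perm fI); split=> [i|j|]; rewrite ?permE //.
(* only the determinants of these matrices matter *)
have : perm_mx (perm fI) = block_mx (perm_mx t1) 0 0 (perm_mx t2) :> 'M[int]_(p + q).
  apply/matrixP => i i'; case: (split_ordP i) => a ->; case: (split_ordP i') => b ->.
  - by rewrite block_mxEul !mxE permE fl eq_lshift.
  - by rewrite block_mxEur !mxE permE fl eq_lrshift.
  - by rewrite block_mxEdl !mxE permE fr eq_rlshift.
  - by rewrite block_mxEdr !mxE permE fr eq_rshift.
move=> /(congr1 (fun A => \det A)).
rewrite det_ublock !det_perm => e.
by move: e; do 3 case: odd_perm; rewrite /= ?expr1 ?expr0.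
Qed.

(** A permutation that preserves the first block also preserves the second. *)
Lemma block_permP p q (t : 'S_(p + q)) :
  (forall i : 'I_p, (t (lshift q i) < p)%N) -> exists (t1 : 'S_p) (t2 : 'S_q),
  [/\ forall i, t (lshift q i) = lshift q (t1 i),
      forall j, t (rshift p j) = rshift p (t2 j) &
      odd_perm t = odd_perm t1 (+) odd_perm t2].
Proof.
move=> tp; pose f1 i := Ordinal (tp i).
have f1E i : lshift q (f1 i) = t (lshift q i) by exact: val_inj.
have f1I : injective f1.
  by move=> i j e; apply: (@lshift_inj p q); apply: (@perm_inj _ t); rewrite -!f1E e.
have f1S i : exists j, f1 j = i by exists (invF f1I i); rewrite f_invF.
have tq (j : 'I_q) : exists j', rshift p j' = t (rshift p j).
  case: (split_ordP (t (rshift p j))) => [i e|j' ->]; last by exists j'.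
  have [i' e'] := f1S i; move: e; rewrite -e' f1E => /perm_inj/eqP.
  by rewrite eq_rlshift.
have [f2 f2E] := choice tq.
have f2I : injective f2.
  by move=> i j e; apply: (@rshift_inj p q); apply: (@perm_inj _ t); rewrite -!f2E e.
have [u [ul ur us]] := block_perm (perm f1I) (perm f2I).
have tu : t = u.
  apply/permP => i; case: (split_ordP i) => j ->.
    by rewrite ul permE f1E.
  by rewrite ur permE f2E.
by exists (perm f1I), (perm f2I); rewrite tu.
Qed.

(** Enumerate the elements that satisfy P before the others. *)
Lemma sorting_perm k (P : pred 'I_k) : exists (p : nat) (s : 'S_k),
  (p <= k)%N /\ forall i, P (s i) = (i < p)%N.
Proof.
(* the elements of 'I_k, those in P first *)
pose r := seq.filter P (enum 'I_k) ++ seq.filter (predC P) (enum 'I_k).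
have pr : perm_eq r (enum 'I_k) by rewrite perm_filterC.
have sr : size r = k by rewrite (perm_size pr) size_enum_ord.
have ur : uniq r by rewrite (perm_uniq pr) enum_uniq.
pose f i := nth i r (val i).
have fI : injective f.
  have lt (i : 'I_k) : (val i < size r)%N by rewrite sr; exact: ltn_ord.
  move=> i j; rewrite /f (set_nth_default j i (lt i)).
  by move=> /eqP; rewrite nth_uniq // => /eqP/val_inj.
exists (size (seq.filter P (enum 'I_k))), (perm fI); split.
  by rewrite -[X in (_ <= X)%N]sr size_cat leq_addr.
move=> i; rewrite permE /f nth_cat; case: ltnP => [lt|ge].
  by have := mem_nth i lt; rewrite mem_filter => /andP[].
have lt : (i - size (seq.filter P (enum 'I_k)) < size (seq.filter (predC P) (enum 'I_k)))%N.
  by rewrite ltn_subLR // -size_cat -/r sr; exact: ltn_ord.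
by have := mem_nth i lt; rewrite mem_filter => /andP[/negbTE].
Qed.

Lemma card_lt k p : (p <= k)%N -> #|[pred i : 'I_k | (i < p)%N]| = p.
Proof.
move=> pk; have wI : injective (widen_ord pk) by move=> i j /(congr1 val) /= /val_inj.
rewrite -[RHS]card_ord -(fintype.card_image wI).
apply: eq_card => i; rewrite !inE.
apply/idP/fintype.imageP => [ip|[j _ ->]]; last exact: (ltn_ord j).
by exists (Ordinal ip) => //; exact: val_inj.
Qed.


(** * Tensor symbols and spans of blob diagrams *)

Section TensorSymbols.
Context {K : fieldType} (C D : complex K).

Lemma tsymZ_l k p q c (a : ch C p) (b : ch D q) : tsym k (c *: a) b = c *: tsym k a b.
Proof. by have := tsym_lin_l k c a 0 b; rewrite addr0 tsym0l addr0. Qed.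

Lemma tsymZ_r k p q c (a : ch C p) (b : ch D q) : tsym k a (c *: b) = c *: tsym k a b.
Proof. by have := tsym_lin_r k c a b 0; rewrite addr0 tsym0r addr0. Qed.

Lemma tsym_suml k p q (I : finType) (a : I -> ch C p) (b : ch D q) :
  tsym k (\sum_i a i) b = \sum_i tsym k (a i) b.
Proof.
have [L LE] := linear_fun (f := fun a : ch C p => tsym k a b)
  (fun c a a' => tsym_lin_l k c a a' b).
by rewrite -LE linear_sum; apply: eq_bigr => i _; rewrite LE.
Qed.

Lemma tsym_sumr k p q (I : finType) (a : ch C p) (b : I -> ch D q) :
  tsym k a (\sum_i b i) = \sum_i tsym k a (b i).
Proof.
have [L LE] := linear_fun (f := fun b : ch D q => tsym k a b)
  (fun c b b' => tsym_lin_r k c a b b').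
by rewrite -LE linear_sum; apply: eq_bigr => i _; rewrite LE.
Qed.

End TensorSymbols.

Section Lspan.
Context {K : fieldType} {V : lmodType K} (A : set V).

Lemma lspan0 : lspan A 0.
Proof.
by exists 0%N, (fun=> 0), (fun=> 0); split; [case | rewrite big_ord0].
Qed.

Lemma lspan_gen v : A v -> lspan A v.
Proof.
by move=> Av; exists 1%N, (fun=> 1), (fun=> v); split=> //; rewrite big_ord1 scale1r.
Qed.

Lemma lspan_ind (P : V -> Prop) : P 0 -> (forall a u v, P u -> P v -> P (a *: u + v)) ->
  (forall v, A v -> P v) -> forall v, lspan A v -> P v.
Proof.
move=> P0 PL PA v [m [a [w [wA ->]]]].
apply: big_ind => //.
  by move=> u u' Pu Pu'; rewrite -[u]scale1r; exact: PL.
by move=> i _; rewrite -[_ *: _]addr0; apply: PL => //; exact: PA.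
Qed.

Lemma lspan_submod : submod (lspan A).
Proof. by split=> [|a u v]; [exact: lspan0 | exact: lspan_lin]. Qed.

End Lspan.

Section Blobs.
Context {R : realType} {K : fieldType} {n : nat} {F : system_of_fields R K n}.
Context (U : local_relations F).
Local Notation pt := (@pt R).
Local Notation space := (@Defs.space R).
Let H := sof_fields F.

Lemma bsym0 X (c : fl F n (bnd n.+1 X)) k (T : 'I_k -> space) : bsym U c T 0 = 0.
Proof.
have D0 : diagrams U c T 0 by exact: lspan0.
have := bsym_lin (-1) D0 D0.
by rewrite scaler0 add0r scaleN1r addNr.
Qed.

Lemma blob_diagram_perm X k (T : 'I_k -> space) (x : fl F n.+1 X) (s : 'S_k) :
  blob_diagram U T x -> blob_diagram U (T \o s) x.
Proof.
move=> [t [l [C h]]]; exists t, (l \o s), (C \o s) => j /=.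
have [h1 h2 h3] := h (s j); split=> // tw; apply: h3 => j' Tj'.
by apply: (tw (s^-1%g j')); rewrite /= permKV.
Qed.

Lemma diagrams_permE X (c : fl F n (bnd n.+1 X)) k (T : 'I_k -> space) (s : 'S_k) :
  diagrams U c (T \o s) = diagrams U c T.
Proof.
apply/seteqP; split=> u; last exact: diagrams_perm.
move=> /(diagrams_perm s^-1%g); congr (diagrams _ _ _ _).
by apply/funext => i /=; rewrite permKV.
Qed.

Lemma blob_nonempty X k (T : 'I_k -> space) (x : fl F n.+1 X) : blob_diagram U T x ->
  forall i, T i !=set0 /\ T i `<=` X.
Proof.
move=> [s [l [C h]]] i; have [b -> _] := h i; have [le [CS [v Cv] _ _ _] _] := b.
split; first by exists (to_end s (l i) v); exists v.
exact: to_end_sub b.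
Qed.

(** No blob is empty, so a configuration with an empty member carries no diagram. *)
Lemma diagrams_empty X (c : fl F n (bnd n.+1 X)) k (T : 'I_k -> space) i u :
  ~ (T i !=set0) -> diagrams U c T u -> u = 0.
Proof.
move=> Ti; move: u; apply: lspan_ind => // [a u v -> ->|v /blob_nonempty/(_ i)[//]].
by rewrite scaler0 addr0.
Qed.

(** ** Fields on the disjoint union of two manifolds *)

Lemma push_iso X X' (c : fl F n (bnd n.+1 X)) (c' : fl F n (bnd n.+1 X')) f :
  mfd n.+1 X -> homeo X X' f -> fpush F f c = c' ->
  exists (L : {linear topf F c -> topf F c'}) (L' : {linear topf F c' -> topf F c}),
    [/\ cancel L L', cancel L' L & forall u, inc F (L u) = fpush F f (inc F u)].
Proof.
move=> mX hf <-; have mX' := mfd_homeo hf mX; have [g [hg gK fK]] := homeo_inv hf.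
have n1 := leqnn n.+1; have nb : (n <= n.+1)%N by [].
have [_ _ mb _] := mX; have [_ _ mb' _] := mX'.
have [L LE] := fpush_linear H c mX mX' hf.
have gfc : fpush F g (fpush F f c : fl F n (bnd n.+1 X')) = c :> fl F n (bnd n.+1 X).
  rewrite -(fpush_comp H c nb mb mb' mb (homeo_bnd mX hf) (homeo_bnd mX' hg)).
  rewrite -[RHS](fpush_id H) //; apply: (fpush_ext H) => // v /bnd_sub Xv.
  exact: gK.
have [L' LE'] := fpush_linear H (fpush F f c : fl F n (bnd n.+1 X')) mX' mX hg.
rewrite gfc in L' LE'.
exists L, L'; split=> u; last by rewrite LE.
  apply: (Defs.inc_inj H mX).
  rewrite -LE' -LE -(fpush_comp H _ n1 mX mX' mX hf hg).
  by rewrite -[RHS](fpush_id H) //; apply: (fpush_ext H) => // v; exact: gK.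
apply: (Defs.inc_inj H mX').
rewrite -LE -LE' -(fpush_comp H _ n1 mX' mX mX' hg hf).
by rewrite -[RHS](fpush_id H) //; apply: (fpush_ext H) => // v; exact: fK.
Qed.

Lemma res_field_dsum X1 X2 (x1 : fl F n.+1 X1) (x2 : fl F n.+1 X2) :
  mfd n.+1 X1 -> mfd n.+1 X2 ->
  res F (field_dsum x1 x2) = dsum_bc (res F x1) (res F x2).
Proof.
move=> m1 m2; have p1 := mfd_polyhedron m1; have p2 := mfd_polyhedron m2.
rewrite /field_dsum (du_res H _ _ (leqnn n) (dsum_is_dsum m1 m2)).
rewrite (res_fpush H x1 (leqnn n) m1 (mfd_inj1 m1) (homeo_inj1 p1)).
rewrite (res_fpush H x2 (leqnn n) m2 (mfd_inj2 m2) (homeo_inj2 p2)).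
by rewrite /dsum_bc (bnd_inj1 n.+1 p1) (bnd_inj2 n.+1 p2).
Qed.

Lemma fpush_inj k X X' f (x y : fl F k X) : (k <= n.+1)%N -> mfd k X -> homeo X X' f ->
  fpush F f x = fpush F f y :> fl F k X' -> x = y.
Proof.
move=> kn mX hf e; have [g [hg gK _]] := homeo_inv hf.
have E z : fpush F g (fpush F f z : fl F k X') = z :> fl F k X.
  rewrite -(fpush_comp H z kn mX (mfd_homeo hf mX) mX hf hg).
  by rewrite -[RHS](fpush_id H) //; apply: (fpush_ext H).
by rewrite -(E x) e E.
Qed.

Lemma dsum_bc_inj X1 X2 (a c : fl F n (bnd n.+1 X1)) (b d : fl F n (bnd n.+1 X2)) :
  mfd n.+1 X1 -> mfd n.+1 X2 -> dsum_bc a b = dsum_bc c d -> a = c /\ b = d.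
Proof.
move=> m1 m2; have p1 := mfd_polyhedron m1; have p2 := mfd_polyhedron m2.
have [_ _ mb1 _] := m1; have [_ _ mb2 _] := m2.
have dB := is_dsum_bnd (dsum_is_dsum m1 m2).
rewrite (bnd_inj1 n.+1 p1) (bnd_inj2 n.+1 p2) in dB.
move=> /(du_inj (leqnn n) dB)[e1 e2]; split.
  by apply: (fpush_inj _ mb1 (homeo_inj1 (mfd_polyhedron mb1)) e1).
by apply: (fpush_inj _ mb2 (homeo_inj2 (mfd_polyhedron mb2)) e2).
Qed.

Section DisjointUnion.
Context (X1 X2 : space) (mX1 : mfd n.+1 X1) (mX2 : mfd n.+1 X2).
Context (c1 : fl F n (bnd n.+1 X1)) (c2 : fl F n (bnd n.+1 X2)).
Local Notation cc := (dsum_bc c1 c2).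

Let mdsum : mfd n.+1 (dsum X1 X2).
Proof. by case: (dsum_is_dsum mX1 mX2). Qed.

(** The tensor product axiom for the disjoint copies of X1 and X2, transported to X1
    and X2 themselves. *)
Lemma dsum_tens : exists (B : {linear tens (topf F c1) (topf F c2) -> topf F cc})
    (B' : {linear topf F cc -> tens (topf F c1) (topf F c2)}),
  [/\ cancel B B', cancel B' B &
      forall u v, inc F (B (pure_tens u v)) = field_dsum (inc F u) (inc F v)].
Proof.
have p1 := mfd_polyhedron mX1; have p2 := mfd_polyhedron mX2.
pose a : fl F n (bnd n.+1 (inj1 @` X1)) := fpush F inj1 c1.
pose b : fl F n (bnd n.+1 (inj2 @` X2)) := fpush F inj2 c2.
have ccE : cc = du F a b.
  by rewrite /a /b /dsum_bc (bnd_inj1 n.+1 p1) (bnd_inj2 n.+1 p2).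
have [L [Lb LE]] := du_tens_at (dsum_is_dsum mX1 mX2) ccE.
have [P1 [Q1 [P1K Q1K P1E]]] := push_iso (c := c1) (c' := a) mX1 (homeo_inj1 p1) erefl.
have [P2 [Q2 [P2K Q2K P2E]]] := push_iso (c := c2) (c' := b) mX2 (homeo_inj2 p2) erefl.
have [P PE] : exists P : {linear tens (topf F c1) (topf F c2) -> tens (topf F a) (topf F b)},
    forall v w, P (pure_tens v w) = pure_tens (P1 v) (P2 w).
  by apply: tens_lift => *; rewrite linearP ?pure_lin_l ?pure_lin_r.
have [Q QE] : exists Q : {linear tens (topf F a) (topf F b) -> tens (topf F c1) (topf F c2)},
    forall v w, Q (pure_tens v w) = pure_tens (Q1 v) (Q2 w).
  by apply: tens_lift => *; rewrite linearP ?pure_lin_l ?pure_lin_r.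
have PQ : cancel P Q.
  apply: tens_ind => [v w|x y hx hy|d x hx]; first by rewrite PE QE P1K P2K.
    by rewrite !linearD hx hy.
  by rewrite !linearZ hx.
have QP : cancel Q P.
  apply: tens_ind => [v w|x y hx hy|d x hx]; first by rewrite QE PE Q1K Q2K.
    by rewrite !linearD hx hy.
  by rewrite !linearZ hx.
have [L' LK L'K] := Lb.
have L'lin : linear L'.
  by move=> d u v; apply: (can_inj LK); rewrite linearP !L'K.
have [M ME] := linear_fun L'lin.
exists (L \o P : {linear _ -> _}), (Q \o M : {linear _ -> _}); split=> [t|u|u v] /=.
- by rewrite ME LK PQ.
- by rewrite ME QP L'K.
- by rewrite PE LE P1E P2E.
Qed.

Let B := sval (cid dsum_tens).
Let B' := sval (cid (svalP (cid dsum_tens))).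
Let BP : [/\ cancel B B', cancel B' B &
  forall u v, inc F (B (pure_tens u v)) = field_dsum (inc F u) (inc F v)] :=
  svalP (cid (svalP (cid dsum_tens))).

Definition join_fields (u : topf F c1) (v : topf F c2) : topf F cc := B (pure_tens u v).

Lemma inc_join u v : inc F (join_fields u v) = field_dsum (inc F u) (inc F v).
Proof. by case: BP => _ _ ->. Qed.

Lemma join_lin_l a u u' v :
  join_fields (a *: u + u') v = a *: join_fields u v + join_fields u' v.
Proof. by rewrite /join_fields pure_lin_l linearP. Qed.

Lemma join_lin_r a u v v' :
  join_fields u (a *: v + v') = a *: join_fields u v + join_fields u v'.
Proof. by rewrite /join_fields pure_lin_r linearP. Qed.

Lemma join0l v : join_fields 0 v = 0.
Proof. by have := join_lin_l (-1) 0 0 v; rewrite scaler0 add0r scaleN1r addNr. Qed.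

Lemma join0r u : join_fields u 0 = 0.
Proof. by have := join_lin_r (-1) u 0 0; rewrite scaler0 add0r scaleN1r addNr. Qed.

Lemma join_lift (M : lmodType K) (f : topf F c1 -> topf F c2 -> M) :
  (forall a v v' w, f (a *: v + v') w = a *: f v w + f v' w) ->
  (forall a v w w', f v (a *: w + w') = a *: f v w + f v w') ->
  exists L : {linear topf F cc -> M}, forall v w, L (join_fields v w) = f v w.
Proof.
move=> fl fr; have [L LE] := tens_lift fl fr; have [BK _ _] := BP.
by exists (L \o B' : {linear _ -> _}) => v w; rewrite /= BK LE.
Qed.

Lemma join_gen_eq (M : lmodType K) (f g : {linear topf F cc -> M}) :
  (forall v w, f (join_fields v w) = g (join_fields v w)) -> f =1 g.
Proof.
move=> h u; have [_ BK _] := BP; rewrite -(BK u).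
move: (B' u); apply: tens_ind => [v w|x y hx hy|a x hx]; first exact: h.
  by rewrite !linearD hx hy.
by rewrite !linearZ hx.
Qed.

Lemma diagrams_join p q k (T1 : 'I_p -> space) (T2 : 'I_q -> space) u v :
  (p + q)%N = k -> diagrams U c1 T1 u -> diagrams U c2 T2 v ->
  diagrams U cc (jconf T1 T2 : 'I_k -> space) (join_fields u v).
Proof.
move=> e Tu Tv; move: u Tu; apply: lspan_ind => [|a u u' h h'|u Tu].
- by rewrite join0l; exact: lspan0.
- by rewrite join_lin_l; exact: lspan_lin.
move: v Tv; apply: lspan_ind => [|a v v' h h'|v Tv].
- by rewrite join0r; exact: lspan0.
- by rewrite join_lin_r; exact: lspan_lin.
by apply: lspan_gen; rewrite /= inc_join; exact: blob_diagram_join.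
Qed.

(** By [blob_side] the blobs can be ordered so that those in X1 come first. *)
Lemma jconf_sort k (T : 'I_k -> space) (x : fl F n.+1 (dsum X1 X2)) :
  blob_diagram U T x ->
  exists p q (T1 : 'I_p -> space) (T2 : 'I_q -> space) (s : 'S_k),
  [/\ (p + q)%N = k, T = jconf T1 T2 \o s,
      (forall j, T1 j `<=` X1) & (forall j, T2 j `<=` X2)].
Proof.
move=> bd; have side := blob_side (dsum_is_dsum mX1 mX2) bd.
have [p [s [pk sP]]] := sorting_perm (fun i => `[< T i `<=` inj1 @` X1 >]).
have e : (p + (k - p))%N = k by rewrite subnKC.
have lt1 (j : 'I_p) : (j < k)%N by have := ltn_ord j; lia.
have lt2 (j : 'I_(k - p)) : (p + j < k)%N by have := ltn_ord j; lia.
have in1 (j : 'I_p) : T (s (Ordinal (lt1 j))) `<=` inj1 @` X1.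
  by apply/asboolP; rewrite sP /=.
have in2 (j : 'I_(k - p)) : T (s (Ordinal (lt2 j))) `<=` inj2 @` X2.
  have [_ [h|//]] := side (s (Ordinal (lt2 j))).
  by move: h => /asboolP; rewrite sP /= ltnNge leq_addr.
exists p, (k - p)%N, (fun j => ptl @` T (s (Ordinal (lt1 j)))),
  (fun j => ptl @` T (s (Ordinal (lt2 j)))), (s^-1)%g; split=> //.
- suff E : jconf (fun j => ptl @` T (s (Ordinal (lt1 j))))
     (fun j => ptl @` T (s (Ordinal (lt2 j)))) = T \o s.
    by rewrite E; apply/funext => i /=; rewrite permKV.
  apply/funext => i; have [[j ij]|[j ij]] := juxtP i e.
    rewrite /jconf (juxtl _ _ ij) /=.
    have -> : i = Ordinal (lt1 j) by exact: val_inj.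
    rewrite image_comp; apply/seteqP; split=> [_ [v Tv <-]|v Tv].
      by have [w _ wv] := in1 j _ Tv; rewrite -wv in Tv *.
    by exists v => //; have [w _ <-] := in1 j _ Tv.
  rewrite /jconf (juxtr _ _ ij) /=.
  have -> : i = Ordinal (lt2 j) by exact: val_inj.
  rewrite image_comp; apply/seteqP; split=> [_ [v Tv <-]|v Tv].
    by have [w _ wv] := in2 j _ Tv; rewrite -wv in Tv *.
  by exists v => //; have [w _ <-] := in2 j _ Tv.
- by move=> j _ [v /in1[w Xw <-] <-].
- by move=> j _ [v /in2[w Xw <-] <-].
Qed.

(** By [jconf_sort] and [blob_diagram_split] the blob complex of the disjoint union
    is spanned by juxtaposed diagrams. *)
Lemma blob_dsum_eq k (M : lmodType K) (f g : {linear blob_ch U cc k -> M}) :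
  (forall p q (T1 : 'I_p -> space) (T2 : 'I_q -> space) u v, (p + q)%N = k ->
     diagrams U c1 T1 u -> diagrams U c2 T2 v ->
     f (bsym U cc (jconf T1 T2) (join_fields u v)) =
     g (bsym U cc (jconf T1 T2) (join_fields u v))) ->
  f =1 g.
Proof.
move=> h; apply: linear_gen_eq => -[T w Tw].
rewrite -[pres_gen _ _]bsymE /=.
suff : diagrams U cc T w /\ f (bsym U cc T w) = g (bsym U cc T w) by case.
move: w Tw; apply: lspan_ind => [|a u v [Tu fu] [Tv fv]|w bd].
- by split; [exact: lspan0 | rewrite bsym0 !linear0].
- by split; [exact: lspan_lin | rewrite bsym_lin // !linearP fu fv].
split; first exact: lspan_gen.
have [p [q [T1 [T2 [s [e TE sub1 sub2]]]]]] := jconf_sort bd.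
(* a zero field represents 0, whatever its configuration is *)
have [w0|nz] := pselect (w = 0); first by rewrite w0 bsym0 !linear0.
have nzw : ~ fzero (inc F w) by move=> /(fzero_inc mdsum).
have bdJ : blob_diagram U (jconf T1 T2 : 'I_k -> space) (inc F w).
  have -> : jconf T1 T2 = T \o (s^-1)%g :> ('I_k -> space).
    by rewrite TE; apply/funext => i /=; rewrite permKV.
  exact: blob_diagram_perm bd.
have [x1 [x2 [xE b1 b2]]] := blob_diagram_split mX1 mX2 e sub1 sub2 bdJ nzw.
have := congr1 (res F) xE; rewrite (res_inc H w mdsum) res_field_dsum //.
move=> /(dsum_bc_inj mX1 mX2)[r1 r2].
have [u uE] := inc_ex mX1 (esym r1); have [v vE] := inc_ex mX2 (esym r2).
have -> : w = join_fields u v by apply: (Defs.inc_inj H mdsum); rewrite inc_join uE vE.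
rewrite TE bsym_perm !linearZ h //; apply: lspan_gen; rewrite /= ?uE ?vE //.
Qed.

End DisjointUnion.

End Blobs.

(** * The isomorphism *)

Arguments tsym {K C D} k {p q} a b.
Arguments tc_diff {K} C D k : simpl never.
Arguments blob_diff {R K n F} U {X} c k : simpl never.

Section Iso.
Context {R : realType} {K : fieldType} {n : nat} {F : system_of_fields R K n}.
Context (U : local_relations F).
Local Notation pt := (@pt R).
Local Notation space := (@Defs.space R).
Let H := sof_fields F.

(** ** Permuting juxtaposed configurations *)

Lemma jconf_perm p q k (T1 : 'I_p -> space) (T2 : 'I_q -> space) (t1 : 'S_p) (t2 : 'S_q) :
  (p + q)%N = k -> exists t : 'S_k,
  jconf (T1 \o t1) (T2 \o t2) = jconf T1 T2 \o t :> ('I_k -> space) /\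
  odd_perm t = odd_perm t1 (+) odd_perm t2.
Proof.
move=> e; subst k; have [t [tl tr ts]] := block_perm t1 t2; exists t; split=> //.
apply/funext => i /=; case: (split_ordP i) => j ->.
  rewrite tl /jconf (juxtl (lshift q j) j) //.
  by rewrite (juxtl (lshift q (t1 j)) (t1 j)).
rewrite tr /jconf (juxtr (rshift p j) j) //.
by rewrite (juxtr (rshift p (t2 j)) (t2 j)).
Qed.

(** The blobs on the left are recognized by the copy of the space in which they lie;
    this requires that they are not empty. *)
Lemma jconf_left p q k (T1 : 'I_p -> space) (T2 : 'I_q -> space) (i : 'I_k) :
  (p + q)%N = k -> (forall j, T1 j !=set0) -> (forall j, T2 j !=set0) ->
  (i < p)%N = `[< exists A : space, jconf T1 T2 i = inj1 @` A >].
Proof.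
move=> e ne1 ne2; have [[j ij]|[j ij]] := juxtP i e; rewrite ij.
  rewrite ltn_ord; apply/esym/asboolP; exists (T1 j).
  by rewrite /jconf (juxtl _ _ ij).
rewrite ltnNge leq_addr; apply/esym/asboolPn => -[A].
rewrite /jconf (juxtr _ _ ij) => E; have [v Tv] := ne2 j.
have : (inj1 @` A) (inj2 v) by rewrite -E; exists v.
by move=> Av; apply: (disjoint_out (inj12 A (T2 j)) Av); exists v.
Qed.

(** By [jconf_left] the permutation t preserves the two blocks. *)
Lemma jconf_uniq p q p' q' k (T1 : 'I_p -> space) (T2 : 'I_q -> space)
    (T1' : 'I_p' -> space) (T2' : 'I_q' -> space) (t : 'S_k) :
  (p + q)%N = k -> (p' + q')%N = k ->
  (forall j, T1 j !=set0) -> (forall j, T2 j !=set0) ->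
  (forall j, T1' j !=set0) -> (forall j, T2' j !=set0) ->
  jconf T1' T2' = jconf T1 T2 \o t ->
  exists (ep : p' = p) (eq : q' = q) (t1 : 'S_p) (t2 : 'S_q),
  [/\ T1' = T1 \o t1 \o cast_ord ep, T2' = T2 \o t2 \o cast_ord eq &
      odd_perm t = odd_perm t1 (+) odd_perm t2].
Proof.
move=> e e' ne1 ne2 ne1' ne2' E.
have tp i : (t i < p)%N = (i < p')%N.
  rewrite (jconf_left _ e ne1 ne2) (jconf_left _ e' ne1' ne2').
  by rewrite E.
have ep : p' = p.
  have pk : (p <= k)%N by rewrite -e leq_addr.
  have pk' : (p' <= k)%N by rewrite -e' leq_addr.
  rewrite -(card_lt pk) -(card_lt pk').
  rewrite -(fintype.card_image (@perm_inj _ t)); apply: eq_card => i; rewrite !inE.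
  apply/fintype.imageP/idP => [[j]|ip]; first by rewrite inE -tp => h ->.
  by exists (t^-1 i)%g; rewrite ?inE -?tp permKV.
have eq : q' = q by lia.
exists ep, eq; subst p' q' k.
have [t1 [t2 [tl tr ts]]] : exists (t1 : 'S_p) (t2 : 'S_q),
    [/\ forall i, t (lshift q i) = lshift q (t1 i),
      forall j, t (rshift p j) = rshift p (t2 j) &
      odd_perm t = odd_perm t1 (+) odd_perm t2].
  by apply: block_permP => i; rewrite tp /=.
exists t1, t2; split=> //; apply/funext => j; rewrite /= cast_ord_id.
  have := congr1 (fun f => f (lshift q j)) E; rewrite /= tl /jconf.
  rewrite (juxtl (lshift q j) j) //.
  rewrite (juxtl (lshift q (t1 j)) (t1 j)) //.
  by move=> /(congr1 (fun A => ptl @` A)); rewrite !image_comp !image_id.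
have := congr1 (fun f => f (rshift p j)) E; rewrite /= tr /jconf.
rewrite (juxtr (rshift p j) j) //.
rewrite (juxtr (rshift p (t2 j)) (t2 j)) //.
by move=> /(congr1 (fun A => ptl @` A)); rewrite !image_comp !image_id.
Qed.

Section DisjointUnion.
Context (X1 X2 : space) (mX1 : mfd n.+1 X1) (mX2 : mfd n.+1 X2).
Context (c1 : fl F n (bnd n.+1 X1)) (c2 : fl F n (bnd n.+1 X2)).
Local Notation cc := (dsum_bc c1 c2).
Local Notation C1 := (blob U c1).
Local Notation C2 := (blob U c2).
Local Notation join_fields := (join_fields mX1 mX2).

(** ** From the tensor product to the blob complex *)

Section Juxtaposition.
Context (k p q : nat).

(** In [tensor_complex] the symbols of degree other than k are zero in degree k,
    whence the second case. *)
Definition juxt_gen (g1 : blob_gen U c1 p) (g2 : blob_gen U c2 q) : blob_ch U cc k :=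
  if (p + q)%N == k then
    bsym U cc (jconf (bg_conf g1) (bg_conf g2)) (join_fields (bg_field g1) (bg_field g2))
  else 0.

Fact juxt_gen_l g2 : respects (@blob_rel _ _ _ _ U _ c1 p) (fun g1 => juxt_gen g1 g2).
Proof.
rewrite /juxt_gen => _ _ [a g g' g0 e1 e2 e|s g g' e1 e2] /=;
  case: eqP => [pq|_]; rewrite ?scaler0 ?addr0 //.
  rewrite e1 e2 e join_lin_l bsym_lin //; apply: diagrams_join => //; try exact: bg_mem.
    by rewrite -e1; exact: bg_mem.
  by rewrite -e2; exact: bg_mem.
have [t [tE ts]] := jconf_perm (bg_conf g) (bg_conf g2) s 1%g pq.
rewrite e1 e2; have -> : bg_conf g2 = bg_conf g2 \o (1%g : 'S_q).
  by apply/funext => i /=; rewrite perm1.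
rewrite tE bsym_perm ts odd_perm1 addbF; congr (_ *: bsym _ _ _ _).
by congr jconf; apply/funext => i /=; rewrite perm1.
Qed.

Fact juxt_gen_r g1 : respects (@blob_rel _ _ _ _ U _ c2 q) (juxt_gen g1).
Proof.
rewrite /juxt_gen => _ _ [a g g' g0 e1 e2 e|s g g' e1 e2] /=;
  case: eqP => [pq|_]; rewrite ?scaler0 ?addr0 //.
  rewrite e1 e2 e join_lin_r bsym_lin //; apply: diagrams_join => //; try exact: bg_mem.
    by rewrite -e1; exact: bg_mem.
  by rewrite -e2; exact: bg_mem.
have [t [tE ts]] := jconf_perm (bg_conf g1) (bg_conf g) 1%g s pq.
rewrite e1 e2; have -> : bg_conf g1 = bg_conf g1 \o (1%g : 'S_p).
  by apply/funext => i /=; rewrite perm1.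
rewrite tE bsym_perm ts odd_perm1 addFb; congr (_ *: bsym _ _ _ _).
by congr jconf; apply/funext => i /=; rewrite perm1.
Qed.

Definition juxt_map : ch C1 p -> ch C2 q -> blob_ch U cc k :=
  bilift juxt_gen_l juxt_gen_r.

Lemma juxt_map_sym (T1 : 'I_p -> space) (T2 : 'I_q -> space) u v : (p + q)%N = k ->
  diagrams U c1 T1 u -> diagrams U c2 T2 v ->
  juxt_map (bsym U c1 T1 u) (bsym U c2 T2 v) = bsym U cc (jconf T1 T2) (join_fields u v).
Proof.
move=> e Tu Tv; rewrite (bsymE (BlobGen Tu)) (bsymE (BlobGen Tv)).
by rewrite /juxt_map bilift_genE /juxt_gen e eqxx.
Qed.

Lemma juxt_map_deg a b : (p + q)%N <> k -> juxt_map a b = 0.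
Proof.
move=> ne; apply: (bilinear_gen_eq (g := fun _ _ => 0)) a b =>
  [b c a a'|a c b b'|b c a a'|a c b b'|i j].
- exact: bilift_lin_l.
- exact: bilift_lin_r.
- by rewrite scaler0 addr0.
- by rewrite scaler0 addr0.
- by rewrite /juxt_map bilift_genE /juxt_gen; case: eqP.
Qed.

End Juxtaposition.

Definition tens_to_blob_gen k (g : tgen C1 C2) : blob_ch U cc k :=
  let: (existT p a, existT q b) := g in juxt_map k a b.

Fact tens_to_blob_respects k : respects (@tc_rel _ C1 C2 k) (@tens_to_blob_gen k).
Proof.
move=> _ _ [p q a b h|p q c a a' b|p q c a b b'] /=.
- exact: juxt_map_deg.
- exact: bilift_lin_l.
- exact: bilift_lin_r.
Qed.

Definition tens_to_blob k : {linear tc_ch C1 C2 k -> blob_ch U cc k} :=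
  plift (@tens_to_blob_gen k) (@tens_to_blob_respects k).

Arguments tens_to_blob : simpl never.

Lemma tens_to_blob_sym k p q (a : ch C1 p) (b : ch C2 q) :
  tens_to_blob k (tsym k a b) = juxt_map k a b.
Proof. exact: plift_gen. Qed.

(** ** From the blob complex to the tensor product *)

(** As a function of the subspace, and not of the configuration, it is the same for
    all orders of the blobs ([theta_perm]). *)
Definition proj X (c : fl F n (bnd n.+1 X)) (D : set (topf F c)) :
    {linear topf F c -> topf F c} :=
  match pselect (submod D) with
  | left h => sval (cid (projection h))
  | right _ => \0
  end.

Lemma proj_in X (c : fl F n (bnd n.+1 X)) k (T : 'I_k -> space) u :
  diagrams U c T (proj (diagrams U c T) u).
Proof.
rewrite /proj; case: pselect => [h|]; last by case; exact: lspan_submod.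
by have [h1 _] := svalP (cid (projection h)); exact: h1.
Qed.

Lemma proj_id X (c : fl F n (bnd n.+1 X)) k (T : 'I_k -> space) u :
  diagrams U c T u -> proj (diagrams U c T) u = u.
Proof.
move=> Tu; rewrite /proj; case: pselect => [h|]; last by case; exact: lspan_submod.
by have [_ h1] := svalP (cid (projection h)); exact: h1.
Qed.

Section Theta.
Context (k p q : nat) (T1 : 'I_p -> space) (T2 : 'I_q -> space).

(** The projections make the symbols linear in arbitrary fields u and v. *)
Lemma theta_ex : exists L : {linear topf F cc -> tc_ch C1 C2 k}, forall u v,
  L (join_fields u v) = tsym k (bsym U c1 T1 (proj (diagrams U c1 T1) u) : ch C1 p)
                        (bsym U c2 T2 (proj (diagrams U c2 T2) v) : ch C2 q).
Proof.
apply: join_lift => [a u u' v|a u v v'].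
  by rewrite linearP bsym_lin ?tsym_lin_l //; exact: proj_in.
by rewrite linearP bsym_lin ?tsym_lin_r //; exact: proj_in.
Qed.

Definition theta : {linear topf F cc -> tc_ch C1 C2 k} := sval (cid theta_ex).

Lemma thetaE u v : theta (join_fields u v) =
  tsym k (bsym U c1 T1 (proj (diagrams U c1 T1) u) : ch C1 p)
         (bsym U c2 T2 (proj (diagrams U c2 T2) v) : ch C2 q).
Proof. exact: (svalP (cid theta_ex)). Qed.

End Theta.

Lemma theta_perm k p q (T1 : 'I_p -> space) (T2 : 'I_q -> space)
    (t1 : 'S_p) (t2 : 'S_q) w :
  theta k (T1 \o t1) (T2 \o t2) w = ((-1) ^+ t1 * (-1) ^+ t2) *: theta k T1 T2 w.
Proof.
have [L LE] := linear_scale (theta k T1 T2) ((-1) ^+ t1 * (-1) ^+ t2).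
rewrite -LE; apply: join_gen_eq => u v.
rewrite LE !thetaE !diagrams_permE !bsym_perm.
by rewrite [LHS]tsymZ_l tsymZ_r scalerA.
Qed.

(** A way to write T as a reordered juxtaposition.  The blobs are required to be
    non-empty because empty ones could be put on either side. *)
Record sorting k (T : 'I_k -> space) := Sorting {
  srt_p : nat;
  srt_q : nat;
  srt_1 : 'I_srt_p -> space;
  srt_2 : 'I_srt_q -> space;
  srt_perm : 'S_k;
  srt_size : (srt_p + srt_q)%N = k;
  srt_ne1 : forall j, srt_1 j !=set0;
  srt_ne2 : forall j, srt_2 j !=set0;
  srt_eq : T = jconf srt_1 srt_2 \o srt_perm }.

Definition sorting_val k (T : 'I_k -> space) (d : sorting T) (u : topf F cc) :
    tc_ch C1 C2 k :=
  (-1) ^+ srt_perm d *: theta k (@srt_1 _ _ d) (@srt_2 _ _ d) u.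

(** Two sortings differ by permutations of the two blocks, and [theta] changes by
    the signs of these ([theta_perm]). *)
Lemma sorting_val_uniq k (T : 'I_k -> space) (d d' : sorting T) u :
  sorting_val d u = sorting_val d' u.
Proof.
case: d d' => p q T1 T2 s e ne1 ne2 TE [p' q' T1' T2' s' e' ne1' ne2' TE'].
rewrite /sorting_val /=.
pose t := (s'^-1 * s)%g.
have E : jconf T1' T2' = jconf T1 T2 \o t.
  apply/funext => i; rewrite /= /t permM.
  have := congr1 (fun f => f (s'^-1 i)%g) TE; rewrite /= => <-.
  by rewrite TE' /= permKV.
have [ep [eq [t1 [t2 [E1 E2 ts]]]]] := jconf_uniq e e' ne1 ne2 ne1' ne2' E.
subst p' q'.
have -> : T1' = T1 \o t1 by rewrite E1; apply/funext => i /=; rewrite cast_ord_id.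
have -> : T2' = T2 \o t2 by rewrite E2; apply/funext => i /=; rewrite cast_ord_id.
rewrite theta_perm scalerA; congr (_ *: _).
have -> : odd_perm s = odd_perm s' (+) (odd_perm t1 (+) odd_perm t2).
  by rewrite -ts /t odd_permM odd_permV addbA addbb.
by rewrite !signr_addb.
Qed.

(** A configuration without a sorting carries no diagram, so its value is immaterial
    and taken to be zero. *)
Definition tens_val k (T : 'I_k -> space) (u : topf F cc) : tc_ch C1 C2 k :=
  match pselect (inhabited (sorting T)) with
  | left h => sorting_val (inhabited_witness h) u
  | right _ => 0
  end.

Lemma tens_valE k (T : 'I_k -> space) (d : sorting T) u : tens_val T u = sorting_val d u.
Proof.
rewrite /tens_val; case: pselect => [h|]; first exact: sorting_val_uniq.
by case; constructor.
Qed.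

Lemma tens_val_lin k (T : 'I_k -> space) a u v :
  tens_val T (a *: u + v) = a *: tens_val T u + tens_val T v.
Proof.
rewrite /tens_val; case: pselect => [h|_]; last by rewrite scaler0 addr0.
by rewrite /sorting_val linearP scalerDr !scalerA mulrC.
Qed.

Lemma tens_val_perm k (T : 'I_k -> space) (s : 'S_k) u :
  tens_val (T \o s) u = (-1) ^+ s *: tens_val T u.
Proof.
have ex (T' : 'I_k -> space) (s' : 'S_k) (d : sorting T') :
    exists d' : sorting (T' \o s'), forall u, sorting_val d' u = (-1) ^+ s' *: sorting_val d u.
  case: d => p q T1 T2 t e ne1 ne2 TE.
  have TE' : T' \o s' = jconf T1 T2 \o (s' * t)%g.
    by rewrite TE; apply/funext => i /=; rewrite permM.
  exists (Sorting e ne1 ne2 TE') => w.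
  by rewrite /sorting_val /= odd_permM signr_addb scalerA.
have [[d]|no] := pselect (inhabited (sorting T)).
  by have [d' d'E] := ex _ s d; rewrite (tens_valE d) (tens_valE d').
rewrite /tens_val; case: pselect => [[d]|_]; last first.
  by case: pselect => [h|_]; [case: no | rewrite scaler0].
case: no; have [d' _] := ex _ (s^-1)%g d; constructor.
move: d'; have -> // : (T \o s) \o (s^-1)%g = T.
by apply/funext => i /=; rewrite permKV.
Qed.

Fact tens_val_respects k : respects (@blob_rel _ _ _ _ U _ cc k)
  (fun g => tens_val (bg_conf g) (bg_field g)).
Proof.
move=> _ _ [a g1 g2 g e1 e2 e|s g g' e1 e2] /=.
  by rewrite e1 e2 e tens_val_lin.
by rewrite e1 e2 tens_val_perm.
Qed.

Definition blob_to_tens k : {linear blob_ch U cc k -> tc_ch C1 C2 k} :=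
  plift _ (@tens_val_respects k).

Arguments blob_to_tens : simpl never.

(** If some blob is empty, then u or v is zero and both sides vanish.  Otherwise the
    juxtaposition is sorted already, and the projections fix u and v. *)
Lemma blob_to_tens_sym k p q (T1 : 'I_p -> space) (T2 : 'I_q -> space) u v :
  (p + q)%N = k -> diagrams U c1 T1 u -> diagrams U c2 T2 v ->
  blob_to_tens k (bsym U cc (jconf T1 T2) (join_fields u v)) =
  tsym k (bsym U c1 T1 u : ch C1 p) (bsym U c2 T2 v : ch C2 q).
Proof.
move=> e Tu Tv.
have [[j nj]|/forallNP ne1] := pselect (exists j, ~ (T1 j !=set0)).
  by rewrite (diagrams_empty nj Tu) join0l !bsym0 linear0 tsym0l.
have [[j nj]|/forallNP ne2] := pselect (exists j, ~ (T2 j !=set0)).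
  by rewrite (diagrams_empty nj Tv) join0r !bsym0 linear0 tsym0r.
have Tuv := diagrams_join mX1 mX2 e Tu Tv.
rewrite (bsymE (BlobGen Tuv)) [LHS]plift_gen /=.
have TE : jconf T1 T2 = jconf T1 T2 \o (1%g : 'S_k).
  by apply/funext => i /=; rewrite perm1.
rewrite (tens_valE (Sorting e (fun j => contrapT (ne1 j))
  (fun j => contrapT (ne2 j)) TE)).
by rewrite /sorting_val /= odd_perm1 expr0 scale1r thetaE !proj_id.
Qed.

Lemma blob_to_tensK k : cancel (blob_to_tens k) (tens_to_blob k).
Proof.
move=> x.
have := @blob_dsum_eq _ _ _ _ U _ _ mX1 mX2 c1 c2 k _
  (tens_to_blob k \o blob_to_tens k : {linear _ -> _}) (idfun : {linear _ -> _}).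
apply=> {x} p q T1 T2 u v e Tu Tv.
apply: etrans (congr1 (tens_to_blob k) (blob_to_tens_sym e Tu Tv)) _.
by rewrite tens_to_blob_sym juxt_map_sym.
Qed.

Lemma tens_to_blobK k : cancel (tens_to_blob k) (blob_to_tens k).
Proof.
move=> x.
have := linear_gen_eq
  (blob_to_tens k \o tens_to_blob k : {linear tc_ch C1 C2 k -> tc_ch C1 C2 k})
  (idfun : {linear _ -> _}).
apply=> {x} -[[p a] [q b]].
change (blob_to_tens k (tens_to_blob k (tsym k a b)) = tsym k a b).
rewrite tens_to_blob_sym.
have [e|ne] := eqVneq (p + q)%N k; last first.
  by rewrite juxt_map_deg ?linear0 ?tsym_deg //; exact/eqP.
apply: (bilinear_gen_eq (f := fun a b => blob_to_tens k (juxt_map k a b))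
  (g := fun (a : ch C1 p) (b : ch C2 q) => tsym k a b)) a b =>
  [b c a a'|a c b b'|b c a a'|a c b b'|g1 g2].
- by rewrite [juxt_map _ _ _]bilift_lin_l linearP.
- by rewrite [juxt_map _ _ _]bilift_lin_r linearP.
- exact: tsym_lin_l.
- exact: tsym_lin_r.
- rewrite -!bsymE juxt_map_sym //; try exact: bg_mem.
  by rewrite blob_to_tens_sym //; exact: bg_mem.
Qed.

(** ** Compatibility with the differentials *)

Lemma sum_split (V : zmodType) p q k (e : (p + q)%N = k) (E : 'I_k -> V) :
  \sum_i E i = \sum_(j < p) E (cast_ord e (lshift q j)) +
               \sum_(j < q) E (cast_ord e (rshift p j)).
Proof.
subst k; rewrite big_split_ord.
by congr (_ + _); apply: eq_bigr => j _; rewrite cast_ord_id.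
Qed.

Lemma jconf_liftl p q k (T1 : 'I_p.+1 -> space) (T2 : 'I_q -> space)
    (i : 'I_k.+1) (j : 'I_p.+1) :
  (p + q)%N = k -> i = j :> nat ->
  jconf T1 T2 \o lift i = jconf (T1 \o lift j) T2 :> ('I_k -> space).
Proof.
move=> e ij; apply/funext => x /=; have [[y xy]|[y xy]] := juxtP x e.
  rewrite /jconf (juxtl _ _ xy) (juxtl _ (lift j y)) //=.
  by rewrite ij xy.
rewrite /jconf (juxtr _ _ xy) (juxtr _ y) //=.
by rewrite /bump xy ij; have := ltn_ord j; lia.
Qed.

Lemma jconf_liftr p q k (T1 : 'I_p -> space) (T2 : 'I_q.+1 -> space)
    (i : 'I_k.+1) (j : 'I_q.+1) :
  (p + q)%N = k -> i = (p + j)%N :> nat ->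
  jconf T1 T2 \o lift i = jconf T1 (T2 \o lift j) :> ('I_k -> space).
Proof.
move=> e ij; apply/funext => x /=; have [[y xy]|[y xy]] := juxtP x e.
  rewrite /jconf (juxtl _ _ xy) (juxtl _ y) //=.
  by rewrite /bump xy ij; have := ltn_ord y; lia.
rewrite /jconf (juxtr _ _ xy) (juxtr _ (lift j y)) //=.
by rewrite /bump xy ij; lia.
Qed.

(** Removing a blob of T1 or of T2 from their juxtaposition gives the two terms of
    the differential of the tensor product; the blobs of T2 have p predecessors,
    whence the sign of the second term. *)
Lemma blob_to_tens_diff k (x : blob_ch U cc k.+1) :
  blob_to_tens k (blob_diff U cc k x) = tc_diff C1 C2 k (blob_to_tens k.+1 x).
Proof.
have := @blob_dsum_eq _ _ _ _ U _ _ mX1 mX2 c1 c2 k.+1 _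
  (blob_to_tens k \o blob_diff U cc k : {linear _ -> _})
  (tc_diff C1 C2 k \o blob_to_tens k.+1 : {linear _ -> _}).
apply=> {x} p q T1 T2 u v e Tu Tv.
have Tuv := diagrams_join mX1 mX2 e Tu Tv.
change (blob_to_tens k (blob_diff U cc k (bsym U cc (jconf T1 T2) (join_fields u v))) =
  tc_diff C1 C2 k (blob_to_tens k.+1 (bsym U cc (jconf T1 T2) (join_fields u v)))).
rewrite blob_diff_sym // linear_sum blob_to_tens_sym // tc_diff_sym (sum_split e).
congr (_ + _).
  case: p T1 e Tu Tuv => [|p] T1 e Tu Tuv; first by rewrite big_ord0 tsym0l.
  have e' : (p + q)%N = k by lia.
  rewrite [diff_pred _ _ _]blob_diff_sym // tsym_suml.
  apply: eq_bigr => j _; rewrite linearZ_LR [RHS]tsymZ_l; congr (_ *: _).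
  rewrite (@jconf_liftl _ _ _ _ _ _ j) // blob_to_tens_sym //.
  exact: diagrams_remove.
case: q T2 e Tv Tuv => [|q] T2 e Tv Tuv; first by rewrite big_ord0 tsym0r scaler0.
have e' : (p + q)%N = k by lia.
rewrite [diff_pred _ _ _]blob_diff_sym // tsym_sumr scaler_sumr.
apply: eq_bigr => j _; rewrite linearZ_LR [in RHS]tsymZ_r scalerA exprD; congr (_ *: _).
rewrite (@jconf_liftr _ _ _ _ _ _ j) // blob_to_tens_sym //.
exact: diagrams_remove.
Qed.

Definition blob_dsum_map : chain_map (blob U cc) (tensor_complex C1 C2) :=
  @ChainMap K (blob U cc) (tensor_complex C1 C2) blob_to_tens blob_to_tens_diff.

End DisjointUnion.

End Iso.

(* The isomorphism is natural in homeomorphisms f1, f2, with induced chain maps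
   g1, g2 and g. *)
Theorem mainTheorem2 (R : realType) (K : fieldType) (n : nat)
    (F : system_of_fields R K n) (U : local_relations F) :
  exists Phi : forall (X1 X2 : manifold R n)
      (c1 : boundary_condition F n X1) (c2 : boundary_condition F n X2),
      chain_map (blob U (dsum_bc c1 c2))
                (tensor_complex (blob U c1) (blob U c2)),
    (forall (X1 X2 : manifold R n)
        (c1 : boundary_condition F n X1) (c2 : boundary_condition F n X2),
      chain_iso (Phi X1 X2 c1 c2)) /\
    (forall (X1 X2 X1' X2' : manifold R n) (f1 f2 : @pt R -> @pt R)
        (c1 : boundary_condition F n X1) (c2 : boundary_condition F n X2)
        (c1' : boundary_condition F n X1') (c2' : boundary_condition F n X2')
        (g1 : chain_map (blob U c1) (blob U c1'))
        (g2 : chain_map (blob U c2) (blob U c2'))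
        (g : chain_map (blob U (dsum_bc c1 c2)) (blob U (dsum_bc c1' c2'))),
      homeo X1 X1' f1 -> homeo X2 X2' f2 ->
      c1' = fpush F f1 c1 -> c2' = fpush F f2 c2 ->
      induced_by f1 g1 -> induced_by f2 g2 -> induced_by (dsum_map f1 f2) g ->
      forall (k : nat) (x : ch (blob U (dsum_bc c1 c2)) k),
        Phi X1' X2' c1' c2' k (g k x) = tensor_map g1 g2 k (Phi X1 X2 c1 c2 k x)).
Proof.
have H := sof_fields F.
exists (fun X1 X2 => blob_dsum_map U (manifoldP X1) (manifoldP X2)); split.
  move=> X1 X2 c1 c2 k; exists (tens_to_blob U (manifoldP X1) (manifoldP X2) c1 c2 k).
    exact: blob_to_tensK.
  exact: tens_to_blobK.
move=> X1 X2 X1' X2' f1 f2 c1 c2 c1' c2' g1 g2 g h1 h2 e1 e2 i1 i2 i k x.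
pose m1 := manifoldP X1; pose m2 := manifoldP X2.
pose m1' := manifoldP X1'; pose m2' := manifoldP X2'.
have := @blob_dsum_eq _ _ _ _ U _ _ m1 m2 c1 c2 k _
  (blob_to_tens U m1' m2' c1' c2' k \o g k : {linear _ -> _})
  (tensor_map g1 g2 k \o blob_to_tens U m1 m2 c1 c2 k : {linear _ -> _}).
apply=> {x} p q T1 T2 u v e Tu Tv.
have push X X' (c : boundary_condition F n X) (c' : boundary_condition F n X') f
    (m : nat) (T : 'I_m -> @Defs.space R) w : mfd n.+1 X -> mfd n.+1 X' -> homeo X X' f ->
    c' = fpush F f c -> diagrams U c T w -> exists w' : topf F c',
    inc F w' = fpush F f (inc F w) /\ diagrams U c' (fun j => f @` T j) w'.
  move=> mX mX' hf -> Tw; have [L LE] := fpush_linear H c mX mX' hf.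
  by exists (L w); rewrite LE; split=> //; exact: diagrams_homeo.
have [u' [u'E Tu']] := push _ _ _ _ _ _ _ _ m1 m1' h1 e1 Tu.
have [v' [v'E Tv']] := push _ _ _ _ _ _ _ _ m2 m2' h2 e2 Tv.
have uvE : inc F (join_fields m1' m2' u' v') =
    fpush F (dsum_map f1 f2) (inc F (join_fields m1 m2 u v)).
  rewrite !inc_join /field_dsum u'E v'E.
  by rewrite (fpush_dsum _ _ (leqnn n.+1) m1 m2 h1 h2).
change (blob_to_tens U m1' m2' c1' c2' k
    (g k (bsym U (dsum_bc c1 c2) (jconf T1 T2) (join_fields m1 m2 u v))) =
  tensor_map g1 g2 k (blob_to_tens U m1 m2 c1 c2 k
    (bsym U (dsum_bc c1 c2) (jconf T1 T2) (join_fields m1 m2 u v)))).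
rewrite (i _ _ _ _ (diagrams_join m1 m2 e Tu Tv) uvE).
have -> : (fun j : 'I_k => dsum_map f1 f2 @` jconf T1 T2 j) =
    jconf (fun j => f1 @` T1 j) (fun j => f2 @` T2 j).
  apply/funext => j; have [[l jl]|[l jl]] := juxtP j e.
    rewrite /jconf !(juxtl _ _ jl) !image_comp; apply: eq_imagel => w _ /=.
    by rewrite /dsum_map /= eqxx.
  rewrite /jconf !(juxtr _ _ jl) !image_comp; apply: eq_imagel => w _ /=.
  by rewrite /dsum_map /= oner_eq0.
rewrite blob_to_tens_sym // blob_to_tens_sym //.
by rewrite [RHS]tm_sym (i1 _ _ _ _ Tu u'E) (i2 _ _ _ _ Tv v'E).
Qed.
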